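(* Let $M$ be a finite dimensional $C^2$ complete connected Riemannian manifold and let $G,H:T^*M\to\mathbb{R}$ be two Tonelli Hamiltonians which Poisson commute. Then their Lax-Oleinik semi-groups commute: for every function $u:M\to\mathbb{R}\cup\{-\infty,+\infty\}$ and all real numbers $s,t>0$, $$T_G^{-s}T_H^{-t}u=T_H^{-t}T_G^{-s}u.$$
   Context: A Hamiltonian $H:T^*M\to\mathbb{R}$ is Tonelli if it is $C^2$ and: (1) for every $K>0$ there is $C^*(K)\in\mathbb{R}$ with $H(x,p)\geqslant K\|p\|-C^*(K)$ for all $(x,p)\in T^*M$; (2) for every $R\geqslant 0$, $\sup\{H(x,p):\|p\|\leqslant R\}<+\infty$; (3) for every $(x,p)\in T^*M$ the second fiber derivative $\partial^2H/\partial p^2(x,p)$ is positive definite. $T^*M$ carries the symplectic form $\Omega=-d\lambda$, $\lambda$ the canonical Liouville form; the Hamiltonian vector field $X_H$ is defined by $\Omega(X_H(x,p),\cdot)=d_{(x,p)}H$. $G$ and $H$ Poisson commute if $\Omega(X_G,X_H)$ vanishes everywhere on $T^*M$. The Lagrangian associated with $H$ is $L_H(x,v)=\max_{p\in T_x^*M}\big(p(v)-H(x,p)\big)$ for $(x,v)\in TM$. For $u:M\to\mathbb{R}\cup\{-\infty,+\infty\}$, $x\in M$, $s>0$, $$T_H^{-s}u(x)=\inf_{\gamma}\Big(u(\gamma(0))+\int_0^sL_H(\gamma(\sigma),\dot\gamma(\sigma))\,d\sigma\Big),$$ the infimum being over all absolutely continuous curves $\gamma:[0,s]\to M$ with $\gamma(s)=x$;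 $T_G^{-s}$ is defined in the same way from $L_G$. *)

(* Defs.v *)
From HB Require Import structures.
From mathcomp Require Import all_boot all_order all_algebra.
From mathcomp Require Import all_classical all_reals all_analysis.

Set Implicit Arguments.
Unset Strict Implicit.
Unset Printing Implicit Defensive.

Import Order.TTheory GRing.Theory Num.Theory.
Import numFieldNormedType.Exports.

Local Open Scope classical_set_scope.
Local Open Scope ring_scope.

(* [f] is of class C^k on the open set [U]. *)
Fixpoint Ck (R : realType) (V W : normedModType R) (k : nat)
    (U : set V) (f : V -> W) : Prop :=
  match k with
  | 0 => {within U, continuous f}
  | k'.+1 => (forall x, U x -> differentiable f x) /\
             (forall v : V, Ck k' U ('D_v f))
  end.

Record chart (R : realType) (n : nat) (M : topologicalType) := Chart {
  dom : set M;
  tgt : set 'rV[R]_n;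
  fwd : M -> 'rV[R]_n;
  bwd : 'rV[R]_n -> M;
  dom_open : open dom;
  tgt_open : open tgt;
  fwd_tgt : forall x, dom x -> tgt (fwd x);
  bwd_dom : forall y, tgt y -> dom (bwd y);
  fwdK : forall x, dom x -> bwd (fwd x) = x;
  bwdK : forall y, tgt y -> fwd (bwd y) = y;
  fwd_cont : {within dom, continuous fwd};
  bwd_cont : {within tgt, continuous bwd} }.

(* The atlas need not be maximal. On a manifold that is only C^2 the bundle
   charts of the cotangent bundle change in a C^1 way, so "C^2 on the cotangent
   bundle" refers to a given atlas: see [tonelli] below. *)
Record C2manifold (R : realType) (n : nat) (M : topologicalType) := C2Manifold {
  atlas : set (chart R n M);
  chart_at : M -> chart R n M;
  chart_at_atlas : forall x, atlas (chart_at x);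
  chart_at_dom : forall x, dom (chart_at x) x;
  transition_C2 : forall a b, atlas a -> atlas b ->
    Ck 2 (tgt a `&` bwd a @^-1` dom b) (fwd b \o bwd a);
  manifold_hausdorff : hausdorff_space M;
  manifold_second_countable : @second_countable M }.

(* The tangent space at [x] is 'rV_n, the space of coordinate vectors in the
   preferred chart [chart_at X x]; its dual, the cotangent space at [x], is
   'cV_n. The matrix [tmx X a x] converts tangent coordinates from the preferred
   chart at [x] to the chart [a]: [v] becomes [v *m tmx X a x]. Dually, the
   covector with coordinates [q] in [a] is [tmx X a x *m q]. *)
Definition tmx (R : realType) (n : nat) (M : topologicalType)
    (X : C2manifold R n M) (a : chart R n M) (x : M) : 'M[R]_n :=
  'J (fwd a \o bwd (chart_at X x)) (fwd (chart_at X x) x).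

Definition tangent (R : realType) (n : nat) (M : topologicalType)
  (X : C2manifold R n M) (x : M) := 'rV[R]_n.

Definition cotangent (R : realType) (n : nat) (M : topologicalType)
  (X : C2manifold R n M) (x : M) := 'cV[R]_n.

Definition pairing (R : realType) (n : nat) (p : 'cV[R]_n) (v : 'rV[R]_n) : R :=
  (v *m p) 0 0.

(* A metric with coefficients of class C^1, the largest class that is invariant
   under C^2 changes of charts. *)
Record riemannian (R : realType) (n : nat) (M : topologicalType)
    (X : C2manifold R n M) := Riemannian {
  gram : M -> 'M[R]_n;
  gram_sym : forall x, (gram x)^T = gram x;
  gram_pos : forall x (v : tangent X x), v != 0 -> 0 < (v *m gram x *m v^T) 0 0;
  gram_C1 : forall a, atlas X a -> Ck 1 (tgt a)
    (fun y => invmx (tmx X a (bwd a y)) *m gram (bwd a y)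
              *m (invmx (tmx X a (bwd a y)))^T) }.

Section riemannian_geometry.
Variables (R : realType) (n : nat) (M : topologicalType).
Variables (X : C2manifold R n M) (g : riemannian X).

Definition tnorm (x : M) (v : tangent X x) : R :=
  Num.sqrt ((v *m gram g x *m v^T) 0 0).

Definition conorm (x : M) (p : cotangent X x) : R :=
  sup [set pairing p v | v in [set v | tnorm (x := x) v <= 1]].

Definition velocity (c : R -> M) (t : R) : tangent X (c t) :=
  derive1 (fwd (chart_at X (c t)) \o c) t.

Definition C1curve (c : R -> M) : Prop :=
  continuous c /\
  forall a, atlas X a -> Ck 1 (c @^-1` dom a) (fwd a \o c : R -> 'rV[R]_n).

Definition curve_length (c : R -> M) (r s : R) : \bar R :=
  (\int[@lebesgue_measure R]_(t in `[r, s]) (tnorm (velocity c t))%:E)%E.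

(* Every C^1 curve on [0, 1] extends to a C^1 curve on the real line. *)
Definition rdist (x y : M) : \bar R :=
  ereal_inf [set curve_length c 0 1 | c in
    [set c | [/\ C1curve c, c 0 = x & c 1 = y]]].

Definition rcomplete : Prop :=
  forall u : nat -> M,
    (forall e : R, 0 < e -> exists N : nat, forall i j : nat,
       (N <= i)%N -> (N <= j)%N -> (rdist (u i) (u j) < e%:E)%E) ->
    exists x : M, u @ \oo --> x.

(* Only the values of [c] on [r, s] matter. *)
Definition abs_cont_curve (r s : R) (c : R -> M) : Prop :=
  forall e : R, 0 < e -> exists2 d : R, 0 < d &
    forall (m : nat) (a b : 'I_m -> R),
      (forall i, [/\ r <= a i, a i <= b i & b i <= s]) ->
      trivIset setT (fun i => `]a i, b i[%classic) ->
      \sum_(i < m) (b i - a i) < d ->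
      (\sum_(i < m) rdist (c (a i)) (c (b i)) < e%:E)%E.

End riemannian_geometry.

Section hamiltonian.
Variables (R : realType) (n : nat) (M : topologicalType).
Variable (X : C2manifold R n M).

Definition hamiltonian := forall x : M, cotangent X x -> R.

Definition in_chart (H : hamiltonian) (a : chart R n M)
    (z : 'rV[R]_n * 'cV[R]_n) : R :=
  H (bwd a z.1) (tmx X a (bwd a z.1) *m z.2).

Definition tonelli (g : riemannian X) (H : hamiltonian) : Prop :=
  [/\ (forall a, atlas X a -> Ck 2 [set z | tgt a z.1] (in_chart H a)),
      (forall K : R, 0 < K -> exists C : R, forall x (p : cotangent X x),
         H x p >= K * conorm g p - C),
      (forall r : R, 0 <= r -> exists B : R, forall x (p : cotangent X x),
         conorm g p <= r -> H x p <= B) &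
      (forall x (p w : cotangent X x), w != 0 ->
         0 < 'D_w ('D_w (H x : 'cV[R]_n -> R)) p)].

(* In the bundle coordinates (y, q) given by a chart, a tangent vector xi to the
   cotangent bundle is projected by the differential of the bundle projection to
   xi.1. *)
Definition liouville (z xi : 'rV[R]_n * 'cV[R]_n) : R := pairing z.2 xi.1.

(* d theta (xi, eta) for constant coordinate vector fields xi and eta, whose
   bracket vanishes. *)
Definition extd (V : normedModType R) (theta : V -> V -> R) (z xi eta : V) : R :=
  'D_xi (fun w => theta w eta) z - 'D_eta (fun w => theta w xi) z.

Definition Omega (z xi eta : 'rV[R]_n * 'cV[R]_n) : R :=
  - extd liouville z xi eta.

Definition is_hamiltonian_vector (f : 'rV[R]_n * 'cV[R]_n -> R)
    (z xi : 'rV[R]_n * 'cV[R]_n) : Prop :=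
  forall eta, Omega z xi eta = 'd f z eta.

Definition poisson_commute (G H : hamiltonian) : Prop :=
  forall a, atlas X a -> forall z : 'rV[R]_n * 'cV[R]_n, tgt a z.1 ->
  forall xi eta : 'rV[R]_n * 'cV[R]_n,
    is_hamiltonian_vector (in_chart G a) z xi ->
    is_hamiltonian_vector (in_chart H a) z eta ->
    Omega z xi eta = 0.

Definition lagrangian (H : hamiltonian) (x : M) (v : tangent X x) : \bar R :=
  ereal_sup [set (pairing p v - H x p)%:E | p in [set: cotangent X x]].

(* The library sets -oo + +oo = -oo. The infimum does not depend on this
   convention: M is connected, so if u takes the value -oo at some point, a C^1
   curve issued from that point has finite action and the infimum is -oo. *)
Definition lax_oleinik (g : riemannian X) (H : hamiltonian) (s : R)
    (u : M -> \bar R) (x : M) : \bar R :=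
  ereal_inf [set (u (c 0%R) + \int[@lebesgue_measure R]_(t in `[0%R, s])
                                lagrangian H (velocity X c t))%E
            | c in [set c : R -> M | abs_cont_curve g 0 s c /\ c s = x]].

End hamiltonian.

(* Main.v *)
Require Import Defs.
From HB Require Import structures.
From mathcomp Require Import all_boot all_order all_algebra.
From mathcomp Require Import all_classical all_reals all_analysis.
From mathcomp Require Import measurable_realfun ring lra.
Import Order.TTheory GRing.Theory Num.Theory.
Import numFieldNormedType.Exports.
Local Open Scope classical_set_scope.
Local Open Scope ring_scope.

(** The semigroups are infima of [u z] plus the action kernels of [H] and [G], so the
    theorem says that a broken path made of an [H]-curve followed by a [G]-curve can be
    replaced, at arbitrarily small extra cost, by a [G]-curve followed by an [H]-curve.

    In one chart and for short times, replace the [H]-curve by an almost minimal chain of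
    [N] short segments, with momenta [q_i]. Minimality gives a discrete Hamilton equation
    for [(x_i, q_i)]. It conserves both [H] and [G] up to [O(1/N)]: the conservation of [H]
    bounds the momenta, the conservation of [G] says that [G] takes the same value at both
    ends of the chain. The first variation of the cost of the chain then lets one slide its
    endpoints: the final one along the given [G]-curve, the initial one in the direction
    [dG/dp]. Convexity of [G] shows that the total cost does not increase.

    Globally, if the swap fails for times [(t, s)] with a loss proportional to [s t], cut
    both curves into many pieces: the swap fails, with the same relative loss, on one of
    the small squares, at a point that the superlinearity of [H] and [G] puts at a small
    distance. Iterating yields a Cauchy sequence, and completeness yields a point near which
    the local statement is violated. *)

Set Implicit Arguments.
Unset Strict Implicit.
Unset Printing Implicit Defensive.

(** No minimizing curve and no Hamiltonian flow is constructed: a discrete chain has a first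
    variation in finitely many variables, and a near minimizer suffices. Its momenta are not bounded
    in advance, whereas the Taylor and convexity constants of a Hamiltonian are uniform only for
    bounded momenta. Hence [LP] replaces the Lagrangian by a maximum over momenta of norm at most
    [P]. It is below the true Lagrangian, so chains sampled from a given curve cost no more than the
    curve, up to a small error; and conservation of energy keeps the momenta of a near minimal chain
    below some [P1 < P], where the truncation changes nothing.

    The constant of the quadratic error in the variation of a chain blows up as its time step tends
    to 0. So the chain is discretized first, and the sliding step is chosen afterwards. The
    increments of the given [G]-curve, which is only absolutely continuous, need not be of the order
    of that step; their squares are absorbed by its action.

    The Lagrangian along a curve is not shown to be measurable, so its integral is handled as a
    lower integral. *)

Section nnsfun.
Import HBNNSimple.
Lemma measurable_EFin_nnsfun d (T : measurableType d) (R : realType)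
  (u : {nnsfun T >-> R}) : measurable_fun [set: T] (EFin \o (u : T -> R)).
Proof. exact/measurable_EFinP. Qed.

End nnsfun.

(** * Lower integrals of arbitrary functions *)

Section lower_integral.
Context (R : realType).
Local Notation mu := (@lebesgue_measure R).
Local Open Scope ereal_scope.
Import HBNNSimple.
Implicit Types (f g : R -> \bar R) (A B D N : set R).

Lemma proj_nnsfunE (h : {nnsfun (measurableTypeR R) >-> R}) D (mD : measurable D) x :
  proj_nnsfun h mD x = (if x \in D then h x else 0)%R.
Proof.
by rewrite -(congr1 (fun u => u x) (mrestrict h mD)).
Qed.

Lemma mkc D f : \int[mu]_(x in D) f x = \int[mu]_x (f \_ D) x.
Proof. by rewrite integral_mkcond. Qed.

Lemma le_integral_nnsfun f (h : {nnsfun (measurableTypeR R) >-> R}) :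
  (forall x, (h x)%:E <= f x) -> \int[mu]_x (h x)%:E <= \int[mu]_x f x.
Proof.
move=> hf; rewrite integralT_nnsfun.
have f0 x : 0 <= f x by apply: le_trans (hf x); rewrite lee_fin; exact: fun_ge0.
rewrite ge0_integralTE//; apply: ereal_sup_ubound; by exists h.
Qed.

Lemma integral_le_nnsfun f (c : \bar R) : (forall x, 0 <= f x) ->
  (forall h : {nnsfun (measurableTypeR R) >-> R},
    (forall x, (h x)%:E <= f x) -> \int[mu]_x (h x)%:E <= c) ->
  \int[mu]_x f x <= c.
Proof.
move=> f0 H; rewrite ge0_integralTE//.
by apply: ge_ereal_sup => _ [h hf <-]; rewrite -integralT_nnsfun; exact: H.
Qed.

(** A simple function below [f] is below [g] once it is set to 0 on [N], and this does not change
    its integral. *)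
Lemma ge0_le_integral_ae f g N : measurable N -> mu N = 0 ->
  (forall x, 0 <= f x) -> (forall x, 0 <= g x) ->
  (forall x, ~ N x -> f x <= g x) -> \int[mu]_x f x <= \int[mu]_x g x.
Proof.
move=> mN N0 f0 g0 fg; apply: integral_le_nnsfun => // h hf.
pose k := proj_nnsfun h (measurableC mN).
have kE x : k x = (if x \in N then 0 else h x)%R.
  by rewrite /k proj_nnsfunE in_setC; case: (x \in N).
apply: (@le_trans _ _ (\int[mu]_x (k x)%:E)); last first.
  apply: le_integral_nnsfun => x; rewrite kE; case: ifPn => [//|].
  rewrite notin_setE => Nx; exact: le_trans (hf x) (fg _ Nx).
suff -> : \int[mu]_x (h x)%:E = \int[mu]_x (k x)%:E by [].
apply: ae_eq_integral; [exact: measurableT|exact: measurable_EFin_nnsfun|exact: measurable_EFin_nnsfun|].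
exists N; split => // x /= ; apply: contra_notP => Nx _.
change ((h x)%:E = (k x)%:E); rewrite (kE x) ifN// notin_setE //.
Qed.

(** For one inequality, a simple function below the restriction of [f] to the union is cut into its
    two restrictions. For the other, simple functions below the restrictions to [A] and [B] are
    added; disjointness keeps the sum below [f]. *)
Lemma ge0_integral_setU_lower f A B : measurable A -> measurable B ->
  [disjoint A & B] -> (forall x, 0 <= f x) ->
  \int[mu]_(x in A `|` B) f x = \int[mu]_(x in A) f x + \int[mu]_(x in B) f x.
Proof.
move=> mA mB dAB f0.
have g0 D x : 0 <= (f \_ D) x by rewrite /patch; case: ifP.
rewrite mkc.
apply/eqP; rewrite eq_le; apply/andP; split.
  apply: integral_le_nnsfun => // h hf.
  have E : \int[mu]_x (h x)%:E = \int[mu]_(x in A `|` B) (h x)%:E.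
    rewrite [RHS]mkc; congr (integral _ _ _); apply/funext => x.
    rewrite /patch; case: ifPn => // xAB.
    have := hf x; rewrite /patch (negbTE xAB) lee_fin => h0.
    by apply/eqP; rewrite eqe eq_le h0 /=; exact: fun_ge0.
  rewrite E ge0_integral_setU//=; [|exact/measurable_funTS/measurable_EFinP|
    by move=> x _; rewrite lee_fin; exact: fun_ge0].
  have le D : measurable D -> D `<=` A `|` B ->
      \int[mu]_(x in D) (h x)%:E <= \int[mu]_(x in D) f x.
    move=> mD DAB; rewrite mkc [leRHS]mkc.
    have -> : (EFin \o h) \_ D = (fun x => (proj_nnsfun h mD x)%:E).
      by apply/funext => x; rewrite proj_nnsfunE /patch; case: ifP.
    apply: le_integral_nnsfun => x; rewrite proj_nnsfunE /patch.
    have := hf x; rewrite /patch; case: ifPn => [_|].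
      by case: ifP.
    rewrite notin_setE => xAB _.
    by case: ifPn => [|//]; rewrite inE => /DAB.
  by apply: leeD; apply: le.
rewrite (mkc A f) (mkc B f).
have i0 D : 0 <= \int[mu]_x (f \_ D) x by apply: integral_ge0.
(* Once the left side is finite, the terms can be moved across the inequality one at a time, and
   each supremum over simple functions is treated alone. *)
have [->|ltA] := eqVneq (\int[mu]_x (f \_ (A `|` B)) x) +oo; first exact: leey.
have leU D : measurable D -> D `<=` A `|` B ->
    \int[mu]_x (f \_ D) x <= \int[mu]_x (f \_ (A `|` B)) x.
  move=> mD DAB; apply: (@ge0_le_integral_ae _ _ set0) => //.
  move=> x _; rewrite /patch; case: ifPn => [|_].
    by rewrite inE => /DAB xAB; rewrite ifT// inE.
  by case: ifP.
have finU D : measurable D -> D `<=` A `|` B -> \int[mu]_x (f \_ D) x \is a fin_num.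
  move=> mD DAB; rewrite ge0_fin_numE//; apply: le_lt_trans (leU _ mD DAB) _.
  by rewrite ltey.
have fB : \int[mu]_x (f \_ B) x \is a fin_num by apply: finU => //; exact: subsetUr.
rewrite -leeBrDr//; apply: integral_le_nnsfun => // h1 h1f.
rewrite leeBrDr// addeC.
have f1 : \int[mu]_x (h1 x)%:E \is a fin_num.
  rewrite ge0_fin_numE; last first.
    by apply: integral_ge0 => x _; rewrite lee_fin; exact: fun_ge0.
  apply: le_lt_trans (le_integral_nnsfun h1f) _.
  by rewrite -ge0_fin_numE//; apply: finU => //; exact: subsetUl.
rewrite -leeBrDr//; apply: integral_le_nnsfun => // h2 h2f.
rewrite leeBrDr// -ge0_integralD//; last first.
  - exact/measurable_EFinP.
  - by move=> x _; rewrite lee_fin; exact: fun_ge0.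
  - exact/measurable_EFinP.
  - by move=> x _; rewrite lee_fin; exact: fun_ge0.
apply: (@le_integral_nnsfun _ (add_nnsfun h2 h1)) => x /=.
have := h1f x; have := h2f x; rewrite /patch EFinD !in_setU.
case: (boolP (x \in A)) => xA; case: (boolP (x \in B)) => xB //=.
- move: dAB => /disj_setPLR/(_ x); rewrite inE in xA; move=> /(_ xA).
  by rewrite inE in xB.
- by move=> a b; rewrite -[leRHS]add0e; exact: leeD.
- by move=> a b; rewrite -[leRHS]adde0; exact: leeD.
- by move=> a b; rewrite -[leRHS]adde0; exact: leeD.
Qed.

Lemma le_integral_ae f g D N : measurable N -> mu N = 0 ->
  (forall x, D x -> ~ N x -> f x <= g x) ->
  \int[mu]_(x in D) f x <= \int[mu]_(x in D) g x.
Proof.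
move=> mN N0 fg; rewrite integralE [leRHS]integralE.
apply: leeB.
  rewrite mkc [leRHS]mkc.
  apply: (ge0_le_integral_ae mN) => //.
  - by move=> x; rewrite /patch; case: ifP.
  - by move=> x; rewrite /patch; case: ifP.
  move=> x Nx; rewrite /patch; case: ifP => //.
  rewrite inE => Dx; apply: (@funepos_le _ _ [set x]) => //; last by rewrite inE.
  by move=> _ /[1!inE] ->; exact: fg.
rewrite mkc [leRHS]mkc.
apply: (ge0_le_integral_ae mN) => //.
- by move=> x; rewrite /patch; case: ifP.
- by move=> x; rewrite /patch; case: ifP.
move=> x Nx; rewrite /patch; case: ifP => //.
rewrite inE => Dx; apply: (@funeneg_le _ _ [set x]) => //; last by rewrite inE.
by move=> _ /[1!inE] ->; exact: fg.
Qed.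

Lemma le_integral_lower f g D : (forall x, D x -> f x <= g x) ->
  \int[mu]_(x in D) f x <= \int[mu]_(x in D) g x.
Proof. by move=> fg; apply: (@le_integral_ae _ _ _ set0) => // x Dx _; exact: fg. Qed.

Lemma integral_cst_itv (k r s : R) : (r <= s)%R ->
  \int[mu]_(x in `[r, s]) k%:E = (k * (s - r))%:E.
Proof.
rewrite le_eqVlt => /predU1P[->|rs]; rewrite integral_cst//= lebesgue_measure_itv/= lte_fin.
  by rewrite ltxx mule0 subrr mulr0.
by rewrite rs -EFinD -EFinM.
Qed.

(** The bound by [- B] gives the negative part a finite integral on a bounded interval, so the
    difference of the two parts never reads [+oo - +oo] and can be split. *)
Lemma integral_split_lower f (B r m s : R) : (r <= m)%R -> (m <= s)%R -> (0 <= B)%R ->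
  (forall x, (r <= x <= s)%R -> (- B)%:E <= f x) ->
  \int[mu]_(x in `[r, s]) f x =
  \int[mu]_(x in `[r, m]) f x + \int[mu]_(x in `[m, s]) f x.
Proof.
move=> rm ms B0 fB.
(* The closed intervals share the point [m], which is a null set; it is removed from the second one
   to make them disjoint. *)
have oc (g : R -> \bar R) : (forall x, 0 <= g x) ->
    \int[mu]_(x in `[m, s]) g x = \int[mu]_(x in `]m, s]) g x.
  move=> g0; rewrite mkc [RHS]mkc.
  have L x : ~ [set m] x -> (g \_ `[m, s]) x = (g \_ `]m, s]) x.
    move=> /= xm; rewrite /patch; suff -> : (x \in `[m, s]%classic) = (x \in `]m, s]%classic) by [].
    apply/idP/idP; rewrite !inE /= !in_itv/= => /andP[mx ->]; rewrite andbT ?(ltW mx)//.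
    by rewrite lt_neqAle mx andbT; apply/eqP => mx'; exact: xm.
  apply/eqP; rewrite eq_le; apply/andP; split; apply: (@ge0_le_integral_ae _ _ [set m]) => //;
    by [rewrite lebesgue_measure_set1|move=> x; rewrite /patch; case: ifP|move=> x /L ->].
have spl (g : R -> \bar R) : (forall x, 0 <= g x) ->
    \int[mu]_(x in `[r, s]) g x =
    \int[mu]_(x in `[r, m]) g x + \int[mu]_(x in `[m, s]) g x.
  move=> g0; rewrite oc// -ge0_integral_setU_lower//.
  - by rewrite -itv_bndbnd_setU// bnd_simp.
  - apply/disj_setPLR => x; rewrite /= !in_itv/= => /andP[_ xm].
    by rewrite ltNge xm.
rewrite integralE [X in _ = X + _]integralE [X in _ = _ + X]integralE.
rewrite (spl f^\+)// (spl f^\-)//.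
have fin a b : (r <= a)%R -> (a <= b)%R -> (b <= s)%R -> \int[mu]_(x in `[a, b]) f^\- x \is a fin_num.
  move=> ra ab bs; rewrite ge0_fin_numE; last exact: integral_ge0.
  apply: (@le_lt_trans _ _ (\int[mu]_(x in `[a, b]) B%:E)).
    apply: le_integral_lower => x /=; rewrite in_itv/= => /andP[ax xb].
    rewrite funenegE ge_max lee_fin B0 andbT leeNl -EFinN fB//.
    by rewrite (le_trans ra ax) (le_trans xb bs).
  by rewrite integral_cst_itv// ltry.
have F1 := fin _ _ (lexx _) rm ms; have F2 := fin _ _ rm ms (lexx _).
by rewrite fin_num_oppeD// addeACA.
Qed.

(** The translated measure has the right values on half-open intervals, and these determine the
    Lebesgue measure. *)
Lemma lebesgue_measure_translation (h : R) (A : set R) : measurable A ->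
  mu ((fun x => x + h)%R @^-1` A) = mu A.
Proof.
move=> mA; have mf : measurable_fun [set: measurableTypeR R] (fun x : measurableTypeR R => (x + h)%R : measurableTypeR R).
  by apply: measurable_funD => //.
rewrite -[LHS]/(pushforward mu (fun x : measurableTypeR R => (x + h)%R : measurableTypeR R) A).
apply/esym/lebesgue_measure_unique => // X [[a b] _ <-] /=.
rewrite /pushforward.
have -> : (fun x => x + h)%R @^-1` `]a, b] = `](a - h)%R, (b - h)%R]%classic.
  by apply/seteqP; split => x /=; rewrite !in_itv/= ltrBlDr lerBrDr.
rewrite -[LHS]/(mu `]a, b]) -[RHS]/(mu `](a - h)%R, (b - h)%R]).
by rewrite !lebesgue_measure_itv/= !lte_fin ltrD2r -!EFinD; case: ifP => // _; congr _%:E; ring.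
Qed.

Lemma integral_shift_lower f (r s h : R) :
  \int[mu]_(x in `[(r + h)%R, (s + h)%R]) f x = \int[mu]_(x in `[r, s]) f (x + h)%R.
Proof.
have sh (k : R) : measurable_fun [set: measurableTypeR R] (fun x : measurableTypeR R => (x + k)%R : measurableTypeR R).
  by apply: measurable_funD => //.
have E (h0 : {nnsfun (measurableTypeR R) >-> R}) (k : R) :
   \int[mu]_x (h0 (x + k)%R)%:E = \int[mu]_x (h0 x)%:E.
  rewrite -[LHS](@ge0_integral_pushforward _ _ _ _ _ (fun x : measurableTypeR R => (x + k)%R : measurableTypeR R) (sh k) mu setT (EFin \o h0))//.
  - apply: eq_measure_integral => A mA _; exact: lebesgue_measure_translation.
  - exact/measurable_EFinP.
  - by move=> x _; rewrite lee_fin; exact: fun_ge0.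
(* One inequality for all translations [a] is enough, since the other one is obtained by translating
   back. *)
have le (g : R -> \bar R) (a : R) : (forall x, 0 <= g x) ->
    \int[mu]_x g (x + a)%R <= \int[mu]_x g x.
  move=> g0; apply: integral_le_nnsfun => // w hg.
  rewrite -(E w (- a)%R); apply: le_integral_lower => x _.
  by have := hg (x - a)%R; rewrite subrK.
have eq (g : R -> \bar R) (a : R) : (forall x, 0 <= g x) ->
    \int[mu]_x g (x + a)%R = \int[mu]_x g x.
  move=> g0; apply/eqP; rewrite eq_le le//=.
  have := @le (fun x => g (x + a)%R) (- a)%R.
  by under eq_integral do rewrite subrK; exact.
have eqD (g : R -> \bar R) : (forall x, 0 <= g x) ->
   \int[mu]_(x in `[(r + h)%R, (s + h)%R]) g x = \int[mu]_(x in `[r, s]) g (x + h)%R.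
  move=> g0; rewrite mkc -(eq _ h); last first.
    by move=> x; rewrite /patch; case: ifP.
  rewrite [RHS]mkc; congr (integral _ _ _); apply/funext => x.
  rewrite /patch; congr (if _ then _ else _).
  by apply/idP/idP; rewrite !inE /= !in_itv /= !lerD2r.
rewrite integralE [RHS]integralE (eqD f^\+)// (eqD f^\-)//.
by congr (_ - _); apply: eq_integral => x _; rewrite ?funeposE ?funenegE.
Qed.

End lower_integral.

(** * Absolutely continuous functions of a real variable *)

Section list_ac.
Context (R : realType).
Implicit Types (f V : R -> R) (l : seq (R * R)).
Local Notation TV := total_variation.

Definition disj_itv (p q : R * R) : bool := (p.2 <= q.1) || (q.2 <= p.1).

(** A list, and not an indexed family, because refining a packing amounts to concatenating lists.
    The intervals may share end points, as those of a partition do. *)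
Definition packing r s l : bool :=
  all (fun p => [&& r <= p.1, p.1 <= p.2 & p.2 <= s]) l && pairwise disj_itv l.

Definition plen l := \sum_(p <- l) (p.2 - p.1).
Definition pvar f l := \sum_(p <- l) `|f p.2 - f p.1|.

Definition ac_on r s f := forall e : R, 0 < e -> exists2 d : R, 0 < d &
  forall l, packing r s l -> plen l < d -> pvar f l < e.

Lemma packing_cat r a s l1 l2 : r <= a -> a <= s ->
  packing r a l1 -> packing a s l2 -> packing r s (l1 ++ l2).
Proof.
move=> ra as_ /andP[/allP al1 p1] /andP[/allP al2 p2].
apply/andP; split.
  rewrite all_cat; apply/andP; split; apply/allP => p pl.
    by have /and3P[-> -> /le_trans->] := al1 _ pl.
  by have /and3P[/(le_trans ra) -> -> ->] := al2 _ pl.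
rewrite pairwise_cat p1 p2 !andbT; apply/allrelP => p q pl ql.
have /and3P[_ _ pa] := al1 _ pl; have /and3P[aq _ _] := al2 _ ql.
by rewrite /disj_itv (le_trans pa aq).
Qed.

Lemma partition_packing a b f s : itv_partition a b s ->
  exists l, [/\ packing a b l, plen l = b - a & pvar f l = variation a b f s].
Proof.
elim: s a => [|h t IH] a P.
  exists [::]; rewrite /plen /pvar !big_nil variation_nil.
  by have -> := itv_partition_nil P; rewrite subrr.
have ah : a < h by case: P => /= /andP[].
have P' := itv_partition_cons P.
have [l [pl ll vl]] := IH _ P'.
have hb := itv_partition_le P'.
exists ([:: (a, h)] ++ l); split.
- apply: (packing_cat (ltW ah) hb) => //.
  by rewrite /packing /= lexx (ltW ah) lexx.
- by rewrite /plen big_cons /= -/(plen l) ll addrC subrKA.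
- rewrite /pvar big_cons /= -/(pvar f l) vl.
  rewrite -[h :: t]cat1s (variation_cat _ (ltW ah) hb (itv_partition1 ah) P').
  by congr (_ + _); rewrite /variation /= big_nat1.
Qed.

Lemma tv_packing a b f (e : R) : a <= b -> 0 < e -> TV a b f \is a fin_num ->
  exists l, [/\ packing a b l, plen l <= b - a & fine (TV a b f) <= pvar f l + e].
Proof.
rewrite le_eqVlt => /predU1P[->|ab] e0 fin.
  exists [::]; rewrite /plen /pvar !big_nil subrr; split => //.
  by rewrite total_variationxx add0r ltW.
have [_ [v [s Ps <-] <-]] := ub_ereal_sup_adherent e0 fin.
rewrite -/(total_variation a b f) => lt.
have [l [pl ll vl]] := partition_packing f Ps.
exists l; split => //; first by rewrite ll.
rewrite vl -lerBlDr -lee_fin EFinB fineK//; exact: ltW.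
Qed.

(** Each interval is replaced by a partition that realizes the total variation on it up to [e];
    hence the error [e *+ size l]. This reduces the variation of the total variation to the
    variation of [f] on a finer packing. *)
Lemma tv_packing_list r s f (e : R) l : 0 < e -> packing r s l ->
  (forall p, p \in l -> TV p.1 p.2 f \is a fin_num) ->
  exists l', [/\ packing r s l', plen l' <= plen l,
    (forall q, q \in l' -> exists2 p, p \in l & p.1 <= q.1 /\ q.2 <= p.2) &
    \sum_(p <- l) fine (TV p.1 p.2 f) <= pvar f l' + e *+ size l].
Proof.
move=> e0; elim: l => [|p l IH] /=.
  by move=> _ _; exists [::]; rewrite /plen /pvar !big_nil addr0.
rewrite /packing /= => /andP[/andP[/and3P[rp pp ps] al] /andP[dp pl]] fin.
have Pl : packing r s l by rewrite /packing al pl.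
have fl q : q \in l -> TV q.1 q.2 f \is a fin_num.
  by move=> ql; apply: fin; rewrite inE ql orbT.
have fp : TV p.1 p.2 f \is a fin_num by apply: fin; rewrite inE eqxx.
have [l' [pl' ll' sub var]] := IH Pl fl.
have [k [pk lk vk]] := tv_packing pp e0 fp.
have [/allP ak pwk] := andP pk; have [/allP al' pwl'] := andP pl'.
exists (k ++ l'); split.
- rewrite all_cat; apply/andP; split.
    apply/andP; split; apply/allP => q ql; last exact: al'.
    by have /and3P[a1 -> a2] := ak _ ql; rewrite (le_trans rp a1) (le_trans a2 ps).
  rewrite pairwise_cat pwk pwl' !andbT; apply/allrelP => q q' qk q'l.
  have /and3P[a1 a2 a3] := ak _ qk.
  have [p' p'l [b1 b2]] := sub _ q'l.
  move/allP: dp => /(_ _ p'l); rewrite /disj_itv => /orP[h|h]; apply/orP.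
    by left; rewrite (le_trans a3)// (le_trans h).
  by right; rewrite (le_trans b2)// (le_trans h).
- by rewrite /plen big_cat big_cons /= lerD.
- move=> q; rewrite mem_cat => /orP[qk|/sub[p' p'l h]].
    by exists p; rewrite ?inE ?eqxx//; have /and3P[a1 a2 a3] := ak _ qk.
  by exists p' => //; rewrite inE p'l orbT.
- rewrite big_cons /pvar big_cat /= mulrS addrACA; exact: lerD.
Qed.

Lemma ac_total_variation_lt r s f (e : R) : 0 < e -> ac_on r s f ->
  exists2 d : R, 0 < d & forall a b, r <= a -> a <= b -> b <= s -> b - a < d ->
    (TV a b f <= e%:E)%E.
Proof.
move=> e0 /(_ e e0)[d d0 H]; exists d => // a b ra ab bs bad.
rewrite /total_variation; apply: ge_ereal_sup => _ [v [t Pt <-] <-].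
have [l [/andP[/allP al pl] ll vl]] := partition_packing f Pt.
rewrite lee_fin -vl ltW// H// ?ll//; apply/andP; split => //.
apply/allP => p /al /and3P[a1 -> a2].
by rewrite (le_trans ra a1) (le_trans a2 bs).
Qed.

(** The variation is at most 1 on intervals shorter than [d], and finitely many of length [d / 2]
    cover [[a, b]]. *)
Lemma ac_bounded_variation r s f : ac_on r s f ->
  forall a b, r <= a -> a <= b -> b <= s -> TV a b f \is a fin_num.
Proof.
move=> ac a b ra ab bs.
have [d d0 H] := ac_total_variation_lt ltr01 ac.
have d20 : 0 < d / 2 by rewrite divr_gt0.
have K (k : nat) : forall x, a <= x -> x <= b -> x - a <= (d / 2) *+ k ->
    TV a x f \is a fin_num.
  elim: k => [|k IH] x ax xb.
    rewrite mulr0n subr_le0 => xa; have -> : x = a by apply/eqP; rewrite eq_le xa ax.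
    by rewrite total_variationxx.
  move=> xk; have [le|lt] := leP (x - a) (d / 2 *+ k); first exact: IH.
  pose y := a + (d / 2) *+ k.
  have ay : a <= y by rewrite lerDl mulrn_wge0// ltW.
  have yx : y <= x by rewrite /y; lra.
  rewrite (total_variationD f ay yx) fin_numD; apply/andP; split.
    by apply: IH => //; [exact: le_trans xb|rewrite /y addrAC subrr add0r].
  rewrite ge0_fin_numE ?total_variation_ge0//.
  apply: le_lt_trans (ltry 1); apply: H => //.
  - exact: le_trans ay.
  - exact: le_trans bs.
  - by move: xk; rewrite mulrSr /y; lra.
have [k Hk] : exists k : nat, b - a <= (d / 2) *+ k.
  exists (Num.bound ((b - a) / (d / 2))).
  rewrite -mulr_natl -ler_pdivrMr//; apply/ltW/archi_boundP.
  by rewrite divr_ge0 ?subr_ge0// ltW.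
exact: (K k).
Qed.

(** For [r <= s], the retraction of the line onto [[r, s]]. It does not increase lengths, so
    composing with it extends an absolutely continuous function to the line, by its end values. *)
Definition clamp (r s x : R) := Num.max r (Num.min x s).

Lemma clamp_itv r s x : r <= s -> r <= clamp r s x <= s.
Proof. by move=> rs; rewrite /clamp le_max lexx/= ge_max rs ge_min lexx orbT. Qed.

Lemma clamp_id r s x : r <= x <= s -> clamp r s x = x.
Proof. by rewrite /clamp => /andP[rx /min_idPl->]; apply/max_idPr. Qed.

Lemma clamp_homo r s : {homo clamp r s : x y / x <= y}.
Proof.
move=> x y xy; rewrite /clamp ge_max le_max lexx/= le_max; apply/orP; right.
by rewrite le_min !ge_min xy lexx orbT.
Qed.

Lemma clamp_dist r s x y : r <= s -> x <= y -> clamp r s y - clamp r s x <= y - x.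
Proof.
move=> rs xy; rewrite /clamp /Num.max /Num.min.
by case: (ltP x s) => xs; case: (ltP y s) => ys; do 2?case: ltP => ?; lra.
Qed.

Lemma packing_clamp r s a b l : r <= s -> packing a b l ->
  let l' := [seq (clamp r s p.1, clamp r s p.2) | p <- l] in
  packing r s l' /\ plen l' <= plen l.
Proof.
move=> rs /andP[/allP al pl] l'; split.
  apply/andP; split.
    apply/allP => _ /mapP[p /al /and3P[_ pp _] ->] /=.
    have /andP[-> _] := clamp_itv p.1 rs; have /andP[_ ->] := clamp_itv p.2 rs.
    by rewrite clamp_homo.
  rewrite pairwise_map; apply: sub_pairwise pl => p q /orP[h|h]; apply/orP => /=.
    by left; exact: clamp_homo.
  by right; exact: clamp_homo.
rewrite /plen big_map big_seq [leRHS]big_seq; apply: ler_sum => p /al /and3P[_ pp _] /=.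
exact: clamp_dist.
Qed.

Definition ac_global V := forall e : R, 0 < e -> exists2 d : R, 0 < d &
  forall a b l, packing a b l -> plen l < d -> pvar V l < e.

Lemma ac_clamp r s f : r <= s -> ac_on r s f -> ac_global (f \o clamp r s).
Proof.
move=> rs ac e /ac[d d0 H]; exists d => // a b l pl ld.
have [p1 p2] := packing_clamp rs pl.
have := H _ p1 (le_lt_trans p2 ld).
by rewrite /pvar big_map.
Qed.

Lemma ac_globalD f g : ac_global f -> ac_global g -> ac_global (f \+ g).
Proof.
move=> acf acg e e0.
have e20 : 0 < e / 2 by rewrite divr_gt0.
have [d1 d10 H1] := acf _ e20; have [d2 d20 H2] := acg _ e20.
exists (Num.min d1 d2); first by rewrite lt_min d10.
move=> a b l pl; rewrite lt_min => /andP[l1 l2].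
rewrite (splitr e); apply: le_lt_trans (ltrD (H1 _ _ _ pl l1) (H2 _ _ _ pl l2)).
rewrite /pvar -big_split /=; apply: ler_sum => p _.
by rewrite opprD addrACA ler_normD.
Qed.

Lemma ac_tv r s f : r <= s -> ac_on r s f -> ac_on r s (fine \o TV r ^~ f).
Proof.
move=> rs ac e e0.
have e20 : 0 < e / 2 by rewrite divr_gt0.
have [d d0 H] := ac _ e20; exists d => // l pl ld.
have [/allP al pwl] := andP pl.
have F := ac_bounded_variation ac.
pose n := (size l).+1.
(* The error is allowed to be [e / 2] in all, hence [e / 2 / n] per interval; the successor in [n]
   avoids a division by 0. *)
have [|p /al /and3P[? ? ?]|l' [pl' ll' _ Hl']] := @tv_packing_list r s f (e / 2 / n%:R) l _ pl.
  by rewrite divr_gt0.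
  exact: F.
have -> : pvar (fine \o TV r ^~ f) l = \sum_(p <- l) fine (TV p.1 p.2 f).
  rewrite /pvar !big_seq; apply: eq_bigr => p /al /and3P[rp pp ps] /=.
  have F1 : TV r p.1 f \is a fin_num by apply: F => //; exact: le_trans ps.
  have F2 : TV p.1 p.2 f \is a fin_num by apply: F.
  rewrite (total_variationD f rp pp) fineD//.
  rewrite (_ : fine _ + _ - fine _ = fine (TV p.1 p.2 f)); last by ring.
  rewrite ger0_norm//.
  by rewrite fine_ge0// total_variation_ge0.
apply: (le_lt_trans Hl'); rewrite [ltRHS](splitr e); apply: ltr_leD.
  by apply: H => //; exact: le_lt_trans ld.
rewrite -[_ *+ _]mulr_natr -mulrA -[leRHS]mulr1 ler_wpM2l ?(ltW e20)//.
by rewrite mulrC ler_pdivrMr ?ltr0n// mul1r ler_nat leqnSn.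
Qed.

Local Notation mu := (@lebesgue_measure R).

Lemma ac_global_dist V : ac_global V -> forall e : R, 0 < e ->
  exists2 d : R, 0 < d & forall x y, x <= y -> y - x < d -> `|V y - V x| < e.
Proof.
move=> ac e /ac[d d0 H]; exists d => // x y xy xyd.
have := H x y [:: (x, y)]; rewrite /packing /= !lexx xy /plen /pvar !big_seq1 /=.
exact.
Qed.

Lemma ac_global_continuous V : ac_global V -> continuous V.
Proof.
move=> ac x; apply/cvgrPdist_lt => e e0.
have [d d0 H] := ac_global_dist ac e0.
near=> y; have xyd : `|x - y| < d by near: y; exists d.
have [xy|yx] := leP x y.
  by rewrite distrC; apply: H => //; move: xyd; rewrite ltr_norml; lra.
by apply: H; [exact: ltW|move: xyd; rewrite ltr_norml; lra].
Unshelve. all: end_near. Qed.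

Section monotone_density.
Variables (V : R -> R) (r s : R).
Hypotheses (ndV : {homo V : x y / x <= y}) (acV : ac_global V).
Hypotheses (Vr : forall x, x <= r -> V x = V r) (Vs : forall x, s <= x -> V x = V s).

Let W : cumulative R R := HB.pack V
  (isCumulative.Build R _ R V ndV (right_continuousW (ac_global_continuous acV))).

Let m := lebesgue_stieltjes_measure W.

Let m_oc a b : a <= b -> m `]a, b]%classic = (V b - V a)%:E.
Proof.
move=> ab; rewrite /m /lebesgue_stieltjes_measure /measure_extension.
rewrite measurable_mu_extE/=; last exact: is_ocitv.
by rewrite wlength_itv_bnd.
Qed.

Let m_setT : (m setT <= (V s - V r)%:E)%E.
Proof.
rewrite -(bigcup_itvT false false).
pose I n : set R := `]- (n%:R), n%:R]%classic.
have cv : (m \o I) n @[n --> \oo] --> m (\bigcup_n I n).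
  apply: nondecreasing_cvg_mu; rewrite /I//; first exact: bigcup_measurable.
  by move=> *; apply/subsetPset/subset_itv; rewrite leBSide/= ?lerN2 ler_nat.
rewrite -(cvg_lim _ cv)//; apply: lime_le; first by apply/cvg_ex; eexists; exact: cv.
apply: nearW => n /=; rewrite m_oc ?ge0_cp// lee_fin lerB//.
  have [h|h] := leP s n%:R; first by rewrite Vs.
  exact/ndV/ltW.
have [h|h] := leP (- n%:R) r; first by rewrite Vr.
exact/ndV/ltW.
Qed.

(** The half-open interval is enlarged slightly to the left; the extra mass is small because [V] is
    continuous. *)
Let m_cc a b : a <= b -> (m `[a, b]%classic <= (V b - V a)%:E)%E.
Proof.
move=> ab; apply/lee_addgt0Pr => e e0.
have [d d0 H] := ac_global_dist acV e0.
have d20 : 0 < d / 2 by rewrite divr_gt0.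
have ad : a - d / 2 <= b by lra.
apply: (@le_trans _ _ (m `]a - d / 2, b]%classic)).
  apply: le_measure; rewrite ?inE; [exact: measurable_itv|exact: measurable_itv|].
  by apply: subset_itvr; rewrite bnd_simp; lra.
rewrite m_oc// -EFinD lee_fin.
have /ltr_normlW : `|V a - V (a - d / 2)| < e by apply: H; lra.
lra.
Qed.

Lemma packing_bounds l : all (fun p => p.1 <= p.2) l -> pairwise disj_itv l ->
  exists a b, packing a b l.
Proof.
move=> al pl; have [a [b ab]] : exists a b, forall p, p \in l -> a <= p.1 /\ p.2 <= b.
  elim: l {al pl} => [|p l [a [b H]]]; first by exists 0, 0.
  exists (Num.min a p.1), (Num.max b p.2) => q; rewrite inE => /predU1P[->|/H[h1 h2]].
    by rewrite ge_min le_max !lexx !orbT.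
  by rewrite ge_min le_max h1 h2.
exists a, b; apply/andP; split => //; apply/allP => p pl'.
by have [-> ->] := ab _ pl'; rewrite andbT; exact: (allP al).
Qed.

Lemma open_itv_bounds (I : set R) : is_interval I -> (mu I < +oo)%E ->
  exists p : R * R, [/\ p.1 <= p.2, `]p.1, p.2[%classic `<=` I, I `<=` `[p.1, p.2]%classic &
    I = set0 \/ True].
Proof.
move=> iI fI; have [->|/set0P I0] := eqVneq I set0.
  exists (0, 0) => /=; split => //; last by left.
  by rewrite set_itvoo0.
have := @RhullK R I; rewrite inE => /(_ iI); move: (Rhull I) => [x y] E.
have fI' := fI; rewrite -E lebesgue_measure_itv /= in fI'.
move: I0; rewrite -E => -[z /=].
case: x y E fI' => [bx x|[]] [bz y|[]] E; rewrite /= ?ltNyr ?ltry ?ltNyy//=.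
- move=> _; rewrite in_itv /= => /andP[/lteifW xz /lteifW zy].
  exists (x, y) => /=; split => //; first exact: le_trans zy.
  + by apply: subset_itv; rewrite bnd_simp; case: bx E; case: bz.
  + by apply: subset_itv; rewrite bnd_simp; case: bx E; case: bz.
  + by right.
- by move=> _; rewrite in_itv /= andbF.
Qed.

(** A null set lies in an open set of length less than [d]. Finitely many components of that set
    form a packing, on which [V] varies by less than [e]; the bound passes to the countable sum of
    the masses of the components. *)
Let m_dominated : m `<< mu.
Proof.
apply/null_content_dominatesP => A mA A0.
apply/eqP; rewrite eq_le measure_ge0 andbT; apply/lee_addgt0Pr => e e0; rewrite add0e.
have [d d0 H] := acV e0.
have [|U [oU AU UA]] := lebesgue_regularity_outer mA _ d0.
  by rewrite A0.
have mU : measurable U by exact: open_measurable.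
have Ud : (mu U < d%:E)%E.
  rewrite -(setDUK AU) measureU//=; last 2 first.
    exact: measurableD.
    by rewrite setDE setICA setICr setI0.
  by rewrite A0 add0e.
apply: (@le_trans _ _ (m U)); first by apply: le_measure => //; rewrite inE.
pose I := open_disjoint_itv oU.
have UE : U = \bigcup_q I q by exact: open_disjoint_itv_bigcup.
have tI : trivIset setT I by exact: open_disjoint_itv_trivIset.
have mI q : measurable (I q) by apply: open_measurable; exact: open_disjoint_itv_open.
have IU q : I q `<=` U by rewrite UE => x Ix; exists q.
have fI q : (mu (I q) < +oo)%E.
  apply: le_lt_trans (lt_trans Ud (ltry d)); by apply: le_measure; rewrite ?inE; [exact: mI|exact: mU|exact: IU].
have [p Hp] := choice (fun q => open_itv_bounds (open_disjoint_itv_is_interval (oU:=oU) (i:=q)) (fI q)).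
have mE (nu : {measure set (measurableTypeR R) -> \bar R}) :
    nu U = (\sum_(0 <= i <oo) nu (I i))%E.
  rewrite UE measure_bigcup//; last by move=> i _; exact: mI.
  by apply: eq_eseriesl => i; exact: in_setT.
apply: (@le_trans _ _ (\sum_(0 <= i <oo) m (I i))%E); first by rewrite -(mE m).
apply: lime_le; first by apply: is_cvg_nneseries.
apply: nearW => n.
(* An empty component yields a pair with equal ends, which may lie inside another component; such
   pairs are dropped. Two remaining pairs cannot overlap: the components would share the midpoint of
   the overlap. *)
pose l := [seq p i | i <- [seq i <- iota 0 n | (p i).1 < (p i).2]].
have pwl : pairwise disj_itv l.
  rewrite pairwise_map.
  apply: (@sub_in_pairwise _ [pred i | (p i).1 < (p i).2] [rel i j | i != j]).
  - move=> i j; rewrite !inE /= => hi hj ij; rewrite /disj_itv; apply: contraT; rewrite negb_or -!ltNge => /andP[h1 h2].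
    have [_ si _ _] := Hp i; have [_ sj _ _] := Hp j.
    pose a := Num.max (p i).1 (p j).1; pose b := Num.min (p i).2 (p j).2.
    have ab : a < b by rewrite /a /b lt_min !gt_max hi h2 hj h1.
    have /trivIsetP/(_ i j Logic.I Logic.I ij) := tI.
    have := mid_in_itvoo ab; set c := (X in X \in _); rewrite in_itv/= /a /b lt_min gt_max => /andP[/andP[c1 c2] /andP[c3 c4]].
    move=> E; suff : (set0 : set R) c by []. 
    by rewrite -E; split; [apply: si|apply: sj]; rewrite /= in_itv/= ?c1 ?c2.
  - exact: filter_all.
  - by rewrite -uniq_pairwise filter_uniq// iota_uniq.
have [a [b pk]] : exists a b, packing a b l.
  apply: packing_bounds => //; apply/allP => _ /mapP[i _ ->].
  by have [] := Hp i.
have len : plen l < d.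
  rewrite -lte_fin; apply: le_lt_trans Ud.
  rewrite /plen big_map big_filter.
  apply: (@le_trans _ _ (\sum_(0 <= i < n) mu (I i))%E); last first.
    apply: (@le_trans _ _ (\sum_(0 <= i <oo) mu (I i))%E); last by rewrite -(mE mu).
    by apply: nneseries_lim_ge.
  rewrite big_mkcond -sumEFin /index_iota subn0; apply: lee_sum => i _.
  have [pi si _ _] := Hp i; case: ifP => // pii.
  rewrite (_ : (_ - _)%:E = mu `](p i).1, (p i).2[%classic); last first.
    by rewrite lebesgue_measure_itv/= lte_fin pii.
  by apply: le_measure; rewrite ?inE; [exact: measurable_itv|exact: mI|exact: si].
apply: (@le_trans _ _ (pvar V l)%:E); last by rewrite lee_fin ltW// (H a b).
rewrite /pvar big_map big_filter -sumEFin /index_iota subn0 [leRHS]big_mkcond.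
apply: lee_sum => i _.
have [pi _ si _] := Hp i.
apply: (@le_trans _ _ (V (p i).2 - V (p i).1)%:E).
  by apply: le_trans (m_cc pi); apply: le_measure; rewrite ?inE; [exact: mI|exact: measurable_itv|exact: si].
case: ifP => pii; first by rewrite lee_fin ler_norm.
have -> : (p i).2 = (p i).1 by apply/eqP; rewrite eq_le pi leNgt pii.
by rewrite subrr.
Qed.

Let m_fin : fin_num_fun m.
Proof.
move=> A mA; rewrite ge0_fin_numE//; apply: le_lt_trans (ltry (V s - V r)).
apply: le_trans m_setT; apply: le_measure; rewrite ?inE//.
Qed.

(** The Stieltjes measure of [V] is finite and absolutely continuous, so Radon-Nikodym provides the
    density, and Lebesgue differentiation identifies it with the derivative. Integration starts at
    [r - 1], which leaves all of [[r, s]] to the right of the base point. *)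
Lemma monotone_ac_density : exists g : R -> R,
  [/\ mu.-integrable setT (EFin \o g),
    (forall a b : R, a <= b -> (\int[mu]_(x in `]a, b]) (g x)%:E = (V b - V a)%:E)%E) &
    {ae mu, forall x, r - 1 < x -> derivable V x 1 /\ derive1 V x = g x}].
Proof.
pose nu : {finite_measure set (measurableTypeR R) -> \bar R} :=
  HB.pack (lebesgue_stieltjes_measure W) (@Measure_isFinite.Build _ (measurableTypeR R) R (lebesgue_stieltjes_measure W) m_fin).
have [f [f0 ffin fint fE]] := @radon_nikodym_sigma_finite _ _ _ mu nu m_dominated.
pose g x := fine (f x).
have gE : EFin \o g = f by apply/funext => x; rewrite /= fineK.
exists g; split.
- by rewrite gE.
- move=> a b ab; rewrite -m_oc//; under eq_integral do rewrite fineK//.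
  by rewrite -fE//; exact: measurable_itv.
pose a0 := r - 1.
have ig y : mu.-integrable [set` Interval (BRight a0) (BRight y)] (EFin \o g).
  rewrite gE; apply: integrableS fint => //; exact: measurable_itv.
have lg : locally_integrable [set: R] g.
  by apply: open_integrable_locally; [exact: openT|rewrite gE].
have := FTC1 ig lg; apply: filterS; first exact: (ae_filter_ringOfSetsType mu).
move=> x Hx a0x.
have /Hx[dF F'] : (BRight a0 < BRight x)%O by rewrite ltBSide.
set F := fun y => _ in dF F'.
have near_eq : \forall y \near x, (cst (V a0) \+ F) y = V y.
  near=> y; have a0y : a0 < y by near: y; exact: lt_nbhsr.
  rewrite /F /Rintegral /=.
  have -> : (\int[mu]_(t in `]a0, y]) (g t)%:E = (V y - V a0)%:E)%E.
    rewrite -m_oc ?(ltW a0y)//; under eq_integral do rewrite fineK//.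
    by rewrite -fE//; exact: measurable_itv.
  by rewrite /= addrC subrK.
have dW : is_derive x 1 (cst (V a0) \+ F) (g x).
  have d0 : derivable (cst (V a0)) x 1 by exact: derivable_cst.
  apply: DeriveDef; first exact: (derivableD d0 dF).
  by rewrite (deriveD d0 dF) derive_cst add0r -derive1E.
have dV : is_derive x 1 V (g x).
  exact: near_eq_is_derive dW.
split; first exact: ex_derive.
by rewrite derive1E derive_val.
Unshelve. all: end_near. Qed.

End monotone_density.

(** Jordan decomposition: [f] is the difference of [V + f] and [V], where [V] is the total variation
    from [r]. Both are nondecreasing and absolutely continuous. *)
Lemma ac_density r s f : r <= s -> ac_on r s f -> exists g : R -> R,
  [/\ mu.-integrable `[r, s] (EFin \o g),
    (\int[mu]_(x in `[r, s]) (g x)%:E = (f s - f r)%:E)%E &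
    {ae mu, forall x, r < x < s -> derivable f x 1 /\ derive1 f x = g x}].
Proof.
move=> rs ac.
pose V := (fine \o total_variation r ^~ f) \o clamp r s.
pose P := V \+ (f \o clamp r s).
have acV : ac_global V by apply: ac_clamp => //; exact: ac_tv.
have acP : ac_global P by apply: ac_globalD => //; exact: ac_clamp.
have fin := ac_bounded_variation ac.
have Vdiff x y : x <= y -> V y - V x = fine (TV (clamp r s x) (clamp r s y) f) /\
    TV (clamp r s x) (clamp r s y) f \is a fin_num.
  move=> xy; have /andP[x1 x2] := clamp_itv x rs; have /andP[y1 y2] := clamp_itv y rs.
  have cxy := clamp_homo r s xy.
  have F1 := fin _ _ (lexx r) x1 x2; have F2 := fin _ _ x1 cxy y2.
  split => //; rewrite /V /= (total_variationD f x1 cxy) fineD//; ring.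
have ndV : {homo V : x y / x <= y}.
  move=> x y xy; rewrite -subr_ge0; have [-> _] := Vdiff _ _ xy.
  by apply/fine_ge0/total_variation_ge0/clamp_homo.
have ndP : {homo P : x y / x <= y}.
  move=> x y xy; rewrite -subr_ge0.
  have [E F] := Vdiff _ _ xy.
  have := total_variation_ge f (clamp_homo r s xy).
  rewrite -[X in (_ <= X)%E](fineK F) lee_fin -E => h.
  have := ler_norm (- (f (clamp r s y) - f (clamp r s x))); rewrite normrN => h2.
  rewrite (_ : P y - P x = (V y - V x) + (f (clamp r s y) - f (clamp r s x))).
    by lra.
  rewrite /P /=; ring.
have cr x : x <= r -> clamp r s x = clamp r s r.
  by move=> xr; rewrite /clamp; apply/eqP; rewrite eq_le clamp_homo//= /clamp;
    rewrite (min_idPl rs) maxxx le_max lexx.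
have cs x : s <= x -> clamp r s x = clamp r s s.
  by move=> xs; rewrite /clamp minxx (min_idPr xs).
have Vr x : x <= r -> V x = V r by move=> h; rewrite /V /= (cr x h).
have Vs x : s <= x -> V x = V s by move=> h; rewrite /V /= (cs x h).
have Pr x : x <= r -> P x = P r by move=> h; rewrite /P /= Vr// (cr x h).
have Ps x : s <= x -> P x = P s by move=> h; rewrite /P /= Vs// (cs x h).
have [g1 [i1 e1 a1]] := monotone_ac_density ndP acP Pr Ps.
have [g2 [i2 e2 a2]] := monotone_ac_density ndV acV Vr Vs.
exists (fun x => g1 x - g2 x).
have I1 : mu.-integrable `[r, s] (EFin \o g1) by apply: integrableS i1 => //; exact: measurable_itv.
have I2 : mu.-integrable `[r, s] (EFin \o g2) by apply: integrableS i2 => //; exact: measurable_itv.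
split.
- rewrite (_ : EFin \o _ = (EFin \o g1) \- (EFin \o g2))%E//.
  by apply: integrableB => //.
- under eq_integral do rewrite EFinB.
  rewrite integralB//=.
  have mg (g : R -> R) : mu.-integrable `[r, s] (EFin \o g) ->
      (\int[mu]_(x in `[r, s]) (g x)%:E = \int[mu]_(x in `]r, s]) (g x)%:E)%E.
    move=> /integrableP[mg _]; apply/esym/integral_itv_obnd_cbnd.
    apply: (measurable_funS _ _ mg); first exact: measurable_itv.
    by apply: subset_itvr; rewrite bnd_simp.
  rewrite mg// mg//.
  rewrite e1// e2// -EFinB; congr _%:E; rewrite /P /=.
  by rewrite !(clamp_id (x := s)) ?lexx ?rs// !(clamp_id (x := r)) ?lexx ?rs//; ring.
have FF := ae_filter_ringOfSetsType mu.
move: a1 a2; apply: filterS2 => x h1 h2 /andP[rx xs].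
have rx1 : r - 1 < x by lra.
have [d1 v1] := h1 rx1; have [d2 v2] := h2 rx1.
have near_eq : \forall y \near x, (P \- V) y = f y.
  near=> y; rewrite /P /V /= clamp_id; last first.
    apply/andP; split; apply: ltW; near: y; [exact: lt_nbhsr|exact: lt_nbhsl].
  by rewrite addrC addKr.
have dW : is_derive x 1 (P \- V) (g1 x - g2 x).
  apply: DeriveDef; first exact: (derivableB d1 d2).
  by rewrite (deriveB d1 d2) -!derive1E v1 v2.
have dV : is_derive x 1 f (g1 x - g2 x).
  exact: near_eq_is_derive dW.
split; first exact: ex_derive.
by rewrite derive1E derive_val.
Unshelve. all: end_near. Qed.

End list_ac.

(** * Changes of charts; velocity, metric and Lagrangian in coordinates *)

Section charts.
Context (R : realType) (n : nat) (M : topologicalType) (X : C2manifold R n M).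
Implicit Types (a b c : chart R n M) (x y : M).

Lemma fwd_cvg a x : dom a x -> fwd a z @[z --> x] --> fwd a x.
Proof.
move=> ax; have := @fwd_cont _ _ _ a.
by rewrite (continuous_open_subspace _ (@dom_open _ _ _ a)) => /(_ x); apply; rewrite inE.
Qed.

Lemma bwd_cvg a (y : 'rV[R]_n) : tgt a y -> bwd a z @[z --> y] --> bwd a y.
Proof.
move=> ay; have := @bwd_cont _ _ _ a.
by rewrite (continuous_open_subspace _ (@tgt_open _ _ _ a)) => /(_ y); apply; rewrite inE.
Qed.

Definition overlap a b : set 'rV[R]_n := tgt a `&` bwd a @^-1` dom b.

Lemma overlap_open a b : open (overlap a b).
Proof.
rewrite openE => y [ay bay] /=; rewrite /interior.
have h1 : nbhs y (tgt a) by apply: open_nbhs_nbhs; split => //; exact: tgt_open.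
have h2 : nbhs (bwd a y) (dom b).
  by apply: open_nbhs_nbhs; split => //; exact: dom_open.
apply: filterI => //; exact: (bwd_cvg ay).
Qed.

Lemma overlap_fwd a b x : dom a x -> dom b x -> overlap a b (fwd a x).
Proof. by move=> ax bx; split; [exact: fwd_tgt|rewrite /= fwdK]. Qed.

Lemma nbhs_overlap a b x : dom a x -> dom b x -> nbhs (fwd a x) (overlap a b).
Proof.
move=> ax bx; apply: open_nbhs_nbhs; split; [exact: overlap_open|exact: overlap_fwd].
Qed.

Lemma nbhs_dom a x : dom a x -> nbhs x (dom a).
Proof. by move=> ax; apply: open_nbhs_nbhs; split => //; exact: dom_open. Qed.

Lemma nbhs_tgt a (y : 'rV[R]_n) : tgt a y -> nbhs y (tgt a).
Proof. by move=> ay; apply: open_nbhs_nbhs; split => //; exact: tgt_open. Qed.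

Definition trans a b := fwd b \o bwd a.

Lemma trans_differentiable a b (y : 'rV[R]_n) : atlas X a -> atlas X b -> overlap a b y ->
  differentiable (trans a b) y.
Proof. by move=> aa ab; have [+ _] := transition_C2 aa ab; apply. Qed.

Definition tjac a b x : 'M[R]_n := 'J (trans a b) (fwd a x).

Lemma tmxE a x : tmx X a x = tjac (chart_at X x) a x.
Proof. by []. Qed.

Lemma tjacM a b x (v : 'rV[R]_n) : atlas X a -> atlas X b -> dom a x -> dom b x ->
  v *m tjac a b x = 'D_v (trans a b) (fwd a x).
Proof.
move=> aa ab ax bx; rewrite /tjac -deriveEjacobian//.
by apply: trans_differentiable => //; exact: overlap_fwd.
Qed.

#[local] Opaque tjac.

Lemma tjac_id a x : atlas X a -> dom a x -> tjac a a x = 1%:M.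
Proof.
move=> aa ax; apply/row_matrixP => i; rewrite rowE [RHS]rowE mulmx1.
rewrite tjacM//.
rewrite -[RHS](derive_id (fwd a x)); apply: near_eq_derive.
have := nbhs_overlap ax ax.
by apply: filterS => y [ay _]; rewrite /trans /= bwdK.
Qed.

Lemma tjac_comp a b c x : atlas X a -> atlas X b -> atlas X c ->
  dom a x -> dom b x -> dom c x -> tjac a c x = tjac a b x *m tjac b c x.
Proof.
move=> aa ab ac ax bx cx; apply/row_matrixP => i; rewrite rowE [RHS]rowE [RHS]mulmxA.
have Oac := overlap_fwd ax cx; have Oab := overlap_fwd ax bx.
have Obc := overlap_fwd bx cx.
have dab := trans_differentiable aa ab Oab.
have tE : trans a b (fwd a x) = fwd b x by rewrite /trans /= fwdK.
have dbc : differentiable (trans b c) (trans a b (fwd a x)).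
  by rewrite tE; exact: trans_differentiable.
have dbc' : differentiable (trans b c) (fwd b x) by rewrite -tE.
have dcomp := differentiable_comp dab dbc.
apply: (etrans (tjacM _ aa ac ax cx)); apply/esym.
apply: (etrans (congr1 (fun u => u *m tjac b c x) (tjacM _ aa ab ax bx))).
apply: (etrans (tjacM _ ab ac bx cx)); apply/esym.
transitivity ('D_(delta_mx 0 i) (trans b c \o trans a b) (fwd a x)); last first.
  rewrite (deriveE _ dcomp) (diff_comp dab dbc) /=.
  by rewrite (deriveE _ dab) (deriveE _ dbc') tE.
apply: near_eq_derive.
have := nbhs_overlap ax bx.
apply: filterS => y [ay by_]; rewrite /trans /= fwdK//.
Qed.

Lemma tjac_inv a b x : atlas X a -> atlas X b -> dom a x -> dom b x ->
  tjac a b x *m tjac b a x = 1%:M.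
Proof. by move=> aa ab ax bx; rewrite -tjac_comp// tjac_id. Qed.

Lemma tmx_unit a x : atlas X a -> dom a x -> tmx X a x \in unitmx.
Proof.
move=> aa ax; have h := tjac_inv (chart_at_atlas X x) aa (chart_at_dom X x) ax.
have [u _] := mulmx1_unit h; rewrite tmxE; exact: u.
Qed.

Lemma invmx_tmx a x : atlas X a -> dom a x ->
  invmx (tmx X a x) = tjac a (chart_at X x) x.
Proof.
move=> aa ax; have := tjac_inv (chart_at_atlas X x) aa (chart_at_dom X x) ax.
move=> h; rewrite -[LHS]mulmx1 -h mulmxA mulVmx ?mul1mx//; exact: tmx_unit.
Qed.

(** Chain rule through the transition map from [a] to the preferred chart at [c t]. That chart is
    frozen at the time [t]; continuity of [c] at [t] keeps nearby points in the domain of [a]. *)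
Lemma velocity_chart a (c : R -> M) (t : R) (v : 'rV[R]_n) : atlas X a ->
  {for t, continuous c} -> dom a (c t) -> is_derive t 1 (fwd a \o c) v ->
  is_derive t 1 (fwd (chart_at X (c t)) \o c) (velocity X c t) /\
  velocity X c t = v *m invmx (tmx X a (c t)).
Proof.
move=> aa cc act dv; set ch := chart_at X (c t).
have Och : overlap a ch (fwd a (c t)) by apply: overlap_fwd => //; exact: chart_at_dom.
have dt := trans_differentiable aa (chart_at_atlas X (c t)) Och.
have df : differentiable (fwd a \o c) t by apply/derivable1_diffP; exact: ex_derive.
have dcomp : differentiable (trans a ch \o (fwd a \o c)) t by exact: differentiable_comp.
have E : is_derive t 1 (fwd ch \o c) (v *m tjac a ch (c t)).
  apply: (@near_eq_is_derive _ _ _ (trans a ch \o (fwd a \o c))).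
    have cn : \forall s \near t, dom a (c s) by apply: cc; exact: nbhs_dom.
    by near=> s; rewrite /trans /= fwdK//; near: s; exact: cn.
  apply: DeriveDef; first exact: diff_derivable.
  rewrite deriveE// diff_comp//= (tjacM _ aa (chart_at_atlas X _) act (chart_at_dom X _)).
  have vE : 'd (fwd a \o c) t 1 = v by rewrite -deriveE// derive_val.
  by rewrite vE (deriveE _ dt).
have V : velocity X c t = v *m tjac a ch (c t).
  by rewrite /velocity derive1E derive_val.
by rewrite V invmx_tmx.
Unshelve. all: end_near. Qed.

Section metric.
Variable g : riemannian X.

(** The Gram matrix of the metric in the coordinates of [a], which is the expression that [gram_C1]
    makes of class C^1. *)
Definition gm a (y : 'rV[R]_n) : 'M[R]_n :=
  invmx (tmx X a (bwd a y)) *m gram g (bwd a y) *m (invmx (tmx X a (bwd a y)))^T.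

Definition cnorm a (y w : 'rV[R]_n) : R := Num.sqrt ((w *m gm a y *m w^T) 0 0).

Lemma tnorm_chart a x (w : 'rV[R]_n) : dom a x ->
  tnorm g (x := x) (w *m invmx (tmx X a x)) = cnorm a (fwd a x) w.
Proof.
by move=> ax; rewrite /tnorm /cnorm /gm fwdK// trmx_mul !mulmxA.
Qed.

Lemma gm_gt0 a (y w : 'rV[R]_n) : atlas X a -> tgt a y -> w != 0 -> 0 < (w *m gm a y *m w^T) 0 0.
Proof.
move=> aa ay w0.
have U : invmx (tmx X a (bwd a y)) \in unitmx.
  by rewrite unitmx_inv; apply: tmx_unit => //; exact: bwd_dom.
have := @gram_pos _ _ _ _ g (bwd a y) (w *m invmx (tmx X a (bwd a y))).
rewrite /gm trmx_mul !mulmxA; apply; apply: contra w0 => /eqP h.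
by rewrite -[w](mulmxK U) h mul0mx.
Qed.

Lemma gm_sym a (y : 'rV[R]_n) : (gm a y)^T = gm a y.
Proof. by rewrite /gm !trmx_mul trmxK gram_sym mulmxA. Qed.

End metric.

Section lagrangian_chart.
Variable H : hamiltonian X.

Lemma lagrangian_ge a x (w : 'rV[R]_n) (q : 'cV[R]_n) : atlas X a -> dom a x ->
  ((pairing q w - in_chart H a (fwd a x, q))%:E <=
    lagrangian H (x := x) (w *m invmx (tmx X a x)))%E.
Proof.
move=> aa ax; apply: ereal_sup_ubound; exists (tmx X a x *m q); first exact: I.
rewrite /in_chart /pairing /= fwdK// mulmxA mulmxKV//; exact: tmx_unit.
Qed.

(** Since [tmx X a x] is invertible, every covector at [x] has coordinates [q] in [a]. Together with
    [lagrangian_ge], the Lagrangian in coordinates is the Legendre transform of the Hamiltonian in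
    coordinates. *)
Lemma lagrangian_le a x (w : 'rV[R]_n) (E : R) : atlas X a -> dom a x ->
  (forall q, pairing q w - in_chart H a (fwd a x, q) <= E) ->
  (lagrangian H (x := x) (w *m invmx (tmx X a x)) <= E%:E)%E.
Proof.
move=> aa ax h; apply: ge_ereal_sup => _ [p _ <-].
have U := tmx_unit aa ax.
have := h (invmx (tmx X a x) *m p).
by rewrite lee_fin /in_chart /pairing /= fwdK// !mulmxA (mulmxV U) mul1mx.
Qed.

End lagrangian_chart.

(** The comparison of the metric with the sup norm bounds the set whose supremum is [conorm]; only
    then is the real [sup] an upper bound of it. *)
Lemma conorm_ge (g : riemannian X) a x (q : 'cV[R]_n) (w : 'rV[R]_n) (k : R) :
  atlas X a -> dom a x -> 0 < k ->
  (forall v, k * `|v| <= cnorm g a (fwd a x) v) -> cnorm g a (fwd a x) w <= 1 ->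
  pairing q w <= conorm g (x := x) (tmx X a x *m q).
Proof.
move=> aa ax k0 kv w1; rewrite /conorm; have U := tmx_unit aa ax.
apply: ub_le_sup; last first.
  exists (w *m invmx (tmx X a x)) => /=; first by rewrite tnorm_chart.
  by rewrite /pairing mulmxA mulmxKV.
exists (\sum_i k^-1 * `|q i 0|) => _ [v /= v1 <-].
rewrite /pairing mulmxA; set w' := v *m tmx X a x.
have : k * `|w'| <= 1.
  apply: (le_trans (kv w')); rewrite -tnorm_chart// /w' mulmxK//.
rewrite mulrC -ler_pdivlMr// mul1r => h.
rewrite mxE; apply: ler_sum => i _; apply: (le_trans (ler_norm _)).
rewrite normrM ler_wpM2r//; apply: le_trans h.
by rewrite [leRHS]/Num.norm /= mx_normrE; apply: (le_bigmax _ _ (0, i)).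
Qed.

Lemma conorm_le (g : riemannian X) a x (q : 'cV[R]_n) (E : R) :
  atlas X a -> dom a x -> 0 <= E ->
  (forall w, cnorm g a (fwd a x) w <= 1 -> pairing q w <= E) ->
  conorm g (x := x) (tmx X a x *m q) <= E.
Proof.
move=> aa ax E0 H; have U := tmx_unit aa ax.
apply: ge_sup.
  exists 0, 0 => /=; last by rewrite /pairing mul0mx mxE.
  by rewrite /tnorm !mul0mx mxE sqrtr0.
move=> _ [v /= v1 <-]; rewrite /pairing mulmxA; apply: H.
by rewrite -tnorm_chart// mulmxK.
Qed.

End charts.

(** * Matrix norms, quadratic forms, and boxes adapted to the metric *)

Lemma cont_eps (R : realType) (V W : normedModType R) (f : V -> W) (x : V) :
  (forall e : R, 0 < e -> exists2 d : R, 0 < d & forall y, `|x - y| < d -> `|f x - f y| < e) ->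
  {for x, continuous f}.
Proof.
move=> H; apply/cvgrPdist_lt => e /H[d d0 Hd].
by apply/nbhs_ballP; exists d => //= y; rewrite -ball_normE /=; exact: Hd.
Qed.

Lemma cont_inv (R : realType) (V W : normedModType R) (f : V -> W) (x : V) :
  {for x, continuous f} ->
  forall e : R, 0 < e -> exists2 d : R, 0 < d & forall y, `|x - y| < d -> `|f x - f y| < e.
Proof.
move=> c e e0; have/cvgrPdist_lt/(_ e e0)/nbhs_ballP[d /= d0 H] := c.
by exists d => // y h; apply: H; rewrite -ball_normE.
Qed.

Lemma mx_entry_le (R : realType) m n (A : 'M[R]_(m, n)) i j : `|A i j| <= `|A|.
Proof.
rewrite [leRHS]/Num.norm /= mx_normrE.
exact: (le_bigmax _ (fun ij : 'I_m * 'I_n => `|A ij.1 ij.2|) (i, j)).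
Qed.

Lemma mx_norm_le (R : realType) m n (A : 'M[R]_(m, n)) (e : R) : 0 <= e ->
  (forall i j, `|A i j| <= e) -> `|A| <= e.
Proof.
move=> e0 H; rewrite [leLHS]/Num.norm /= mx_normrE.
by apply/bigmax_leP; split => // -[i j] _ /=.
Qed.

Lemma mulmx_norm_le (R : realType) m n p (A : 'M[R]_(m, n)) (B : 'M[R]_(n, p)) :
  `|A *m B| <= n%:R * `|A| * `|B|.
Proof.
apply: mx_norm_le => [|i j]; first by rewrite !mulr_ge0.
rewrite mxE; apply: (le_trans (ler_norm_sum _ _ _)).
rewrite (_ : n%:R * `|A| * `|B| = \sum_(k < n) `|A| * `|B|); last first.
  by rewrite sumr_const card_ord -[RHS]mulr_natl mulrA.
by apply: ler_sum => k _; rewrite normrM ler_pM// mx_entry_le.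
Qed.

Lemma trmx_norm (R : realType) m n (A : 'M[R]_(m, n)) : `|A^T| = `|A|.
Proof.
apply/eqP; rewrite eq_le; apply/andP; split; apply: mx_norm_le => // i j.
  by rewrite mxE mx_entry_le.
by have := mx_entry_le A^T j i; rewrite mxE.
Qed.

Lemma pairing_le (R : realType) n (q : 'cV[R]_n) (v : 'rV[R]_n) :
  `|pairing q v| <= n%:R * `|q| * `|v|.
Proof.
rewrite mulrAC; apply: le_trans (mulmx_norm_le v q); exact: mx_entry_le.
Qed.

Section quadratic.
Context (R : realType) (n : nat).
Implicit Types (A B : 'M[R]_n) (u w : 'rV[R]_n).

Definition bil A u w : R := (u *m A *m w^T) 0 0.

Lemma bil_le A u w : `|bil A u w| <= n%:R ^+ 2 * `|A| * `|u| * `|w|.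
Proof.
apply: (le_trans (mx_entry_le _ _ _)); apply: (le_trans (mulmx_norm_le _ _)).
rewrite trmx_norm.
apply: (le_trans (ler_wpM2r (normr_ge0 w) (ler_wpM2l (ler0n _ n) (mulmx_norm_le u A)))).
by rewrite le_eqVlt; apply/orP; left; apply/eqP; ring.
Qed.

Lemma bilBA A B u w : bil (A - B) u w = bil A u w - bil B u w.
Proof. by rewrite /bil mulmxBr mulmxBl !mxE. Qed.

Lemma bilBl A u u' w : bil A (u - u') w = bil A u w - bil A u' w.
Proof. by rewrite /bil !mulmxBl !mxE. Qed.

Lemma bilBr A u w w' : bil A u (w - w') = bil A u w - bil A u w'.
Proof. by rewrite /bil linearB /= mulmxBr !mxE. Qed.

Lemma bilZ A (k : R) w : bil A (k *: w) (k *: w) = k ^+ 2 * bil A w w.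
Proof. by rewrite /bil linearZ /= -!scalemxAl -scalemxAr !mxE expr2 mulrA. Qed.

Lemma bil_continuous A : continuous (fun w => bil A w w).
Proof.
move=> w; apply: cont_eps => e e0.
pose C := n%:R ^+ 2 * `|A| * (2 * `|w| + 1) + 1.
have C0 : 0 < C by rewrite ltr_wpDl// mulr_ge0// ?mulr_ge0// addr_ge0// mulr_ge0.
exists (Num.min 1 (e / C)); first by rewrite lt_min ltr01 divr_gt0.
move=> v; rewrite lt_min => /andP[vw vw'].
have -> : bil A w w - bil A v v = bil A (w - v) w + bil A v (w - v).
  by rewrite bilBl bilBr; ring.
apply: (le_lt_trans (ler_normD _ _)).
have h1 := bil_le A (w - v) w; have h2 := bil_le A v (w - v).
have nv : `|v| <= `|w| + 1.
  have := ler_normB w (w - v); rewrite opprB addrC subrK; lra.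
have : `|bil A (w - v) w| + `|bil A v (w - v)| <= C * `|w - v|.
  apply: (le_trans (lerD h1 h2)); rewrite /C mulrDl mul1r.
  set K := n%:R ^+ 2 * `|A|; have K0 : 0 <= K by rewrite mulr_ge0.
  have h3 : K * `|v| * `|w - v| <= K * (`|w| + 1) * `|w - v|.
    by rewrite ler_wpM2r// ler_wpM2l.
  have := normr_ge0 (w - v); move: h3; set d := `|w - v|; nra.
move=> h; apply: (le_lt_trans h); by rewrite mulrC -ltr_pdivlMr.
Qed.

(** The constant is the minimum of the form on the unit sphere; homogeneity of degree 2 does the
    rest. *)
Lemma bil_coercive A : (forall w, w != 0 -> 0 < bil A w w) ->
  exists2 m : R, 0 < m & forall w, m * `|w| ^+ 2 <= bil A w w.
Proof.
move=> pos; pose S := [set w : 'rV[R]_n | `|w| = 1].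
(* The sphere is empty in dimension 0. *)
have [S0|/set0P S0] := eqVneq S set0.
  exists 1 => // w; have [->|w0] := eqVneq w 0.
    by rewrite normr0 expr0n mulr0 /bil !mul0mx mxE.
  suff : S (`|w|^-1 *: w) by rewrite S0.
  by rewrite /S /= normrZ normfV normr_id mulVf ?normr_eq0.
have cS : compact S.
  apply: bounded_closed_compact.
    by exists 1; split => // x x1 w /= ->; exact: ltW.
  have -> : S = (fun w : 'rV[R]_n => `|w|) @^-1` [set 1] by [].
  apply: closed_comp; first by move=> w _; exact: norm_continuous.
  exact: closed_eq.
have [w0 w0S min] := compact_EVT_min S0 cS (continuous_subspaceT (@bil_continuous A)).
exists (bil A w0 w0).
  apply: pos; apply: contraPneq w0S => ->; rewrite inE /S /= normr0.
  by move/eqP; rewrite eq_sym oner_eq0.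
move=> w; have [->|wn0] := eqVneq w 0.
  by rewrite normr0 expr0n mulr0 /bil !mul0mx mxE.
have nw : 0 < `|w| by rewrite normr_gt0.
have uS : (`|w|^-1 *: w) \in S.
  by rewrite inE /S /= normrZ normfV normr_id mulVf// normr_eq0.
have := min _ uS; rewrite bilZ exprVn => h.
by rewrite mulrC -ler_pdivlMl// exprn_gt0.
Qed.

End quadratic.

Lemma quad_bounds1 (R : realType) (m M0 A B C : R) :
  - (m / 2 * C) <= A - B -> A - B <= m / 2 * C -> m * C <= A -> A <= M0 * C ->
  0 <= m -> 0 <= C -> m / 2 * C <= B /\ B <= (M0 + m) * C.
Proof. by move=> h1 h2 h3 h4 m0 C0; have := mulr_ge0 m0 C0; split; lra. Qed.

Lemma quad_bounds2 (R : realType) (m A B B' C : R) :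
  - (m / 2 * C) <= A - B -> A - B' <= m / 2 * C -> m * C <= A -> 0 <= m -> 0 <= C -> B <= 2 ^+ 2 * B'.
Proof. by rewrite expr2 => h1 h2 h3 m0 C0; have := mulr_ge0 m0 C0; lra. Qed.

Section metric_box.
Context (R : realType) (n : nat) (M : topologicalType) (X : C2manifold R n M).
Variable g : riemannian X.

Definition box (y0 : 'rV[R]_n) (r : R) : set 'rV[R]_n := [set y | `|y - y0| <= r].

Lemma cnormE a y w : cnorm g a y w = Num.sqrt (bil (gm g a y) w w).
Proof. by []. Qed.

Lemma box_tgt (a : chart R n M) y0 : tgt a y0 ->
  exists2 r : R, 0 < r & box y0 r `<=` tgt a.
Proof.
move=> /nbhs_tgt /nbhs_ballP[r /= r0 H]; exists (r / 2); first by rewrite divr_gt0.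
move=> y /= h; apply: H; rewrite -ball_normE /= distrC.
by apply: (le_lt_trans h); rewrite ltr_pdivrMr// ltr_pMr// ltr1n.
Qed.

(** On a small box the form differs from the one at [y0] by at most half the coercivity constant
    [m]. This gives both comparisons with the sup norm, and bounds the ratio of the forms at two
    points by 4, that of the norms by 2. *)
Lemma metric_box (a : chart R n M) (y0 : 'rV[R]_n) : atlas X a -> tgt a y0 ->
  exists r k : R, [/\ 0 < r, 0 < k, box y0 r `<=` tgt a,
    (forall y w, box y0 r y -> k * `|w| <= cnorm g a y w <= k^-1 * `|w|) &
    (forall y y' w, box y0 r y -> box y0 r y' -> cnorm g a y w <= 2 * cnorm g a y' w)].
Proof.
move=> aa ay; have [r1 r10 H1] := box_tgt ay.
have [m m0 Hm] : exists2 m : R, 0 < m & forall w, m * `|w| ^+ 2 <= bil (gm g a y0) w w.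
  by apply: bil_coercive => w; exact: gm_gt0.
pose N : R := n%:R ^+ 2 + 1.
have N0 : 0 < N by rewrite ltr_wpDl// exprn_ge0.
have e0 : 0 < m / 2 / N by rewrite !divr_gt0.
have cg : gm g a z @[z --> y0] --> gm g a y0.
  have [/(_ y0 ay) d _] := gram_C1 g aa; exact: differentiable_continuous d.
have [r2 r20 H2] := cont_inv cg e0.
pose r := Num.min r1 (r2 / 2).
have r0 : 0 < r by rewrite lt_min r10 divr_gt0.
have near y w : box y0 r y ->
    `|bil (gm g a y0) w w - bil (gm g a y) w w| <= m / 2 * `|w| ^+ 2.
  rewrite /box /= le_min => /andP[_ h].
  have : `|gm g a y0 - gm g a y| < m / 2 / N.
    apply: H2; rewrite distrC; apply: (le_lt_trans h).
    by rewrite ltr_pdivrMr// ltr_pMr// ltr1n.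
  rewrite ltr_pdivlMr// => h2; rewrite -bilBA; apply: (le_trans (bil_le _ _ _)).
  rewrite -mulrA -expr2 ler_wpM2r ?exprn_ge0//; apply: le_trans (ltW h2).
  by rewrite mulrC ler_wpM2l// /N lerDl.
pose M0 := N * `|gm g a y0|.
have up w : bil (gm g a y0) w w <= M0 * `|w| ^+ 2.
  apply: (le_trans (ler_norm _)); apply: (le_trans (bil_le _ _ _)).
  rewrite -mulrA -expr2 ler_wpM2r ?exprn_ge0//.
  by rewrite ler_wpM2r// /N lerDl.
have M00 : 0 <= M0 by rewrite mulr_ge0// ltW.
pose k := Num.min (Num.sqrt (m / 2)) (Num.sqrt (M0 + m))^-1.
have s1 : 0 < Num.sqrt (m / 2) by rewrite sqrtr_gt0 divr_gt0.
have s2 : 0 < Num.sqrt (M0 + m) by rewrite sqrtr_gt0 ltr_wpDl.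
exists r, k; split => //.
- by rewrite lt_min s1 invr_gt0.
- by move=> y /= h; apply: H1; apply: le_trans h _; rewrite ge_min lexx.
- move=> y w by_; have := near y w by_; rewrite ler_norml => /andP[h1 h2].
  have q1 := Hm w; have q2 := up w; have w2 : 0 <= `|w| ^+ 2 by rewrite exprn_ge0.
  have [lo hi] := quad_bounds1 h1 h2 q1 q2 (ltW m0) w2.
  rewrite cnormE; apply/andP; split.
    apply: (@le_trans _ _ (Num.sqrt (m / 2) * `|w|)).
      by rewrite ler_wpM2r// ge_min lexx.
    rewrite -[X in _ * X](ger0_norm (normr_ge0 w)) -sqrtr_sqr -sqrtrM ?divr_ge0 ?(ltW m0)//.
    exact: ler_wsqrtr.
  apply: (@le_trans _ _ (Num.sqrt (M0 + m) * `|w|)); last first.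
    rewrite ler_wpM2r// -[leLHS]invrK lef_pV2 ?posrE ?invr_gt0//.
      by rewrite ge_min lexx orbT.
    by rewrite lt_min s1 invr_gt0.
  rewrite -[X in _ * X](ger0_norm (normr_ge0 w)) -sqrtr_sqr -sqrtrM ?addr_ge0 ?(ltW m0)//.
  exact: ler_wsqrtr.
- move=> y y' w by_ by'.
  have := near y w by_; rewrite ler_norml => /andP[h1 h2].
  have := near y' w by'; rewrite ler_norml => /andP[h3 h4].
  have q1 := Hm w.
  rewrite !cnormE.
  have -> : (2 : R) = Num.sqrt (2 ^+ 2) by rewrite sqrtr_sqr ger0_norm.
  rewrite -sqrtrM ?exprn_ge0//; apply: ler_wsqrtr.
  by apply: (quad_bounds2 h1 h4 q1 (ltW m0)); rewrite exprn_ge0.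
Qed.

End metric_box.

(** * Taylor expansion along segments *)

Section line.
Context (R : realType).

Lemma is_derive_line (V W : normedModType R) (F : V -> W) (x k : V) (t : R) :
  derivable F (x + t *: k) k ->
  is_derive t 1 (fun s : R => F (x + s *: k)) ('D_k F (x + t *: k)).
Proof.
move=> d.
have E : (fun h : R => h^-1 *: (((fun s : R => F (x + s *: k)) \o shift t) (h *: 1) - F (x + t *: k)))
   = (fun h : R => h^-1 *: ((F \o shift (x + t *: k)) (h *: k) - F (x + t *: k))).
  apply/funext => h /=; congr (_ *: (F _ - _)).
  by rewrite [h *: 1]mulr1 scalerDl addrCA.
apply: DeriveDef; first by rewrite /derivable E.
by rewrite /derive E.
Qed.

Lemma is_derive_continuous (f : R -> R) (t df : R) : is_derive t 1 f df -> {for t, continuous f}.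
Proof. by move=> d; apply/differentiable_continuous/derivable1_diffP; exact: ex_derive. Qed.

Lemma mvt01 (f df : R -> R) : (forall t : R, 0 <= t <= 1 -> is_derive t 1 f (df t)) ->
  forall s : R, 0 <= s <= 1 -> exists2 c, 0 <= c <= 1 & f s - f 0 = df c * s.
Proof.
move=> d s /andP[s0 s1]; have [->|sn0] := eqVneq s 0.
  by exists 0; rewrite ?lexx ?ler01// subrr mulr0.
have sp : 0 < s by rewrite lt_neqAle eq_sym sn0.
have [||c ci E] := @MVT R f df 0 s sp.
- move=> x; rewrite in_itv /= => /andP[x0 xs]; apply: d.
  by rewrite (ltW x0) (le_trans (ltW xs)).
- apply: continuous_in_subspaceT => x; rewrite inE /= in_itv /= => /andP[x0 xs].
  apply: (is_derive_continuous (d x _)); by rewrite x0 (le_trans xs).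
- move: ci; rewrite in_itv /= => /andP[c0 cs].
  by exists c; [rewrite (ltW c0) (le_trans (ltW cs))|rewrite E subr0].
Qed.

Lemma taylor01_ge (f f1 f2 : R -> R) (c : R) :
  (forall t : R, 0 <= t <= 1 -> is_derive t 1 f (f1 t)) ->
  (forall t : R, 0 <= t <= 1 -> is_derive t 1 f1 (f2 t)) ->
  (forall t : R, 0 <= t <= 1 -> c <= f2 t) -> f 0 + f1 0 + c / 2 <= f 1.
Proof.
move=> d1 d2 h.
have lo t : 0 <= t <= 1 -> f1 0 + c * t <= f1 t.
  move=> t01; have [x x01 E] := mvt01 d2 t01.
  have /andP[t0 _] := t01.
  have := ler_wpM2r t0 (h _ x01); lra.
pose p (t : R) := f t - (f1 0 * t + c / 2 * (t * t)).
have dp (t : R) : 0 <= t <= 1 -> is_derive t 1 p (f1 t - (f1 0 + c * t)).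
  move=> t01.
  have dF : is_derive t 1 ((f1 0 \*: (id : R -> R)) + (c / 2 \*: ((id : R -> R) * id)))
    (f1 0 *: 1 + c / 2 *: (t *: 1 + t *: 1)) by apply: is_deriveD.
  apply: (is_derive_eq (is_deriveB (d1 t t01) dF)).
  rewrite -![_ *: _]/(_ * _); lra.
have [|x x01 E] := mvt01 dp (_ : 0 <= 1 <= 1); first by rewrite ler01 lexx.
have := lo _ x01; move: E; rewrite /p mulr1; lra.
Qed.

Lemma taylor01_le (f f1 f2 : R -> R) (c : R) :
  (forall t : R, 0 <= t <= 1 -> is_derive t 1 f (f1 t)) ->
  (forall t : R, 0 <= t <= 1 -> is_derive t 1 f1 (f2 t)) ->
  (forall t : R, 0 <= t <= 1 -> f2 t <= c) -> f 1 <= f 0 + f1 0 + c / 2.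
Proof.
move=> d1 d2 h.
suff : - f 0 + - f1 0 + - c / 2 <= - f 1 by lra.
apply: (@taylor01_ge (fun t => - f t) (fun t => - f1 t) (fun t => - f2 t) (- c)) => t t01.
- exact: is_deriveN (d1 t t01).
- exact: is_deriveN (d2 t t01).
- by rewrite lerN2 h.
Qed.

End line.

Section taylor.
Context (R : realType) (V : normedModType R) (I : finType) (e : I -> V) (cf : I -> V -> R).
Hypotheses (cfE : forall v, v = \sum_i cf i v *: e i) (cf_le : forall i v, `|cf i v| <= `|v|).
Variables (U : set V) (F : V -> R).
Hypotheses (oU : open U) (C2 : Ck 2 U F).

Lemma C2_differentiable x : U x -> differentiable F x.
Proof. by have [h _] := C2; exact: h. Qed.

Lemma C2_differentiable1 w x : U x -> differentiable ('D_w F) x.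
Proof. by have [_ /(_ w)[h _]] := C2; exact: h. Qed.

Lemma C2_continuous2 v w x : U x -> {for x, continuous ('D_v ('D_w F))}.
Proof.
have [_ /(_ w)[_ /(_ v) h]] := C2; move=> Ux; move: h => /=.
by rewrite continuous_open_subspace// => /(_ x); rewrite inE; exact.
Qed.

Lemma C2_derivative_sum w x : U x -> 'D_w F x = \sum_j cf j w * 'D_(e j) F x.
Proof.
move=> Ux; have d := C2_differentiable Ux; rewrite {1}(cfE w) deriveE// linear_sum.
by apply: eq_bigr => j _; rewrite linearZ /= -deriveE.
Qed.

Lemma C2_derivative2_sum v w x : U x ->
  'D_v ('D_w F) x = \sum_j cf j w * 'D_v ('D_(e j) F) x.
Proof.
move=> Ux.
have dj j : derivable ('D_(e j) F) x v by apply: diff_derivable; exact: C2_differentiable1.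
have -> : 'D_v ('D_w F) x = 'D_v (fun y => \sum_j cf j w *: 'D_(e j) F y) x.
  apply: near_eq_derive; have : nbhs x U by exact: open_nbhs_nbhs.
  by apply: filterS => y Uy; exact: C2_derivative_sum.
have : is_derive x v (\sum_j (cf j w \*: ('D_(e j) F))) (\sum_j cf j w *: 'D_v ('D_(e j) F) x).
  elim/big_ind2: _ => [|f df h dh df1 dh1|j _]; first exact: is_derive_cst.
    exact: is_deriveD.
  by apply: is_deriveZ; exact/derivableP.
move=> d; rewrite -[RHS]/(\sum_j cf j w *: 'D_v ('D_(e j) F) x) -[RHS]derive_val.
congr ('D_v _ x); apply/funext => y.
by rewrite fct_sumE.
Qed.

(** Class C^2 is expressed by iterated derivatives in fixed directions. Compactness bounds them for
    the finitely many pairs of basis vectors, and bilinearity extends the bound to all [v] and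
    [w]. *)
Lemma C2_hessian_bound (K : set V) : compact K -> K `<=` U ->
  exists2 C : R, 0 <= C & forall x v w, K x -> `|'D_v ('D_w F) x| <= C * `|v| * `|w|.
Proof.
move=> cK KU.
have [B HB] : exists B : I -> I -> R, forall i j x, K x -> `|'D_(e i) ('D_(e j) F) x| <= B i j.
  have h (ij : I * I) : exists b, forall x, K x -> `|'D_(e ij.1) ('D_(e ij.2) F) x| <= b.
    have /compact_bounded[b [_ hb]] : compact ('D_(e ij.1) ('D_(e ij.2) F) @` K).
      apply: continuous_compact => //; apply: continuous_in_subspaceT => x.
      by rewrite inE => Kx; apply: C2_continuous2; exact: KU.
    by exists (b + 1) => x Kx; apply: (hb (b + 1)); [rewrite ltrDl|exists x].
  have [B HB] := choice h; exists (fun i j => B (i, j)) => i j x Kx; exact: (HB (i, j)).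
exists (\sum_i \sum_j `|B i j|); first by apply: sumr_ge0 => i _; apply: sumr_ge0.
move=> x v w Kx; have Ux := KU _ Kx.
rewrite C2_derivative2_sum//.
have -> : \sum_j cf j w * 'D_v ('D_(e j) F) x =
  \sum_j \sum_i cf j w * (cf i v * 'D_(e i) ('D_(e j) F) x).
  apply: eq_bigr => j _; rewrite -mulr_sumr; congr (_ * _).
  have d := C2_differentiable1 (e j) Ux; rewrite {1}(cfE v) deriveE// linear_sum.
  by apply: eq_bigr => i _; rewrite linearZ /= -deriveE.
rewrite exchange_big /= !mulr_suml; apply: (le_trans (ler_norm_sum _ _ _)).
apply: ler_sum => i _; rewrite !mulr_suml; apply: (le_trans (ler_norm_sum _ _ _)).
apply: ler_sum => j _; rewrite !normrM.
rewrite [leLHS](_ : _ = `|'D_(e i) ('D_(e j) F) x| * `|cf i v| * `|cf j w|); last by ring.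
apply: ler_pM => //.
by apply: ler_pM => //; exact: (le_trans (HB i j x Kx) (ler_norm _)).
Qed.

Lemma C2_line x k t : U (x + t *: k) ->
  is_derive t 1 (fun s : R => F (x + s *: k)) ('D_k F (x + t *: k)).
Proof. by move=> Ut; apply/is_derive_line/diff_derivable; exact: C2_differentiable. Qed.

Lemma C2_line1 w x k t : U (x + t *: k) ->
  is_derive t 1 (fun s : R => 'D_w F (x + s *: k)) ('D_k ('D_w F) (x + t *: k)).
Proof. by move=> Ut; apply/is_derive_line/diff_derivable; exact: C2_differentiable1. Qed.

Lemma C2_taylor_ge x k (c : R) : (forall t : R, 0 <= t <= 1 -> U (x + t *: k)) ->
  (forall t : R, 0 <= t <= 1 -> c <= 'D_k ('D_k F) (x + t *: k)) ->
  F x + 'D_k F x + c / 2 <= F (x + k).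
Proof.
move=> Us h.
have := @taylor01_ge R (fun s => F (x + s *: k)) (fun s => 'D_k F (x + s *: k))
  (fun s => 'D_k ('D_k F) (x + s *: k)) c.
rewrite scale0r scale1r addr0; apply.
- by move=> t t01; exact: (C2_line (Us t t01)).
- by move=> t t01; exact: (C2_line1 k (Us t t01)).
- exact: h.
Qed.

Lemma C2_taylor_le x k (c : R) : (forall t : R, 0 <= t <= 1 -> U (x + t *: k)) ->
  (forall t : R, 0 <= t <= 1 -> 'D_k ('D_k F) (x + t *: k) <= c) ->
  F (x + k) <= F x + 'D_k F x + c / 2.
Proof.
move=> Us h.
have := @taylor01_le R (fun s => F (x + s *: k)) (fun s => 'D_k F (x + s *: k))
  (fun s => 'D_k ('D_k F) (x + s *: k)) c.
rewrite scale0r scale1r addr0; apply.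
- by move=> t t01; exact: (C2_line (Us t t01)).
- by move=> t t01; exact: (C2_line1 k (Us t t01)).
- exact: h.
Qed.

Lemma C2_derive_lipschitz x k w (C : R) : (forall t : R, 0 <= t <= 1 -> U (x + t *: k)) ->
  (forall t : R, 0 <= t <= 1 -> `|'D_k ('D_w F) (x + t *: k)| <= C) ->
  `|'D_w F (x + k) - 'D_w F x| <= C.
Proof.
move=> Us h.
have i01 : is_true ((0 <= (1 : R)) && ((1 : R) <= 1)) by rewrite ler01 lexx.
have [|c c01] := @mvt01 R (fun s => 'D_w F (x + s *: k)) (fun s => 'D_k ('D_w F) (x + s *: k)) _ 1 i01.
  by move=> t t01; exact: (C2_line1 w (Us t t01)).
by rewrite scale0r scale1r addr0 mulr1 => ->; exact: h.
Qed.

End taylor.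

(** * C^1 curves, chains of chart segments, upper bounds of the distance *)

Section smooth_step.
Context (R : realType).

Lemma is_derive_quad (f : R -> R) (t d : R) :
  (forall h, `|f (t + h) - f t - d * h| <= h ^+ 2) -> is_derive t 1 f d.
Proof.
move=> H.
have cv : h^-1 *: ((f \o shift t) (h *: 1) - f t) @[h --> 0^'] --> d.
  apply/cvgrPdist_lt => e e0.
  near=> h.
  have hn0 : h != 0 by near: h; exact: nbhs_dnbhs_neq.
  have he : `|h| < e by near: h; apply: dnbhs0_lt.
  apply: le_lt_trans he.
  rewrite /= [h *: 1]mulr1 addrC.
  have -> : - (h^-1 *: (f (h + t) - f t)) + d = - (h^-1 * (f (t + h) - f t - d * h)).
    have aux (h' d' F : R) : h' != 0 -> - (h'^-1 * F) + d' = - (h'^-1 * (F - d' * h')).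
      by move=> ?; field.
    by rewrite (addrC h); exact: aux.
  rewrite normrN normrM.
  have h0 : 0 < `|h| by rewrite normr_gt0.
  rewrite -(ler_pM2l h0) mulrA -normrM divff// normr1 mul1r -normrM -expr2.
  by rewrite (ger0_norm (sqr_ge0 h)).
apply: DeriveDef; first by apply/cvg_ex; exists d.
by apply/cvg_lim => //; exact: Rhausdorff.
Unshelve. all: end_near. Qed.

Definition possq (t : R) : R := Num.max t 0 ^+ 2.

Lemma is_derive_possq (t : R) : is_derive t 1 possq (2 * Num.max t 0).
Proof.
apply: is_derive_quad => h; rewrite /possq !expr2 ler_norml /Num.max.
by case: ltP => h1; case: ltP => h2; apply/andP; split; nra.
Qed.

(** A C^1 step from 0 to 1 on [[0, 1]], made of two parabolas: its derivative is the tent of height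
    2. *)
Definition sstep (t : R) : R := 2 * (possq t - 2 * possq (t - 2^-1) + possq (t - 1)).
Definition dsstep (t : R) : R :=
  4 * (Num.max t 0 - 2 * Num.max (t - 2^-1) 0 + Num.max (t - 1) 0).

Lemma is_derive_sstep (t : R) : is_derive t 1 sstep (dsstep t).
Proof.
have sh (a : R) : is_derive t 1 (fun s => possq (s - a)) (2 * Num.max (t - a) 0).
  have d := is_derive_possq (t - a).
  apply: is_derive_quad => h; rewrite /possq !expr2 ler_norml /Num.max.
  by case: ltP => h1; case: ltP => h2; apply/andP; split; nra.
have d := is_deriveZ 2 (is_deriveD (is_deriveB (is_derive_possq t) (is_deriveZ 2 (sh 2^-1))) (sh 1)).
apply: (is_derive_eq d); rewrite /dsstep -![_ *: _]/(_ * _); ring.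
Qed.

Lemma dsstep_continuous : continuous dsstep.
Proof.
move=> t; apply: cont_eps => e e0; exists (e / 32); first by rewrite divr_gt0.
have L (u v : R) : `|Num.max u 0 - Num.max v 0| <= `|u - v|.
  by rewrite /Num.max; case: ltP => ?; case: ltP => ?; case: (ler0P (u - v)) => ?;
    rewrite ?ler_norml; first [lra | apply/andP; split; lra].
move=> s h; rewrite /dsstep.
have l1 := le_lt_trans (L t s) h.
have l2 : `|Num.max (t - 2^-1) 0 - Num.max (s - 2^-1) 0| < e / 32.
  by apply: le_lt_trans (L _ _) _; rewrite opprB addrA subrK.
have l3 : `|Num.max (t - 1) 0 - Num.max (s - 1) 0| < e / 32.
  by apply: le_lt_trans (L _ _) _; rewrite opprB addrA subrK.
move: l1 l2 l3; rewrite !ltr_norml => /andP[? ?] /andP[? ?] /andP[? ?].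
by apply/andP; split; lra.
Qed.

Lemma dsstep_bound t : 0 <= dsstep t <= 2.
Proof.
rewrite /dsstep /Num.max; case: ltP => ?; case: ltP => ?; case: ltP => ?;
  apply/andP; split; lra.
Qed.

Lemma sstep_bound t : 0 <= sstep t <= 1.
Proof.
rewrite /sstep /possq /Num.max !expr2; case: ltP => ?; case: ltP => ?; case: ltP => ?;
  apply/andP; split; nra.
Qed.

Lemma sstep0 t : t <= 0 -> sstep t = 0.
Proof.
move=> t0; rewrite /sstep /possq /Num.max !expr2; case: ltP => ?; case: ltP => ?; case: ltP => ?; nra.
Qed.

Lemma sstep1 t : 1 <= t -> sstep t = 1.
Proof.
move=> t0; rewrite /sstep /possq /Num.max !expr2; case: ltP => ?; case: ltP => ?; case: ltP => ?; nra.
Qed.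

Lemma is_derive_aff (al be t : R) : is_derive t 1 (fun s : R => al * s + be) al.
Proof.
have d := is_deriveD (is_deriveZ al (is_derive_id t (1 : R))) (is_derive_cst be t (1 : R)).
by apply: (is_derive_eq d); rewrite addr0 [LHS]mulr1.
Qed.

Lemma is_derive_comp_vec (W : normedModType R) (f : R -> W) (u : R -> R) (t al : R) (w : W) :
  is_derive (u t) 1 f w -> is_derive t 1 u al -> is_derive t 1 (f \o u) (al *: w).
Proof.
move=> df_ dl_.
have df : differentiable f (u t) by apply/derivable1_diffP; exact: ex_derive.
have dl : differentiable u t by apply/derivable1_diffP; exact: ex_derive.
have dc : differentiable (f \o u) t by exact: differentiable_comp.
apply: DeriveDef; first by apply: diff_derivable.
rewrite (deriveE _ dc) diff_comp//= -(deriveE _ dl) derive_val.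
by rewrite -[al in LHS]mulr1 -[_ * _]/(al *: (1 : R)) linearZ /= -(deriveE _ df) derive_val.
Qed.

Lemma is_derive_scale_vec (W : normedModType R) (u : R -> R) (p d : W) (t al : R) :
  is_derive t 1 u al -> is_derive t 1 (fun s => p + u s *: d) (al *: d).
Proof.
move=> du.
have dl : differentiable u t by apply/derivable1_diffP; exact: ex_derive.
have dz : is_derive t 1 (fun t => u t *: d) (al *: d).
  apply: DeriveDef; first by apply: diff_derivable; exact: differentiableZl.
  rewrite deriveE; last exact: differentiableZl.
  by rewrite diffZl//= -deriveE// derive_val.
have := is_deriveD (is_derive_cst p t (1 : R)) dz.
by rewrite add0r.
Qed.

Lemma is_derive_cont_vec (W : normedModType R) (f : R -> W) (t : R) (w : W) :
  is_derive t 1 f w -> {for t, continuous f}.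
Proof.
move=> df; apply: differentiable_continuous; apply/derivable1_diffP; exact: ex_derive.
Qed.

Lemma near_eq_continuous (T : topologicalType) (f h : R -> T) (t : R) :
  (\forall s \near t, f s = h s) -> {for t, continuous f} -> {for t, continuous h}.
Proof.
move=> E cf; rewrite /prop_for /continuous_at -(nbhs_singleton E).
apply: cvg_trans cf; apply: near_eq_cvg; exact: E.
Qed.

End smooth_step.

Section curves.
Context (R : realType) (n : nat) (M : topologicalType) (X : C2manifold R n M).
Variable g : riemannian X.
Implicit Types (c : R -> M) (x y z : M).

(** One chart for each time is enough, since [speed_curve_C1] carries the derivative over to all
    other charts; this makes the property easy to check on concatenations. *)
Definition loc_curve (V : R) c (t : R) := exists a : chart R n M, exists w : R -> 'rV[R]_n,
  [/\ atlas X a, dom a (c t),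
   (\forall s \near t, is_derive (s : R) (1 : R) (fwd a \o c : R -> 'rV[R]_n) (w s)),
   {for t, continuous w} & cnorm g a (fwd a (c t)) (w t) <= V].

Definition speed_curve (V : R) c := continuous c /\ forall t, loc_curve V c t.

Lemma speed_curve_tnorm V c t : speed_curve V c -> tnorm g (velocity X c t) <= V.
Proof.
move=> [cc /(_ t)[a [w [aa act /nbhs_singleton dw cw h]]]].
have [_ ->] := velocity_chart aa (cc t) act dw.
by rewrite tnorm_chart.
Qed.

Lemma speed_curve_C1 V c : speed_curve V c -> C1curve X c.
Proof.
move=> [cc lc]; split => // b ab.
pose U := c @^-1` dom b.
have oU : open U by apply: open_comp; [move=> t _; exact: cc|exact: dom_open].
have main t : U t -> exists w' : R -> 'rV[R]_n,
    (\forall s \near t, is_derive (s : R) (1 : R) (fwd b \o c : R -> 'rV[R]_n) (w' s)) /\ {for t, continuous w'}.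
  move=> Ut; have [a [w [aa act dw cw _]]] := lc t.
  have ov : overlap a b (fwd a (c t)) by exact: overlap_fwd.
  pose w' s := 'D_(w s) (trans a b) (fwd a (c s)).
  have ndom : \forall s \near t, dom a (c s) by apply: cc; exact: nbhs_dom.
  have nU : \forall s \near t, U s by exact: open_nbhs_nbhs.
  exists w'; split.
    near=> s.
    have as_ : dom a (c s) by near: s.
    have bs : dom b (c s) by near: s.
    have ds : is_derive s 1 (fwd a \o c) (w s) by near: s.
    have ovs := overlap_fwd as_ bs.
    have dt := trans_differentiable aa ab ovs.
    have df : differentiable (fwd a \o c) s by apply/derivable1_diffP; exact: ex_derive.
    have dcomp : differentiable (trans a b \o (fwd a \o c)) s by exact: differentiable_comp.
    apply: (@near_eq_is_derive _ _ _ (trans a b \o (fwd a \o c))).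
      have nd : \forall r \near s, dom a (c r) by apply: cc; exact: nbhs_dom.
      by near=> r; rewrite /trans /= fwdK//; near: r; exact: nd.
    apply: DeriveDef; first exact: diff_derivable.
    rewrite deriveE// diff_comp//= /w' [RHS](deriveE _ dt); congr ('d _ _ _).
    by rewrite -deriveE// derive_val.
  (* The derivative is expanded along the basis because the continuity of a directional derivative
     in the base point is given for fixed directions only, and here the direction [w s] moves
     too. *)
  pose w2 s := \sum_i (w s 0 i *: 'D_(delta_mx 0 i) (trans a b) (fwd a (c s))).
  have w2E : \forall s \near t, w2 s = w' s.
    near=> s.
    have as_ : dom a (c s) by near: s.
    have bs : dom b (c s) by near: s.
    have dt := trans_differentiable aa ab (overlap_fwd as_ bs).
    rewrite /w' {1}[w s]row_sum_delta deriveE// linear_sum; apply: eq_bigr => i _.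
    by rewrite linearZ /= -deriveE.
  apply: (near_eq_continuous w2E); rewrite /w2.
  have Dc i : 'D_(delta_mx 0 i) (trans a b) (fwd a (c s)) @[s --> t] -->
      'D_(delta_mx 0 i) (trans a b) (fwd a (c t)).
    have [_ /(_ (delta_mx 0 i))[/(_ _ ov) d2 _]] := transition_C2 aa ab.
    have h1 := differentiable_continuous d2.
    have h2 : fwd a (c s) @[s --> t] --> fwd a (c t).
      exact: (cvg_comp _ _ (cc t) (fwd_cvg act)).
    exact: (cvg_comp _ _ h2 h1).
  have wc i : w s 0 i @[s --> t] --> w t 0 i.
    apply: (cvg_comp _ (fun N : 'rV[R]_n => N 0 i) cw); exact: coord_continuous.
  apply: cvg_big; [exact: add_continuous|move=> i _; exact: (cvgZ (wc i) (Dc i))].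
split => [t Ut|v].
  have [w' [/nbhs_singleton dw _]] := main t Ut.
  by apply/derivable1_diffP; exact: ex_derive.
rewrite /= continuous_open_subspace// => t; rewrite inE => Ut.
have [w' [dw cw]] := main t Ut.
have E : \forall s \near t, v *: w' s = 'D_v (fwd b \o c) s.
  apply: filterS dw => s ds.
  have df : differentiable (fwd b \o c) s by apply/derivable1_diffP; exact: ex_derive.
  rewrite deriveE// -[v in RHS]mulr1 -[v * 1]/(v *: (1 : R)) linearZ /= -deriveE//.
  by rewrite derive_val.
have C : (v : R) *: w' s @[s --> t] --> (v : R) *: w' t by apply: cvgZl_tmp; exact: cw.
exact: (near_eq_continuous E C).
Unshelve. all: end_near. Qed.

Lemma speed_curve_rdist V c x y : 0 <= V -> speed_curve V c -> c 0 = x -> c 1 = y ->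
  (rdist g x y <= V%:E)%E.
Proof.
move=> V0 sc c0 c1; apply: (@le_trans _ _ (curve_length g c 0 1)).
  apply: ereal_inf_lbound; exists c => //; split => //; exact: speed_curve_C1 sc.
apply: (@le_trans _ _ (\int[@lebesgue_measure R]_(t in `[0%R, 1%R]) V%:E)%E).
  by apply: le_integral_lower => t _; rewrite lee_fin; exact: speed_curve_tnorm.
by rewrite integral_cst_itv// subr0 mulr1.
Qed.

Lemma loc_curve_near V c c' t : (\forall s \near t, c s = c' s) ->
  loc_curve V c t -> loc_curve V c' t.
Proof.
move=> E [a [w [aa act dw cw h]]]; exists a, w.
have Et := nbhs_singleton E.
split; rewrite -?Et//.
have E2 := near_join E.
near=> s; apply: (@near_eq_is_derive _ _ _ (fwd a \o c)); last by near: s.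
have : \forall r \near s, c r = c' r by near: s.
by apply: filterS => r /= ->.
Unshelve. all: end_near. Qed.

Lemma speed_curve_affine V c (al be : R) : speed_curve V c ->
  speed_curve (`|al| * V) (fun s => c (al * s + be)).
Proof.
move=> [cc lc].
have ca : continuous (fun s : R => al * s + be).
  move=> s; apply: cvgD; [exact: mulrl_continuous|exact: cvg_cst].
split=> [s|t]; first exact: (continuous_comp (ca s) (cc _)).
have [a [w [aa act dw cw h]]] := lc (al * t + be).
exists a, (fun s => al *: w (al * s + be)); split.
- exact: aa.
- exact: act.
- have : \forall s \near t, is_derive (al * s + be) 1 (fwd a \o c) (w (al * s + be)).
    exact: (ca t _ dw).
  apply: filterS => s ds.
  have D := @is_derive_comp_vec R _ (fwd a \o c) (fun s => al * s + be) s al _ ds (is_derive_aff al be s).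
  exact D.
- by apply: cvgZl_tmp; exact: (cvg_comp _ _ (ca t) cw).
- rewrite !cnormE bilZ sqrtrM ?sqr_ge0// sqrtr_sqr ler_wpM2l//; by rewrite -cnormE.
Qed.

(* constant near both ends, so that concatenations are again C^1 *)
Definition flat (T : R) x y c := [/\ 0 < T, speed_curve 1 c &
  exists2 k : R, 0 < k & (forall s, s <= k -> c s = x) /\ (forall s, T - k <= s -> c s = y)].

Lemma loc_curve_cst V x t : 0 <= V -> loc_curve V (cst x) t.
Proof.
move=> V0; exists (chart_at X x), (cst 0); split.
- exact: chart_at_atlas.
- exact: chart_at_dom.
- by near=> s; exact: (is_derive_cst (fwd (chart_at X x) x) s (1 : R)).
- exact: cvg_cst.
- by rewrite cnormE /bil !mul0mx mxE sqrtr0.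
Unshelve. all: end_near. Qed.

(** Near each time the concatenation agrees with [c1], with a translate of [c2], or, at the
    junction, with the constant [y]. *)
Lemma flat_cat T1 T2 x y z c1 c2 : flat T1 x y c1 -> flat T2 y z c2 ->
  exists c, flat (T1 + T2) x z c.
Proof.
move=> [T10 s1 [k1 k10 [f1 g1]]] [T20 s2 [k2 k20 [f2 g2]]].
pose c t := if t <= T1 then c1 t else c2 (t - T1).
have s2' : speed_curve 1 (fun t => c2 (1 * t + - T1)).
  by have := speed_curve_affine 1 (- T1) s2; rewrite normr1 mulr1.
have [cc1 lc1] := s1; have [cc2 lc2] := s2'.
have L t : exists c', [/\ \forall s \near t, c' s = c s, {for t, continuous c'} & loc_curve 1 c' t].
  have [h|h|h] := ltgtP t T1.
  - exists c1; split; [|exact: cc1|exact: lc1]; near=> s; rewrite /c ifT//; apply/ltW.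
    by near: s; exact: lt_nbhsl.
  - exists (fun t => c2 (1 * t + - T1)); split; [|exact: cc2|exact: lc2].
    near=> s; rewrite /c mul1r ifF//.
    by apply/negbTE; rewrite -ltNge; near: s; exact: lt_nbhsr.
  - exists (cst y); split; [|exact: cvg_cst|exact: loc_curve_cst].
    near=> s; rewrite /c /=; case: ifPn => [_|].
      by rewrite g1// ltW//; near: s; apply: lt_nbhsr; rewrite h ltrBlDr ltrDl.
    rewrite -ltNge => Ts; rewrite f2//.
    have : s < T1 + k2 by near: s; apply: lt_nbhsl; rewrite h ltrDl.
    by rewrite -ltrBlDl => /ltW.
exists c; split; first exact: addr_gt0.
- split=> t.
    have [c' [E cc' _]] := L t.
    exact: (near_eq_continuous E cc').
  have [c' [E _ lc']] := L t; exact: loc_curve_near E lc'.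
- exists (Num.min (Num.min k1 k2) (Num.min T1 T2)); first by rewrite !lt_min k10 k20 T10.
  split=> s; rewrite /c.
    by rewrite !le_min => /andP[/andP[a1 a2] /andP[-> _]]; exact: f1.
  move=> h; have [m1 m2] : Num.min (Num.min k1 k2) (Num.min T1 T2) <= k2 /\
      Num.min (Num.min k1 k2) (Num.min T1 T2) <= T2.
    by rewrite !ge_min !lexx !orbT.
  have [sT|sT] := leP s T1; last by rewrite g2//; lra.
  have -> : s = T1 by lra.
  have : z = c2 0 by rewrite g2//; lra.
  by rewrite f2 ?(ltW k20)// => ->; rewrite g1//; lra.
Unshelve. all: end_near. Qed.

(** An elementary move: a coordinate segment in a single chart, run at metric speed at most [w] in
    unit time. *)
Definition step y (w : R) z := exists a : chart R n M, exists p d : 'rV[R]_n,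
  [/\ atlas X a, bwd a p = y, bwd a (p + d) = z &
   forall t : R, 0 <= t <= 1 -> tgt a (p + t *: d) /\ cnorm g a (p + t *: d) d <= w].

Lemma step_ge0 y w z : step y w z -> 0 <= w.
Proof.
move=> [a [p [d [_ _ _ /(_ 0)]]]]; rewrite lexx ler01 => -[]// _.
by apply: le_trans; rewrite cnormE sqrtr_ge0.
Qed.

(** The segment is run with the profile [sstep] during the middle half of [[0, T]]: [u] sends
    [T / 4] to 0 and [3 T / 4] to 1. The speed is at most [2 / T * 2 * w], whence the condition
    [4 * w <= T]. *)
Lemma step_flat y w z T : step y w z -> 0 < T -> 4 * w <= T -> exists c, flat T y z c.
Proof.
move=> st T0 wT; have w0 := step_ge0 st; case: st => [a [p [d [aa py pz H]]]].
have T1 : T^-1 * T = 1 by rewrite mulVf// gt_eqF.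
pose u (t : R) := (2 * T^-1) * t + - 2^-1.
pose ph t := sstep (u t).
pose c t := bwd a (p + ph t *: d).
have tg t : tgt a (p + ph t *: d) by have [] := H _ (sstep_bound (u t)).
have du (t : R) : is_derive t 1 u (2 * T^-1) by exact: is_derive_aff.
have dph (t : R) : is_derive t 1 ph (2 * T^-1 * dsstep (u t)).
  exact: (is_derive_comp_vec (is_derive_sstep (u t)) (du t)).
have df (t : R) : is_derive t 1 (fun t => p + ph t *: d) ((2 * T^-1 * dsstep (u t)) *: d).
  exact: is_derive_scale_vec.
have cu : continuous u by move=> t; exact: is_derive_cont_vec (du t).
exists c; split => //.
- split=> t.
    exact: (cvg_comp _ _ (is_derive_cont_vec (df t)) (bwd_cvg (tg t))).
  exists a, (fun t => (2 * T^-1 * dsstep (u t)) *: d); split.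
  + exact: aa.
  + exact: (bwd_dom (tg t)).
  + have -> : fwd a \o c = (fun t => p + ph t *: d) by apply/funext => s /=; rewrite /c bwdK.
    by near=> s; exact: df.
  + by apply: cvgZr_tmp; apply: cvgMr; exact: (cvg_comp _ _ (cu t) (@dsstep_continuous R (u t))).
  + rewrite /c bwdK// !cnormE bilZ sqrtrM ?sqr_ge0// sqrtr_sqr -cnormE.
    have /andP[b1 b2] := dsstep_bound (u t).
    have Ti : 0 < T^-1 by rewrite invr_gt0.
    rewrite ger0_norm; last by apply: mulr_ge0 => //; apply: mulr_ge0 => //; exact: ltW.
    have [_ h] := H _ (sstep_bound (u t)).
    apply: (@le_trans _ _ (2 * T^-1 * 2 * w)).
      apply: ler_pM; [|by rewrite cnormE sqrtr_ge0| |exact: h].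
        by apply: mulr_ge0 => //; apply: mulr_ge0 => //; exact: ltW.
      by apply: ler_wpM2l => //; apply: mulr_ge0 => //; exact: ltW.
    have : T^-1 * (4 * w) <= T^-1 * T by rewrite ler_wpM2l// ltW.
    rewrite T1; lra.
- exists (T / 4); first by rewrite divr_gt0.
  have e1 : T^-1 * (T / 4) = 1 / 4 by rewrite mulrA T1.
  split=> s hs; rewrite /c.
    rewrite /ph sstep0 ?scale0r ?addr0// /u.
    have : T^-1 * s <= T^-1 * (T / 4) by rewrite ler_wpM2l// invr_ge0 ltW.
    rewrite e1; lra.
  rewrite /ph sstep1 ?scale1r// /u.
  have : T^-1 * (T - T / 4) <= T^-1 * s by rewrite ler_wpM2l// invr_ge0 ltW.
  rewrite mulrBr e1 T1; lra.
Unshelve. all: end_near. Qed.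

Lemma flat_rdist T x y c : flat T x y c -> (rdist g x y <= T%:E)%E.
Proof.
move=> [T0 sc [k k0 [f1 f2]]].
have sc' := speed_curve_affine T 0 sc.
rewrite mulr1 (gtr0_norm T0) in sc'.
apply: (speed_curve_rdist (ltW T0) sc'); rewrite addr0.
  by rewrite mulr0 f1// ltW.
by rewrite mulr1 f2//; lra.
Qed.

(** Chains of elementary moves whose length bounds add up to [V]. They concatenate and reverse
    without loss; the corners are smoothed only when a bound of [rdist] is needed, at the price of a
    factor 4. *)
Inductive reach : M -> R -> M -> Prop :=
| reach0 x : reach x 0 x
| reachS x V y w z : reach x V y -> step y w z -> reach x (V + w) z.

Lemma reach_flat x V y : reach x V y -> forall e : R, 0 < e -> exists c, flat (4 * V + e) x y c.
Proof.
elim=> {x V y} [x|x V y w z _ IH st] e e0.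
  exists (cst x); rewrite mulr0 add0r; split => //; last by exists e.
  by split=> t; [exact: cvg_cst|exact: loc_curve_cst].
have e20 : 0 < e / 2 by rewrite divr_gt0.
have [c1 F1] := IH _ e20; have w0 := step_ge0 st.
have [||c2 F2] := @step_flat y w z (4 * w + e / 2) st; [by rewrite ltr_wpDl// mulr_ge0|by rewrite lerDl ltW|].
have [c F] := flat_cat F1 F2; exists c.
by have -> : 4 * (V + w) + e = 4 * V + e / 2 + (4 * w + e / 2) by lra.
Qed.

Lemma reach_rdist x V y : reach x V y -> (rdist g x y <= (4 * V)%:E)%E.
Proof.
move=> rc; apply/lee_addgt0Pr => e e0; have [c F] := reach_flat rc e0.
by rewrite -EFinD; exact: flat_rdist F.
Qed.

Lemma box_step a (y0 : 'rV[R]_n) (r k : R) (y y' : 'rV[R]_n) : atlas X a -> box y0 r `<=` tgt a -> 0 < k ->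
  (forall y w : 'rV[R]_n, box y0 r y -> cnorm g a y w <= k^-1 * `|w|) ->
  box y0 r y -> box y0 r y' -> step (bwd a y) (k^-1 * `|y' - y|) (bwd a y').
Proof.
move=> aa bt k0 H by_ by'; exists a, y, (y' - y); split => //; first by rewrite addrC subrK.
move=> t /andP[t0 t1].
have b : box y0 r (y + t *: (y' - y)).
  rewrite /box /= (_ : _ - y0 = (1 - t) *: (y - y0) + t *: (y' - y0)).
    apply: (le_trans (ler_normD _ _)); rewrite !normrZ (ger0_norm t0) ger0_norm ?subr_ge0//.
    have t1' : 0 <= 1 - t by rewrite subr_ge0.
    have h1 := ler_wpM2l t0 by'; have h2 := ler_wpM2l t1' by_; lra.
  apply/rowP => i; rewrite !mxE; ring.
by split; [exact: bt|exact: H].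
Qed.

End curves.

(** * Induction along an interval; lower bounds of integrals along curves *)

Section ac_curves.
Context (R : realType).
Local Notation mu := (@lebesgue_measure R).

(** Real induction: by the local hypothesis at the supremum of the times reachable from [r], a later
    time would be reachable if this supremum were less than [s]. *)
Lemma interval_ind (P : R -> R -> Prop) (r s : R) : r <= s ->
  (forall T, r <= T <= s -> exists2 e : R, 0 < e & forall a b, r <= a -> a <= T -> T <= b ->
     b <= s -> T - e < a -> b < T + e -> P a b) ->
  (forall a b c, r <= a -> a <= b -> b <= c -> c <= s -> P a b -> P b c -> P a c) -> P r s.
Proof.
move=> rs loc tr.
have Prr : P r r.
  by have [|e e0 He] := loc r; [rewrite lexx|apply: He => //; [rewrite ltrBlDr|]; rewrite ltrDl].
pose S := [set t | r <= t <= s /\ P r t].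
have Sr : S r by rewrite /S /= lexx rs.
have hS : has_sup S by split; [exists r | exists s => t [/andP[_ ?] _]].
have tb : r <= sup S <= s.
  by rewrite (ub_le_sup hS.2 Sr)/= ge_sup//; [exists r | move=> t [/andP[_ ?] _]].
have [rt ts] := andP tb.
have [e e0 He] := loc _ tb.
have [t [/andP[rt' tS'] Pt] tS] := sup_adherent e0 hS.
have tle : t <= sup S by apply: ub_le_sup; [exact: hS.2|split; rewrite ?rt'].
pose t' := Num.min (sup S + e / 2) s.
have t't : sup S <= t' by rewrite /t' le_min ts lerDl divr_ge0// ltW.
have t's : t' <= s by rewrite /t' ge_min lexx orbT.
have lt' : t' < sup S + e by rewrite gt_min ltrD2l ltr_pdivrMr// ltr_pMr// (ltr_nat R 1 2).
have P2 : P r t' by apply: (tr _ t) => //; [exact: le_trans t't|exact: He].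
have : t' <= sup S by apply: ub_le_sup; [exact: hS.2|split=> //; rewrite t's (le_trans rt)].
rewrite {1}/t' ge_min => /orP[|h]; first by rewrite gerDl leNgt divr_gt0.
suff -> : s = t' by [].
by apply/eqP; rewrite eq_le t's andbT (le_trans h).
Qed.

Lemma ac_on_lipschitz (f : R -> R) r s B : 0 <= B ->
  (forall x y, r <= x -> x <= y -> y <= s -> `|f y - f x| <= B * (y - x)) -> ac_on r s f.
Proof.
move=> B0 H e e0; exists (e / (B + 1)); first by rewrite divr_gt0// ltr_wpDl.
move=> l /andP[al _] pl.
have h : pvar f l <= B * plen l.
  rewrite /pvar /plen mulr_sumr big_seq [leRHS]big_seq; apply: ler_sum => p pl'.
  by have /and3P[? ? ?] := allP al _ pl'; exact: H.
have l0 : 0 <= plen l.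
  rewrite /plen big_seq; apply: sumr_ge0 => p pl'; have /and3P[_ ? _] := allP al _ pl'; by rewrite subr_ge0.
apply: (le_lt_trans h); move: pl; rewrite ltr_pdivlMr ?ltr_wpDl//; nra.
Qed.

Lemma ac_onD r s (f h : R -> R) : ac_on r s f -> ac_on r s h -> ac_on r s (f \+ h).
Proof.
move=> Hf Hh e e0; have e2 : 0 < e / 2 by rewrite divr_gt0.
have [d1 d10 H1] := Hf _ e2; have [d2 d20 H2] := Hh _ e2.
exists (Num.min d1 d2); first by rewrite lt_min d10.
move=> l pk; rewrite lt_min => /andP[/(H1 _ pk) h1 /(H2 _ pk) h2].
apply: (@le_lt_trans _ _ (pvar f l + pvar h l)); last by lra.
rewrite /pvar -big_split; apply: ler_sum => p _ /=.
by rewrite (_ : _ - _ = (f p.2 - f p.1) + (h p.2 - h p.1)) ?ler_normD//; ring.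
Qed.

Lemma ac_onZ r s (k : R) (f : R -> R) : ac_on r s f -> ac_on r s (fun x => k * f x).
Proof.
move=> Hf e e0; have k0 : 0 < `|k| + 1 by rewrite ltr_wpDl.
have [d d0 H] := Hf _ (divr_gt0 e0 k0); exists d => // l pk /(H _ pk).
rewrite ltr_pdivlMr//; apply: le_lt_trans.
rewrite /pvar mulr_suml; apply: ler_sum => p _.
by rewrite -mulrBr normrM [leLHS]mulrC ler_wpM2l// lerDl.
Qed.

Lemma ac_on_sum m r s (f : 'I_m -> R -> R) : (forall j, ac_on r s (f j)) ->
  ac_on r s (fun x => \sum_j f j x).
Proof.
move=> H; rewrite (_ : (fun x => _) = \sum_j f j); last by apply/funext => x; rewrite fct_sumE.
elim/big_ind : _ => [|h1 h2 H1 H2|j _]; [|exact: ac_onD|exact: H].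
by apply: (@ac_on_lipschitz _ _ _ 0) => // x y *; rewrite subrr normr0 mul0r.
Qed.

(** For a fixed [q], the real function [pairing q (c t) - E * t] is absolutely continuous. Its
    derivative is below [F] almost everywhere, and the integral of its derivative is its
    increment. *)
Lemma vec_low n (c : R -> 'rV[R]_n) (r s E : R) (q : 'cV[R]_n) (F : R -> \bar R) : r <= s ->
  (forall j, ac_on r s (fun t => c t 0 j)) ->
  (forall (t : R) (w : 'rV[R]_n), r < t < s -> is_derive t 1 c w ->
     ((pairing q w - E)%:E <= F t)%E) ->
  ((pairing q (c s - c r) - E * (s - r))%:E <= \int[mu]_(t in `[r, s]) F t)%E.
Proof.
move=> rs ac H.
pose f t := pairing q (c t) + (- E) * t.
have acf : ac_on r s f.
  apply: ac_onD.
    rewrite (_ : (fun t => _) = (fun t => \sum_j q j 0 * c t 0 j)).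
      by apply: ac_on_sum => j; exact: ac_onZ.
    by apply/funext => t; rewrite /pairing mxE; apply: eq_bigr => j _; rewrite mulrC.
  apply: (@ac_on_lipschitz _ _ _ `|E|) => // x y _ xy _.
  by rewrite -mulrBr normrM normrN (@ger0_norm _ (y - x)) ?subr_ge0.
have [gf [_ Ig dg]] := ac_density rs acf.
have dc j : {ae mu, forall x, r < x < s -> derivable (fun t => c t 0 j) x 1}.
  have [gj [_ _]] := ac_density rs (ac j).
  by apply: (@filterS _ _ (ae_filter_ringOfSetsType mu)) => x h /h[].
have dca : {ae mu, forall x, forall j, r < x < s -> derivable (fun t => c t 0 j) x 1}.
  exact: (@filter_forall _ _ _ _ (ae_filter_ringOfSetsType mu)).
have [N [mN N0 HN]] := @filterI _ _ (ae_filter_ringOfSetsType mu) _ _ dg dca.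
pose N' := N `|` ([set r] `|` [set s]).
have mN' : measurable N' by apply: measurableU => //; exact: measurableU.
have N'0 : mu N' = 0.
  apply: null_set_setU => //; first exact: measurableU.
  by apply: null_set_setU => //; exact: lebesgue_measure_set1.
rewrite (_ : pairing q (c s - c r) - E * (s - r) = f s - f r); last first.
  by rewrite /f /pairing mulmxBl !mxE; ring.
rewrite -Ig; apply: (le_integral_ae mN' N'0) => t tI Nt.
have /andP[rt ts] : r < t < s.
  move: tI; rewrite /= in_itv/= => /andP[h1 h2].
  rewrite !lt_neqAle h1 h2 !andbT; apply/andP; split; apply/eqP => h; apply: Nt; right.
    by left; rewrite /= h.
  by right.
have [h1 h2] : (r < t < s -> derivable f t 1 /\ derive1 f t = gf t) /\
    (forall j, r < t < s -> derivable (fun t => c t 0 j) t 1).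
  by apply: contrapT => h; apply: Nt; left; exact: HN.
have rts : r < t < s by rewrite rt.
have [dft <-] := h1 rts.
have dct : derivable c t 1 by apply/derivable_mxP => i j; rewrite ord1; exact: h2.
have dv := DeriveDef dct erefl.
apply: le_trans (H t _ rts dv); rewrite lee_fin derive1E.
have dp : is_derive t 1 f (pairing q ('D_1 c t) - E).
  rewrite /f; have d1 : is_derive t 1 (fun t => pairing q (c t)) (pairing q ('D_1 c t)).
    rewrite (_ : (fun t => _) = \sum_j (fun t => q j 0 *: c t 0 j)); last first.
      apply/funext => x; rewrite fct_sumE /pairing mxE.
      by apply: eq_bigr => j _; rewrite mulrC.
    rewrite /pairing mxE.
    have := @is_derive_sum R R R n (fun j => (fun t => q j 0 *: c t 0 j)) t 1
      (fun j => 'D_1 c t 0 j * q j 0).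
    apply => j; rewrite derive_mx// mxE mulrC.
    apply: is_deriveZ; apply: DeriveDef; [exact: h2|by []].
  have := is_deriveD d1 (is_deriveZ (- E) (is_derive_id t (1 : R))).
  by rewrite [(- E)%:A]mulr1 => D; exact D.
by rewrite (@derive_val _ _ _ _ _ _ _ dp).
Qed.

End ac_curves.

(** * Comparison of the distance with coordinates in a box *)

Section local_distance.
Context (R : realType) (n : nat) (M : topologicalType) (X : C2manifold R n M).
Variable g : riemannian X.
Local Notation mu := (@lebesgue_measure R).
Implicit Types (c : R -> M) (x y z : M).

Definition goodbox (a : chart R n M) (y0 : 'rV[R]_n) (r k : R) : Prop :=
  [/\ atlas X a, 0 < r /\ 0 < k, box y0 r `<=` tgt a,
    (forall y w : 'rV[R]_n, box y0 r y -> k * `|w| <= cnorm g a y w <= k^-1 * `|w|) &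
    (forall y y' w : 'rV[R]_n, box y0 r y -> box y0 r y' -> cnorm g a y w <= 2 * cnorm g a y' w)].

Lemma goodbox_exists x : exists a (y0 : 'rV[R]_n) (r k : R), goodbox a y0 r k /\ dom a x /\ fwd a x = y0.
Proof.
have aa := chart_at_atlas X x; have ax := chart_at_dom X x.
have [r [k [r0 k0 bt h1 h2]]] := metric_box g aa (fwd_tgt ax).
by exists (chart_at X x), (fwd (chart_at X x) x), r, k.
Qed.

Lemma reach_cat x V y V' z : reach g x V y -> reach g y V' z -> reach g x (V + V') z.
Proof.
move=> h h2; move: x V h; elim: h2 => {y V' z} [z|z V' y w z' _ IH st] x V h.
  by rewrite addr0.
by rewrite addrA; apply: reachS st; exact: IH.
Qed.

Lemma step_sym y w z : step g y w z -> step g z w y.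
Proof.
move=> [a [p [d [aa py pz H]]]]; exists a, (p + d), (- d); split => //.
  by rewrite addrK.
move=> t /andP[t0 t1]; have [|h1 h2] := H (1 - t).
  by rewrite subr_ge0 t1 lerBlDr lerDl.
have E : p + d + t *: - d = p + (1 - t) *: d.
  by rewrite scalerN scalerBl scale1r addrA.
by rewrite E; split; [exact: h1|rewrite cnormE -(scaleN1r d) bilZ sqrrN expr1n mul1r -cnormE].
Qed.

Lemma reach_sym x V y : reach g x V y -> reach g y V x.
Proof.
elim=> {x V y} [x|x V y w z h IH st]; first exact: reach0.
rewrite addrC -[w]add0r; apply: (reach_cat _ IH); apply: (reachS (reach0 _ _)).
exact: step_sym.
Qed.

Section box_distance.
Variables (a : chart R n M) (y0 : 'rV[R]_n) (r k : R).
Hypothesis gb : goodbox a y0 r k.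

Lemma box_reach (y y' : 'rV[R]_n) : box y0 r y -> box y0 r y' ->
  reach g (bwd a y) (k^-1 * `|y' - y|) (bwd a y').
Proof.
move=> by_ by'; have [aa [r0 k0] bt h1 h2] := gb.
rewrite -[_ * _]add0r; apply: (reachS (reach0 _ _)).
by apply: (box_step aa bt k0) => // z w /h1 - /(_ w)/andP[].
Qed.

Lemma rdist_box_le (y y' : 'rV[R]_n) : box y0 r y -> box y0 r y' ->
  (rdist g (bwd a y) (bwd a y') <= (4 * (k^-1 * `|y' - y|))%:E)%E.
Proof. by move=> h1 h2; exact: reach_rdist (box_reach h1 h2). Qed.

(** The image of the box is compact, hence closed in a Hausdorff space. So a curve that is outside
    of it at some time stays outside for a while. *)
Lemma bwd_box_closed (r' : R) : r' <= r -> closed (bwd a @` box y0 r').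
Proof.
move=> rr; have [aa [r0 k0] bt _ _] := gb.
apply: compact_closed; first exact: (manifold_hausdorff X).
apply: continuous_compact.
  apply: (@continuous_subspaceW _ _ _ (tgt a)); last exact: bwd_cont.
  by apply: subset_trans bt => y /=; rewrite /box /= => h; exact: le_trans rr.
apply: bounded_closed_compact.
  exists (`|y0| + r'); split; first by rewrite num_real.
  move=> x xr y /=; rewrite /box /= => h; apply: le_trans (ltW xr).
  by rewrite -(subrK y0 y) addrC; apply: (le_trans (ler_normD _ _)); rewrite lerD2l.
have -> : box y0 r' = (fun y : 'rV[R]_n => `|y - y0|) @^-1` [set t | t <= r'] by [].
apply: (@closed_comp _ _ (fun y : 'rV[R]_n => `|y - y0|)); last exact: closed_le.
move=> y _; apply: cont_eps => e e0; exists e => // z h; apply: le_lt_trans h.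
by apply: le_trans (ler_dist_dist _ _) _; rewrite opprB addrA subrK.
Qed.

Lemma C1curve_local c T : C1curve X c -> dom a (c T) -> exists e B : R, exists w : R -> 'rV[R]_n, [/\ 0 < e, 0 <= B &
  forall t : R, `|t - T| < e -> [/\ dom a (c t), is_derive t 1 (fwd a \o c) (w t) & `|w t| <= B]].
Proof.
move=> [cc /(_ a)] H aT; have [aa _ _ _ _] := gb; have {H}[d1 /(_ 1) /= d2] := H aa.
have oU : open (c @^-1` dom a) by apply: open_comp; [move=> t _; exact: cc|exact: dom_open].
move: d2; rewrite continuous_open_subspace// => /(_ T); rewrite inE => /(_ aT) d2.
have /nbhs_ballP[e1 /= e10 H1] : nbhs T (c @^-1` dom a) by apply: open_nbhs_nbhs.
have [e2 e20 H2] := cont_inv d2 ltr01.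
exists (Num.min e1 e2), (`|'D_1 (fwd a \o c) T| + 1), ('D_1 (fwd a \o c)); split.
- by rewrite lt_min e10.
- exact: addr_ge0.
- move=> t; rewrite lt_min => /andP[t1 t2].
  have Ut : dom a (c t) by apply: H1; rewrite -ball_normE /= distrC.
  split; first exact: Ut.
    have dd : derivable (fwd a \o c) t 1 by apply/derivable1_diffP; exact: (d1 t Ut).
    exact: (DeriveDef dd erefl).
  have := H2 t; rewrite distrC => /(_ t2) h.
  rewrite -(subrK ('D_1 (fwd a \o c) T) ('D_1 (fwd a \o c) t)) addrC.
  by apply: (le_trans (ler_normD _ _)); rewrite lerD2l -normrN opprB ltW.
Qed.

Lemma is_derive_coord (f : R -> 'rV[R]_n) (t : R) w j : is_derive t 1 f w ->
  is_derive t 1 (fun t => f t 0 j) (w 0 j).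
Proof.
move=> df; have dd : derivable f t 1 by exact: ex_derive.
apply: DeriveDef; first by have /derivable_mxP := dd; apply.
by rewrite -[w](@derive_val _ _ _ _ _ _ _ df) derive_mx// mxE.
Qed.

Lemma C1curve_ac c T : C1curve X c -> dom a (c T) -> exists2 e : R, 0 < e & forall T1 T2 j,
  T - e < T1 -> T1 <= T -> T <= T2 -> T2 < T + e -> ac_on T1 T2 (fun t => fwd a (c t) 0 j).
Proof.
move=> C1 aT; have [e [B [w [e0 B0 H]]]] := C1curve_local C1 aT; exists e => // T1 T2 j l1 l2 l3 l4.
apply: (ac_on_lipschitz B0) => x y T1x xy yT2.
have near (t : R) : x <= t <= y -> `|t - T| < e.
  by move=> /andP[? ?]; rewrite ltr_norml; apply/andP; split; lra.
have wP (t : R) : x <= t <= y -> is_derive t 1 (fwd a \o c) (w t) /\ `|w t| <= B.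
  by move=> /near/H[].
have dj (t : R) : x <= t <= y -> is_derive t 1 (fun t => fwd a (c t) 0 j) (w t 0 j).
  by move=> /wP[h _]; exact: (is_derive_coord j h).
have [||t] := @MVT_segment R (fun t => fwd a (c t) 0 j) (fun t => w t 0 j) x y xy.
- by move=> t; rewrite in_itv/= => /andP[/ltW h1 /ltW h2]; apply: dj; rewrite h1.
- apply: derivable_within_continuous => t; rewrite in_itv/= => h.
  by have := dj t h => dd; exact: ex_derive.
rewrite in_itv/= => /wP[_ wB] ->.
rewrite normrM (@ger0_norm _ (y - x)) ?subr_ge0// ler_wpM2r ?subr_ge0//.
exact: le_trans (mx_entry_le _ _ _) wB.
Qed.

(* The vector version follows from [vec_low] with the covectors [+- delta_j]. *)
Lemma box_low c T1 T2 (rho : R) : T1 <= T2 -> continuous c ->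
  (forall t, T1 <= t <= T2 -> dom a (c t) /\ box y0 r (fwd a (c t))) ->
  (forall j, ac_on T1 T2 (fun t => fwd a (c t) 0 j)) ->
  (\int[mu]_(t in `[T1, T2]) (tnorm g (velocity X c t))%:E <= rho%:E)%E ->
  `|fwd a (c T2) - fwd a (c T1)| <= k^-1 * rho.
Proof.
move=> T12 cc inb ac Il; have [aa [r0 k0] bt h1 h2] := gb.
have I0 : (0 <= \int[mu]_(t in `[T1, T2]) (tnorm g (velocity X c t))%:E)%E.
  by apply: integral_ge0 => t _; rewrite lee_fin sqrtr_ge0.
have rho0 : 0 <= rho by rewrite -lee_fin (le_trans I0).
have main (q : 'cV[R]_n) : (forall w : 'rV[R]_n, `|pairing q w| <= k * `|w|) ->
    pairing q (fwd a (c T2) - fwd a (c T1)) <= rho.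
  move=> qk; rewrite -lee_fin; apply: le_trans Il.
  have := @vec_low R n (fwd a \o c) T1 T2 0 q
    (fun t => (tnorm g (velocity X c t))%:E) T12 ac.
  rewrite mul0r subr0; apply=> t w /andP[/ltW t1 /ltW t2] dw.
  have tI : T1 <= t <= T2 by rewrite t1.
  have [act bct] := inb t tI.
  have [_ ->] := velocity_chart aa (cc t) act dw.
  rewrite tnorm_chart// subr0 lee_fin; have /andP[h _] := h1 _ w bct.
  by apply: le_trans h; apply: le_trans (ler_norm _) (qk _).
apply: mx_norm_le => [|i j]; first by rewrite mulr_ge0// invr_ge0 ltW.
have abs_le (x e : R) : x <= e -> - x <= e -> `|x| <= e.
  by move=> ? ?; rewrite ler_norml lerNl; apply/andP.
set D := fwd a (c T2) - fwd a (c T1) in main *.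
have pE (w : 'rV[R]_n) (s : R) : pairing (s *: (delta_mx j (0 : 'I_1))) w = s * w 0 j.
  by rewrite /pairing -scalemxAr mxE -colE mxE.
have qk (s : R) : `|s| = k -> forall w : 'rV[R]_n, `|pairing (s *: (delta_mx j (0 : 'I_1))) w| <= k * `|w|.
  move=> sk w; rewrite pE normrM sk ler_wpM2l//; first exact: ltW.
  exact: mx_entry_le.
have l1 := main _ (qk k (gtr0_norm k0)).
have l2 := main _ (qk (- k) (eq_trans (normrN k) (gtr0_norm k0))).
rewrite pE in l1; rewrite pE in l2.
by rewrite ord1; apply: abs_le; rewrite ler_pdivlMl// mulrN -mulNr.
Qed.

(** A curve too short to cross the margin around [x] cannot leave the box. The predicate [P]
    propagates the chart and the estimate from either end of a time interval to the other, because
    [x] may be the initial or the final point of the curve. *)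
Lemma rdist_low (r' : R) x m (rho : R) : r' < r -> dom a x ->
  `|fwd a x - y0| + k^-1 * rho <= r' -> (rdist g x m < rho%:E)%E \/ (rdist g m x < rho%:E)%E ->
  dom a m /\ `|fwd a m - fwd a x| <= k^-1 * rho.
Proof.
move=> rr ax xb dxm; have [aa [r0 k0] bt _ _] := gb.
have ki : 0 < k^-1 by rewrite invr_gt0.
have [c [C1 cl ends]] : exists c, [/\ C1curve X c, (curve_length g c 0 1 <= rho%:E)%E &
    (c 0 = x /\ c 1 = m) \/ (c 0 = m /\ c 1 = x)].
  by case: dxm => /ereal_inf_lt[_ [c [C1 c0 c1] <-]] /ltW h; exists c; split => //; [left|right].
have cc := C1.1.
pose l T1 T2 := (\int[mu]_(t in `[T1, T2]) (tnorm g (velocity X c t))%:E)%E.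
have l0 T1 T2 : (0 <= l T1 T2)%E.
  by apply: integral_ge0 => t _; rewrite lee_fin sqrtr_ge0.
pose P T1 T2 := forall rho : R, (l T1 T2 <= rho%:E)%E ->
  (dom a (c T1) -> `|fwd a (c T1) - y0| + k^-1 * rho <= r' ->
     dom a (c T2) /\ `|fwd a (c T2) - fwd a (c T1)| <= k^-1 * rho) /\
  (dom a (c T2) -> `|fwd a (c T2) - y0| + k^-1 * rho <= r' ->
     dom a (c T1) /\ `|fwd a (c T2) - fwd a (c T1)| <= k^-1 * rho).
suff P01 : P 0 1.
  have [h1 h2] := P01 rho cl.
  case: ends => -[e0 e1].
    by rewrite e0 e1 in h1; exact: h1.
  by rewrite e0 e1 in h2; rewrite distrC; exact: h2.
apply: interval_ind => //.
(* If [c T] lies in the smaller box, short intervals around [T] stay in the larger one and [box_low]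
   applies. Otherwise the curve avoids the smaller box near [T], and the premises of [P] cannot
   hold. *)
- move=> T _; have [[y yb yT]|nb] := pselect ((bwd a @` box y0 r') (c T)).
    have ty : tgt a y by apply: bt; rewrite /box /=; apply: le_trans yb (ltW rr).
    have aT : dom a (c T) by rewrite -yT; exact: bwd_dom.
    have fT : fwd a (c T) = y by rewrite -yT bwdK.
    have [e1 e10 H1] := C1curve_ac C1 aT.
    have cf : {for T, continuous (fwd a \o c)} by exact: (cvg_comp _ _ (cc T) (fwd_cvg aT)).
    have rr0 : 0 < r - r' by rewrite subr_gt0.
    have [e2 e20 H2] := cont_inv cf rr0.
    have /nbhs_ballP[e3 /= e30 H3] : nbhs T (c @^-1` dom a) by apply: cc; exact: nbhs_dom.
    exists (Num.min e1 (Num.min e2 e3)); first by rewrite !lt_min e10 e20.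
    move=> T1 T2 _ T1T TT2 _ b1 b2.
    have [m1 [m2 m3]] : Num.min e1 (Num.min e2 e3) <= e1 /\ Num.min e1 (Num.min e2 e3) <= e2 /\
       Num.min e1 (Num.min e2 e3) <= e3 by rewrite !ge_min !lexx !orbT.
    have T12 := le_trans T1T TT2.
    have inb t : T1 <= t <= T2 -> dom a (c t) /\ box y0 r (fwd a (c t)).
      move=> /andP[h1 h2].
      have near e : Num.min e1 (Num.min e2 e3) <= e -> `|T - t| < e.
        by rewrite ltr_norml; move: h1 h2 T1T TT2 b1 b2; clear => *; apply/andP; split; lra.
      split; first by apply: H3; rewrite -ball_normE; exact: near.
      have h3 := H2 t (near _ m2); rewrite /= fT in h3; rewrite /box /=.
      rewrite (_ : _ - y0 = (y - y0) - (y - fwd a (c t))); last by apply/rowP => j; rewrite !mxE; ring.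
      apply: (le_trans (ler_normB _ _)); move: yb; rewrite /box /=; lra.
    have ac j : ac_on T1 T2 (fun t => fwd a (c t) 0 j).
      by apply: H1 => //; lra.
    have low rh h := box_low T12 cc inb ac (rho := rh) h.
    have [i1 _] : dom a (c T1) /\ box y0 r (fwd a (c T1)) by apply: inb; rewrite lexx.
    have [i2 _] : dom a (c T2) /\ box y0 r (fwd a (c T2)) by apply: inb; rewrite lexx andbT.
    by move=> rh h; split=> _ _; split => //; exact: low.
  have /nbhs_ballP[e /= e0 He] : nbhs T (c @^-1` ~` (bwd a @` box y0 r')).
    apply: cc; apply: open_nbhs_nbhs; split => //; apply: closed_openC.
    exact: bwd_box_closed (ltW rr).
  exists e => // T1 T2 _ T1T TT2 _ b1 b2 rh h.
  have rh0 : 0 <= k^-1 * rh by rewrite mulr_ge0 ?(ltW ki)// -lee_fin (le_trans (l0 T1 T2)).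
  have bad t : `|T - t| < e -> dom a (c t) -> `|fwd a (c t) - y0| + k^-1 * rh <= r' -> False.
    move=> te act hb; apply: (He t); first by rewrite -ball_normE.
    exists (fwd a (c t)); last by rewrite fwdK.
    by rewrite /box /=; lra.
  split=> h1 h2; exfalso; [apply: (bad T1)|apply: (bad T2)] => //;
    by rewrite ltr_norml; apply/andP; move: T1T TT2 b1 b2; clear => *; split; lra.
- move=> t1 t2 t3 _ t12 t23 _ P1 P2 rh h.
  have sp : l t1 t3 = (l t1 t2 + l t2 t3)%E.
    apply: (@integral_split_lower _ _ 0) => // t _.
    by rewrite oppr0 lee_fin sqrtr_ge0.
  have f13 : l t1 t3 \is a fin_num.
    by rewrite ge0_fin_numE// (le_lt_trans h)// ltry.
  have [f12 f23] : l t1 t2 \is a fin_num /\ l t2 t3 \is a fin_num.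
    by move: f13; rewrite sp fin_numD => /andP.
  have [r1 e1] : exists r1 : R, l t1 t2 = r1%:E by exists (fine (l t1 t2)); rewrite fineK.
  have [r2 e2] : exists r2 : R, l t2 t3 = r2%:E by exists (fine (l t2 t3)); rewrite fineK.
  have r10 : 0 <= r1 by rewrite -lee_fin -e1.
  have r20 : 0 <= r2 by rewrite -lee_fin -e2.
  have r12 : r1 + r2 <= rh by move: h; rewrite sp e1 e2 -EFinD lee_fin.
  have le1 : (l t1 t2 <= r1%:E)%E by rewrite e1.
  have le2 : (l t2 t3 <= r2%:E)%E by rewrite e2.
  have [A1 A2] := P1 r1 le1; have [B1 B2] := P2 r2 le2.
  have kr1 : 0 <= k^-1 * r1 by rewrite mulr_ge0// ltW.
  have kr2 : 0 <= k^-1 * r2 by rewrite mulr_ge0// ltW.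
  have kr : k^-1 * r1 + k^-1 * r2 <= k^-1 * rh by rewrite -mulrDr ler_wpM2l// ltW.
  have tri (u v w : 'rV[R]_n) : `|u - w| <= `|u - v| + `|v - w|.
    by rewrite (_ : u - w = (u - v) + (v - w)) ?ler_normD// addrA subrK.
  split=> d1 b1.
    have [|d2 n2] := A1 d1; first by move: b1 kr kr2; clear; lra.
    have t1' := tri (fwd a (c t2)) (fwd a (c t1)) y0.
    have [|d3 n3] := B1 d2; first by move: b1 kr n2 t1'; clear; lra.
    split => //; have := tri (fwd a (c t3)) (fwd a (c t2)) (fwd a (c t1)); move: kr n2 n3; clear; lra.
  have [|d2 n2] := B2 d1; first by move: b1 kr kr1; clear; lra.
  have t1' := tri (fwd a (c t2)) (fwd a (c t3)) y0.
  rewrite (distrC (fwd a (c t2)) (fwd a (c t3))) in t1'.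
  have [|d3 n3] := A2 d2; first by move: b1 kr n2 t1'; clear; lra.
  split => //; have := tri (fwd a (c t3)) (fwd a (c t2)) (fwd a (c t1)); move: kr n2 n3; clear; lra.
Qed.

Lemma rdist_ge0 x y : (0 <= rdist g x y)%E.
Proof.
apply: le_ereal_inf_tmp => _ [c _ <-]; apply: integral_ge0 => t _.
by rewrite lee_fin sqrtr_ge0.
Qed.

Lemma rdist_box_ge x m (rho : R) : dom a x -> box y0 (r / 2) (fwd a x) ->
  k^-1 * rho <= r / 4 -> (rdist g x m < rho%:E)%E \/ (rdist g m x < rho%:E)%E ->
  dom a m /\ `|fwd a m - fwd a x| <= k^-1 * rho.
Proof.
move=> ax xb kr h; have [aa [r0 k0] _ _ _] := gb.
apply: (@rdist_low (r / 2 + r / 4)) => //; first by lra.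
by move: xb; rewrite /box /=; lra.
Qed.

(** [rdist_box_ge] is used with all radii slightly larger than the distance itself, so that the
    estimate is linear in the distance and can be summed over intervals. *)
Lemma rdist_box_fine x m (rho : R) D : dom a x -> box y0 (r / 2) (fwd a x) ->
  k^-1 * rho <= r / 4 -> D = rdist g x m \/ D = rdist g m x -> (D < rho%:E)%E ->
  `|fwd a m - fwd a x| <= k^-1 * fine D.
Proof.
move=> ax xb kr DE h; have [aa [r0 k0] _ _ _] := gb.
have D0 : (0 <= D)%E by case: DE => ->; exact: rdist_ge0.
have fd : D \is a fin_num by rewrite ge0_fin_numE// (lt_trans h)// ltry.
rewrite -ler_pdivrMl ?invr_gt0// invrK; apply/ler_addgt0Pr => e e0.
pose rho' := Num.min rho (fine D + e).
have h' : (D < rho'%:E)%E.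
  by rewrite -(fineK fd) lte_fin lt_min ltrDl e0 -lte_fin fineK// h.
have kr' : k^-1 * rho' <= r / 4.
  apply: le_trans kr; apply: ler_wpM2l; first by rewrite invr_ge0 ltW.
  by rewrite ge_min lexx.
have [_ hh] : dom a m /\ `|fwd a m - fwd a x| <= k^-1 * rho'.
  by apply: (rdist_box_ge ax xb kr'); case: DE => <-; [left|right].
apply: (@le_trans _ _ rho'); last by rewrite ge_min lexx orbT.
by rewrite -ler_pdivlMl// in hh *; rewrite ler_pdivlMl.
Qed.

Lemma abs_cont_pair c r1 s1 : abs_cont_curve g r1 s1 c -> forall e : R, 0 < e ->
  exists2 d : R, 0 < d & forall x y : R, r1 <= x -> x <= y -> y <= s1 -> y - x < d ->
    (rdist g (c x) (c y) < e%:E)%E.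
Proof.
move=> ac e /ac[d d0 H]; exists d => // x y rx xy ys yx.
have := H 1 (fun=> x) (fun=> y); rewrite !big_ord1; apply => //.
by move=> i j _ _ _; rewrite (ord1 i) (ord1 j).
Qed.

Lemma abs_cont_near c r1 s1 T : abs_cont_curve g r1 s1 c -> r1 <= T <= s1 ->
  dom a (c T) -> box y0 (r / 4) (fwd a (c T)) -> exists2 e : R, 0 < e &
  forall t, r1 <= t <= s1 -> `|t - T| < e -> dom a (c t) /\ box y0 (r / 2) (fwd a (c t)).
Proof.
move=> ac /andP[rT Ts] aT bT; have [aa [r0 k0] _ _ _] := gb.
have e0 : 0 < k * (r / 4) by rewrite mulr_gt0// divr_gt0.
have [d d0 H] := abs_cont_pair ac e0; exists d => // t /andP[rt ts] tT.
have bT' : box y0 (r / 2) (fwd a (c T)) by move: bT; rewrite /box /=; lra.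
have ke : k^-1 * (k * (r / 4)) <= r / 4 by rewrite mulKf ?gt_eqF.
have [|? h] := @rdist_box_ge (c T) (c t) (k * (r / 4)) aT bT' ke.
  move: tT; rewrite ltr_norml => /andP[h1 h2].
  by have [tT|/ltW tT] := leP t T; [right|left]; apply: H => //; lra.
split => //; move: bT h; rewrite /box /= mulKf ?gt_eqF// => bT h.
rewrite (_ : _ - y0 = (fwd a (c t) - fwd a (c T)) + (fwd a (c T) - y0)).
  by apply: (le_trans (ler_normD _ _)); lra.
by rewrite addrA subrK.
Qed.

Lemma abs_cont_coord c T1 T2 : abs_cont_curve g T1 T2 c ->
  (forall t, T1 <= t <= T2 -> dom a (c t) /\ box y0 (r / 2) (fwd a (c t))) ->
  forall j, ac_on T1 T2 (fun t => fwd a (c t) 0 j).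
Proof.
move=> ac inb j e e0; have [aa [r0 k0] _ _ _] := gb.
have [e1 [e10 ke1 ke2]] : exists e1, [/\ 0 < e1, k^-1 * e1 <= r / 4 & k^-1 * e1 <= e].
  exists (k * Num.min (r / 4) e).
  rewrite mulrA mulVf ?gt_eqF// mul1r !ge_min !lexx orbT; split => //.
  by rewrite mulr_gt0// lt_min e0 divr_gt0.
have [d d0 H] := ac _ e10; exists d => // l /andP[al pw] ld.
pose al_ (i : 'I_(size l)) := (nth (0, 0) l i).1.
pose bl_ (i : 'I_(size l)) := (nth (0, 0) l i).2.
have H1 i : [/\ T1 <= al_ i, al_ i <= bl_ i & bl_ i <= T2].
  by have /and3P := allP al _ (mem_nth (0, 0) (ltn_ord i)).
have trv : trivIset setT (fun i => `]al_ i, bl_ i[%classic).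
  have dj (i i' : 'I_(size l)) : (i < i')%N -> `]al_ i, bl_ i[%classic `&` `]al_ i', bl_ i'[%classic = set0.
    move=> ii; have := pairwiseP (0, 0) pw; move/(_ i i' (ltn_ord i) (ltn_ord i') ii).
    rewrite /disj_itv => dj; rewrite -subset0 => x; rewrite /= !in_itv/= => -[/andP[x1 x2] /andP[x3 x4]].
    by case/orP: dj => dj; move: x1 x2 x3 x4 dj; rewrite /al_ /bl_; lra.
  move=> i i' _ _ [x hx]; apply/val_inj.
  case: (ltngtP i i') => // ii; have := dj _ _ ii.
    by move=> E; have : set0 x by rewrite -E.
  by rewrite setIC => E; have : set0 x by rewrite -E.
have sl : \sum_(i < size l) (bl_ i - al_ i) < d.
  by move: ld; rewrite /plen (big_nth (0, 0)) big_mkord.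
have := H _ _ _ H1 trv sl => Hs.
have h1 i : (rdist g (c (al_ i)) (c (bl_ i)) < e1%:E)%E.
  apply: le_lt_trans Hs; rewrite (bigD1 i)//=; apply: leeDl.
  by apply: sume_ge0 => i' _; exact: rdist_ge0.
have h2 i : `|fwd a (c (bl_ i)) 0 j - fwd a (c (al_ i)) 0 j| <= k^-1 * fine (rdist g (c (al_ i)) (c (bl_ i))).
  have [? ? ?] := H1 i.
  have [d1 b1] : dom a (c (al_ i)) /\ box y0 (r / 2) (fwd a (c (al_ i))).
    by apply: inb; apply/andP; split => //; lra.
  apply: le_trans (rdist_box_fine d1 b1 ke1 (or_introl erefl) (h1 i)).
  by have := mx_entry_le (fwd a (c (bl_ i)) - fwd a (c (al_ i))) 0 j; rewrite !mxE.
apply: (@le_lt_trans _ _ (\sum_(i < size l) k^-1 * fine (rdist g (c (al_ i)) (c (bl_ i))))).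
  by rewrite /pvar (big_nth (0, 0)) big_mkord; apply: ler_sum => i _; exact: h2.
rewrite -mulr_sumr; apply: lt_le_trans ke2.
rewrite ltr_pM2l ?invr_gt0// -lte_fin -sumEFin.
rewrite (eq_bigr (fun i => rdist g (c (al_ i)) (c (bl_ i)))) => // i _.
by rewrite fineK// ge0_fin_numE ?rdist_ge0// (lt_trans (h1 i))// ltry.
Qed.

Lemma abs_cont_continuous c T1 T2 T : abs_cont_curve g T1 T2 c -> T1 < T < T2 ->
  dom a (c T) -> box y0 (r / 4) (fwd a (c T)) -> {for T, continuous c}.
Proof.
move=> ac /andP[rT Ts] aT bT; have [aa [r0 k0] bt _ _] := gb.
have [e e0 He] := abs_cont_near ac (introT andP (conj (ltW rT) (ltW Ts))) aT bT.
have ne : \forall t \near T, `|t - T| < e.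
  by apply/nbhs_ballP; exists e => //= t; rewrite -ball_normE /= distrC.
have ndom : \forall t \near T, T1 <= t <= T2 /\ (dom a (c t) /\ box y0 (r / 2) (fwd a (c t))).
  near=> t; have tI : T1 <= t <= T2.
    by apply/andP; split; apply/ltW; near: t; [exact: lt_nbhsr|exact: lt_nbhsl].
  by split=> //; apply: He => //; near: t.
apply: (@near_eq_continuous _ _ (bwd a \o (fwd a \o c))).
  by apply: filterS ndom => t [_ [h _]]; rewrite /= fwdK.
have cf : {for T, continuous (fwd a \o c)}.
  apply: cont_eps => e1 e10.
  pose e2 := k * Num.min (r / 4) (e1 / 2).
  have e20 : 0 < e2 by rewrite mulr_gt0// lt_min !divr_gt0.
  have ke : k^-1 * e2 = Num.min (r / 4) (e1 / 2) by rewrite mulrA mulVf ?gt_eqF// mul1r.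
  have [d d0 H] := abs_cont_pair ac e20.
  have /nbhs_ballP[e3 /= e30 H3] := ndom.
  exists (Num.min d e3); first by rewrite lt_min d0.
  move=> t; rewrite lt_min => /andP[t1 t2].
  have [/andP[rt ts] [ct bt']] : T1 <= t <= T2 /\ (dom a (c t) /\ box y0 (r / 2) (fwd a (c t))).
    by apply: H3; rewrite -ball_normE.
  have bT' : box y0 (r / 2) (fwd a (c T)) by move: bT; rewrite /box /=; lra.
  have [||_ h] := @rdist_box_ge (c T) (c t) e2 aT bT'.
  - by rewrite ke ge_min lexx.
  - move: t1; rewrite ltr_norml => /andP[h1 h2].
    by have [tT|/ltW tT] := leP t T; [right|left]; apply: H => //; lra.
  rewrite /= distrC; apply: (le_lt_trans h); rewrite ke gt_min; apply/orP; right; lra.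
exact: (cvg_comp _ _ cf (bwd_cvg (fwd_tgt aT))).
Unshelve. all: end_near. Qed.

End box_distance.
End local_distance.

(** * Cauchy-Schwarz inequality; cutting an interval at a given time *)

Section cauchy_schwarz.
Context (R : realType) (n : nat).
Implicit Types (A : 'M[R]_n) (u w d : 'rV[R]_n).

Lemma bil_sym A u w : A^T = A -> bil A u w = bil A w u.
Proof.
move=> sA; rewrite /bil -[in LHS](mxE trmx_key (fun i j => (u *m A *m w^T) j i)).
by rewrite -[LHS]/((u *m A *m w^T)^T 0 0) !trmx_mul trmxK sA mulmxA.
Qed.

Lemma bilZl A (x : R) u w : bil A (x *: u) w = x * bil A u w.
Proof. by rewrite /bil -!scalemxAl mxE. Qed.

Lemma bilZr A (x : R) u w : bil A u (x *: w) = x * bil A u w.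
Proof. by rewrite /bil linearZ /= -scalemxAr mxE. Qed.

Lemma cauchy_schwarz A u w : A^T = A -> (forall d, d != 0 -> 0 < bil A d d) ->
  bil A u w <= Num.sqrt (bil A u u) * Num.sqrt (bil A w w).
Proof.
move=> sA pA.
have b00 : bil A 0 0 = 0 by rewrite /bil !mul0mx mxE.
have p0 d : 0 <= bil A d d.
  by have [->|/pA/ltW] := eqVneq d 0; rewrite ?b00.
have [->|u0] := eqVneq u 0; first by rewrite /bil !mul0mx mxE sqrtr0 mul0r.
have [->|w0] := eqVneq w 0; first by rewrite b00 sqrtr0 mulr0 /bil trmx0 mulmx0 mxE.
set a := Num.sqrt _; set b := Num.sqrt _.
have a0 : 0 < a by rewrite sqrtr_gt0 pA.
have b0 : 0 < b by rewrite sqrtr_gt0 pA.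
have aE : bil A u u = a ^+ 2 by rewrite sqr_sqrtr.
have bE : bil A w w = b ^+ 2 by rewrite sqr_sqrtr.
(* With [a] and [b] the two norms, the form takes the value [2ab(ab - bil A u w)] at this vector. *)
have := p0 (b *: u - a *: w).
rewrite bilBl !bilBr !bilZl !bilZr (bil_sym w u sA) aE bE => h.
have ab : 0 < a * b by rewrite mulr_gt0.
have : 2 * (a * b) * bil A u w <= 2 * (a * b) * (a * b) by move: h; rewrite !expr2; lra.
by rewrite ler_pM2l// mulr_gt0.
Qed.

End cauchy_schwarz.

Lemma min_itv (R : realType) (a b T : R) : 0 <= a -> a <= b -> 0 <= T ->
  [/\ 0 <= Num.min a T, Num.min a T <= Num.min b T, Num.min b T <= T &
    Num.min b T - Num.min a T <= b - a].
Proof.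
by move=> *; rewrite /Num.min; case: ltP => ?; case: ltP => ?; split; lra.
Qed.

Lemma max_itv (R : realType) (a b T1 T2 : R) : a <= b -> b <= T1 + T2 -> 0 <= T2 ->
  [/\ 0 <= Num.max (a - T1) 0, Num.max (a - T1) 0 <= Num.max (b - T1) 0, Num.max (b - T1) 0 <= T2 &
    Num.max (b - T1) 0 - Num.max (a - T1) 0 <= b - a].
Proof.
by move=> *; rewrite /Num.max; case: ltP => ?; case: ltP => ?; split; lra.
Qed.

(** * Action kernels: concatenation and splitting *)

Section kernels.
Context (R : realType) (n : nat) (M : topologicalType) (X : C2manifold R n M).
Variable g : riemannian X.
Local Notation mu := (@lebesgue_measure R).
Implicit Types (c : R -> M) (x y z : M) (H : hamiltonian X).

Definition act H c (r s : R) : \bar R :=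
  (\int[mu]_(t in `[r, s]) lagrangian H (velocity X c t))%E.

(** The least action from [x] to [y] in time [T]. It is mostly compared through [kern < h] with a
    real [h], which yields a curve of action less than [h] and avoids arithmetic with infinite
    values. *)
Definition kern H (T : R) x y : \bar R := ereal_inf [set act H c 0 T | c in
  [set c | [/\ abs_cont_curve g 0 T c, c 0 = x & c T = y]]].

Lemma conorm0 x : conorm g (x := x) 0 = 0.
Proof.
rewrite /conorm (_ : [set _ | _ in _] = [set 0]) ?sup1//.
apply/seteqP; split => [z [v _ <-]|z ->]; first by rewrite /pairing mulmx0 mxE.
exists 0; last by rewrite /pairing mulmx0 mxE.
by rewrite /= /tnorm !mul0mx mxE sqrtr0.
Qed.

(** The covector 0 is tested in the supremum, and [H] is bounded above on the zero section. *)
Lemma lagrangian_lb H : tonelli g H ->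
  exists2 B : R, 0 <= B & forall x (v : tangent X x), ((- B)%:E <= lagrangian H v)%E.
Proof.
move=> [_ _ /(_ 0 (lexx _))[B HB] _]; exists `|B| => // x v.
apply: (@le_trans _ _ (pairing (0 : 'cV[R]_n) v - H x 0)%:E).
  rewrite /pairing mulmx0 mxE lee_fin add0r lerN2; apply: le_trans (ler_norm _).
  by apply: HB; rewrite conorm0.
by apply: ereal_sup_ubound; exists 0.
Qed.

Lemma act_split H c (r m s : R) : tonelli g H -> r <= m -> m <= s ->
  act H c r s = (act H c r m + act H c m s)%E.
Proof.
move=> /lagrangian_lb[B B0 HB] rm ms.
by apply: (integral_split_lower rm ms B0) => t _; exact: HB.
Qed.

Lemma act_lb H c (B r s : R) : r <= s -> (forall x (v : tangent X x), ((- B)%:E <= lagrangian H v)%E) ->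
  ((- (B * (s - r)))%:E <= act H c r s)%E.
Proof.
move=> rs HB; rewrite -mulNr -integral_cst_itv//.
by apply: le_integral_lower => t _; exact: HB.
Qed.

Lemma kern_lb H (B T : R) x y : 0 <= T -> (forall x (v : tangent X x), ((- B)%:E <= lagrangian H v)%E) ->
  ((- (B * T))%:E <= kern H T x y)%E.
Proof.
move=> T0 HB; apply: le_ereal_inf_tmp => _ [c _ <-].
by have := act_lb c T0 HB; rewrite subr0.
Qed.

Lemma lagrangian_near H c c' (t : R) : (\forall s \near t, c s = c' s) ->
  lagrangian H (velocity X c t) = lagrangian H (velocity X c' t).
Proof.
move=> E; pose L x (f : R -> M) := lagrangian H (x := x) (derive1 (fwd (chart_at X x) \o f) t).
rewrite -[LHS]/(L (c t) c) -[RHS]/(L (c' t) c') -(nbhs_singleton E) /L; congr lagrangian.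
by rewrite !derive1E; apply: near_eq_derive; apply: filterS E => s /= ->.
Qed.

Lemma derive1_shift (W : normedModType R) (f : R -> W) (t h : R) :
  derive1 f (t + h) = derive1 (fun s => f (s + h)) t.
Proof.
rewrite /derive1.
suff -> : (fun k => k^-1 *: (f (k + (t + h)) - f (t + h))) =
  (fun k => k^-1 *: (f (k + t + h) - f (t + h))) by [].
by apply/funext => k; rewrite addrA.
Qed.

Lemma lagrangian_shift H c (t h : R) :
  lagrangian H (velocity X c (t + h)) = lagrangian H (velocity X (fun s => c (s + h)) t).
Proof.
pose L x v := lagrangian H (x := x) v.
rewrite -[LHS]/(L _ _) -[RHS]/(L _ _); congr L; rewrite /velocity derive1_shift.
by [].
Qed.

Lemma itv_ae_eq (f h : R -> \bar R) (r s : R) : (forall t, r < t < s -> f t = h t) ->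
  (\int[mu]_(t in `[r, s]) f t = \int[mu]_(t in `[r, s]) h t)%E.
Proof.
have half (f' h' : R -> \bar R) : (forall t, r < t < s -> f' t = h' t) ->
    (\int[mu]_(t in `[r, s]) f' t <= \int[mu]_(t in `[r, s]) h' t)%E.
  move=> E; apply: (@le_integral_ae _ _ _ _ ([set r] `|` [set s])).
  - exact: measurableU.
  - by apply: null_set_setU => //; exact: lebesgue_measure_set1.
  - move=> t; rewrite /= in_itv/= => /andP[rt ts] nt; rewrite E//.
    rewrite !lt_neqAle rt ts !andbT; apply/andP; split; apply/eqP => e; apply: nt.
      by left.
    by right.
move=> E; apply/eqP; rewrite eq_le; apply/andP; split; apply: half => // t /E.
by [].
Qed.

Lemma act_eq H c c' (r s : R) : (forall t, r < t < s -> c t = c' t) ->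
  act H c r s = act H c' r s.
Proof.
move=> E; apply: itv_ae_eq => t /andP[rt ts]; apply: lagrangian_near.
near=> u; apply: E; apply/andP; split; near: u; [exact: lt_nbhsr|exact: lt_nbhsl].
Unshelve. all: end_near. Qed.

Lemma act_shift H c (r s h : R) :
  act H c (r + h) (s + h) = act H (fun t => c (t + h)) r s.
Proof.
rewrite /act integral_shift_lower; apply: eq_integral => t _; exact: lagrangian_shift.
Qed.

Lemma abs_cont_shift c (r s h : R) : abs_cont_curve g (r + h) (s + h) c ->
  abs_cont_curve g r s (fun t => c (t + h)).
Proof.
move=> ac e /ac[d d0 Hd]; exists d => // m a b Hab tr sm.
apply: (Hd m (fun i => a i + h) (fun i => b i + h)).
- by move=> i; have [? ? ?] := Hab i; split; lra.
- move=> i j _ _ [x]; rewrite /= !in_itv/= => -[/andP[? ?] /andP[? ?]].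
  apply: tr => //; exists (x - h); rewrite /= !in_itv/=; split; apply/andP; split; lra.
- by apply: le_lt_trans sm; apply: ler_sum => i _; lra.
Qed.

Lemma abs_cont_sub c (r s r' s' : R) : r <= r' -> s' <= s -> abs_cont_curve g r s c ->
  abs_cont_curve g r' s' c.
Proof.
move=> rr ss ac e /ac[d d0 Hd]; exists d => // m a b Hab; apply: Hd => i.
by have [? ? ?] := Hab i; split; lra.
Qed.

Lemma kern_le_act H c (r s : R) : abs_cont_curve g r s c ->
  (kern H (s - r) (c r) (c s) <= act H c r s)%E.
Proof.
move=> ac; apply: ereal_inf_lbound; exists (fun t => c (t + r)).
  by split; [apply: abs_cont_shift; rewrite add0r subrK|rewrite add0r|rewrite subrK].
by rewrite -act_shift add0r subrK.
Qed.

(** An interval around the junction time is cut there, and its parts are controlled by [c1] and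
    [c2]. The two distances are recombined through the coordinates of a box centred at the junction
    point. *)
Lemma abs_cont_cat c1 c2 (T1 T2 : R) : 0 <= T1 -> 0 <= T2 -> abs_cont_curve g 0 T1 c1 ->
  abs_cont_curve g 0 T2 c2 -> c1 T1 = c2 0 ->
  abs_cont_curve g 0 (T1 + T2) (fun t => if t <= T1 then c1 t else c2 (t - T1)).
Proof.
move=> T10 T20 ac1 ac2 E; pose c (t : R) := if t <= T1 then c1 t else c2 (t - T1).
rewrite -[X in abs_cont_curve _ _ _ X]/c => e e0.
have [a [y0 [r [k [gb [ay ey]]]]]] := goodbox_exists g (c2 0).
have [aa [r0 k0] bt h1 h2] := gb.
(* [rdist_box_le] contributes [4 / k] and [rdist_box_fine] another [1 / k]; the added 1 covers the
   intervals on one side of [T1]. *)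
pose L := 4 * k^-1 ^+ 2 + 1.
have L0 : 0 < L by rewrite ltr_wpDl// mulr_ge0// sqr_ge0.
have [e1 [e10 ke eL]] : exists e1 : R, [/\ 0 < e1, k^-1 * e1 <= r / 4 & L * (e1 + e1) <= e].
  exists (Num.min (k * (r / 4)) (e / (2 * L))); split.
  - by rewrite lt_min !divr_gt0 ?mulr_gt0// divr_gt0.
  - rewrite -ler_pdivlMl ?invr_gt0// invrK ge_min lexx //.
  - have : Num.min (k * (r / 4)) (e / (2 * L)) <= e / (2 * L) by rewrite ge_min lexx orbT.
    rewrite ler_pdivlMr ?mulr_gt0//; lra.
have [d1 d10 H1] := ac1 _ e10; have [d2 d20 H2] := ac2 _ e10.
exists (Num.min d1 d2); first by rewrite lt_min d10.
move=> m al bl Hab tr; rewrite lt_min => /andP[sm1 sm2].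
pose a1 i := Num.min (al i) T1; pose b1 i := Num.min (bl i) T1.
pose a2 i := Num.max (al i - T1) 0; pose b2 i := Num.max (bl i - T1) 0.
have S1 : (\sum_(i < m) rdist g (c1 (a1 i)) (c1 (b1 i)) < e1%:E)%E.
  apply: H1.
  - by move=> i; have [u1 u2 u3] := Hab i; have [] := min_itv u1 u2 T10.
  - move=> i j _ _ [x]; rewrite /= !in_itv/= /a1 /b1 => -[/andP[x1 x2] /andP[x3 x4]].
    apply: tr => //; exists x; rewrite /= !in_itv/=; move: x1 x2 x3 x4.
    rewrite !gt_min !lt_min => /orP x1 /andP[x2 x2'] /orP x3 /andP[x4 x4'].
    by split; apply/andP; split => //; [case: x1|case: x3] => //; lra.
  - apply: le_lt_trans sm1; apply: ler_sum => i _; have [u1 u2 u3] := Hab i.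
    by have [] := min_itv u1 u2 T10.
have S2 : (\sum_(i < m) rdist g (c2 (a2 i)) (c2 (b2 i)) < e1%:E)%E.
  apply: H2.
  - by move=> i; have [u1 u2 u3] := Hab i; have [] := max_itv u2 u3 T20.
  - move=> i j _ _ [x]; rewrite /= !in_itv/= /a2 /b2 => -[/andP[x1 x2] /andP[x3 x4]].
    apply: tr => //; exists (x + T1); rewrite /= !in_itv/=; move: x1 x2 x3 x4.
    rewrite !gt_max !lt_max => /andP[x1 x1'] /orP x2 /andP[x3 x3'] /orP x4.
    have y2 : x + T1 < bl i by rewrite -ltrBrDr; case: x2 => // h; have := lt_le_trans x1 (ltW h); lra.
    have y4 : x + T1 < bl j by rewrite -ltrBrDr; case: x4 => // h; have := lt_le_trans x3 (ltW h); lra.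
    by split; apply/andP; split => //; rewrite -ltrBlDr.
  - apply: le_lt_trans sm2; apply: ler_sum => i _; have [u1 u2 u3] := Hab i.
    by have [] := max_itv u2 u3 T20.
have each1 i : (rdist g (c1 (a1 i)) (c1 (b1 i)) < e1%:E)%E.
  apply: le_lt_trans S1; rewrite (bigD1 i)//=; apply: leeDl.
  by apply: sume_ge0 => i' _; exact: rdist_ge0.
have each2 i : (rdist g (c2 (a2 i)) (c2 (b2 i)) < e1%:E)%E.
  apply: le_lt_trans S2; rewrite (bigD1 i)//=; apply: leeDl.
  by apply: sume_ge0 => i' _; exact: rdist_ge0.
have fin1 i : rdist g (c1 (a1 i)) (c1 (b1 i)) \is a fin_num.
  by rewrite ge0_fin_numE ?rdist_ge0// (lt_trans (each1 i))// ltry.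
have fin2 i : rdist g (c2 (a2 i)) (c2 (b2 i)) \is a fin_num.
  by rewrite ge0_fin_numE ?rdist_ge0// (lt_trans (each2 i))// ltry.
pose f1 i := fine (rdist g (c1 (a1 i)) (c1 (b1 i))).
pose f2 i := fine (rdist g (c2 (a2 i)) (c2 (b2 i))).
have f10 i : 0 <= f1 i by rewrite fine_ge0// rdist_ge0.
have f20 i : 0 <= f2 i by rewrite fine_ge0// rdist_ge0.
have L1 : 1 <= L by rewrite lerDr mulr_ge0// sqr_ge0.
have key i : (rdist g (c (al i)) (c (bl i)) <= (L * (f1 i + f2 i))%:E)%E.
  have [q1 q2 q3] := Hab i.
  have [bT|bT] := leP (bl i) T1.
    have -> : rdist g (c (al i)) (c (bl i)) = (f1 i)%:E.
      rewrite /f1 fineK// /c bT (le_trans q2 bT) /a1 /b1 !min_l//; exact: le_trans bT.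
    by rewrite lee_fin; have := f10 i; have := f20 i; nra.
  have [aT|aT] := leP (al i) T1; last first.
    have -> : rdist g (c (al i)) (c (bl i)) = (f2 i)%:E.
      by rewrite /f2 fineK// /c !leNgt bT aT /= /a2 /b2 !max_l// subr_ge0 ltW.
    by rewrite lee_fin; have := f10 i; have := f20 i; nra.
  have E1 : rdist g (c1 (a1 i)) (c1 (b1 i)) = rdist g (c (al i)) (c2 0).
    by rewrite /a1 /b1 min_l// min_r ?(ltW bT)// E /c aT.
  have E2 : rdist g (c2 (a2 i)) (c2 (b2 i)) = rdist g (c2 0) (c (bl i)).
    rewrite /a2 /b2 (max_r _) ?subr_le0// max_l ?subr_ge0 ?(ltW bT)//.
    by rewrite /c leNgt bT.
  have yb : box y0 (r / 2) (fwd a (c2 0)).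
    by rewrite /box /= ey subrr normr0 divr_ge0// ltW.
  have l1 := each1 i; have l2 := each2 i; rewrite E1 in l1; rewrite E2 in l2.
  have n1 := rdist_box_fine gb ay yb ke (or_intror erefl) l1.
  have n2 := rdist_box_fine gb ay yb ke (or_introl erefl) l2.
  have [d3 m1] := rdist_box_ge gb ay yb ke (or_intror l1).
  have [d4 m2] := rdist_box_ge gb ay yb ke (or_introl l2).
  rewrite -E1 -/(f1 i) in n1; rewrite -E2 -/(f2 i) in n2; rewrite ey in m1 m2 n1 n2.
  rewrite -(fwdK d3) -(fwdK d4).
  apply: le_trans (rdist_box_le gb _ _) _; [rewrite /box /=; lra|rewrite /box /=; lra|].
  have n3 : `|fwd a (c (bl i)) - fwd a (c (al i))| <= k^-1 * (f1 i + f2 i).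
    rewrite (_ : _ - _ = (fwd a (c (bl i)) - y0) - (fwd a (c (al i)) - y0)).
      by apply: (le_trans (ler_normB _ _)); lra.
    by rewrite opprB addrA subrK.
  rewrite lee_fin /L; have ki : 0 <= 4 * k^-1 by rewrite mulr_ge0// invr_ge0 ltW.
  have := ler_wpM2l ki n3; have := f10 i; have := f20 i; rewrite expr2; lra.
apply: (@le_lt_trans _ _ (\sum_(i < m) (L * (f1 i + f2 i))%:E)%E).
  by apply: lee_sum => i _; exact: key.
rewrite sumEFin lte_fin -mulr_sumr big_split /=; apply: lt_le_trans eL.
rewrite ltr_pM2l// ltrD// -lte_fin -sumEFin.
  by rewrite (eq_bigr (fun i => rdist g (c1 (a1 i)) (c1 (b1 i)))) => // i _; rewrite /f1 fineK.
by rewrite (eq_bigr (fun i => rdist g (c2 (a2 i)) (c2 (b2 i)))) => // i _; rewrite /f2 fineK.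
Qed.

Lemma kern_cat H (T1 T2 : R) x y z (h1 h2 : R) : tonelli g H -> 0 <= T1 -> 0 <= T2 ->
  (kern H T1 x y < h1%:E)%E -> (kern H T2 y z < h2%:E)%E ->
  (kern H (T1 + T2) x z < (h1 + h2)%:E)%E.
Proof.
move=> tH T10 T20 /ereal_inf_lt[_ [c1 [ac1 c10 c1T] <-] l1] /ereal_inf_lt[_ [c2 [ac2 c20 c2T] <-] l2].
pose c (t : R) := if t <= T1 then c1 t else c2 (t - T1).
apply: (@le_lt_trans _ _ (act H c 0 (T1 + T2))).
  apply: ereal_inf_lbound; exists c => //; split.
  - by apply: abs_cont_cat => //; rewrite c1T.
  - by rewrite /c T10.
  - rewrite /c; case: ifPn => [h|_]; last by rewrite addrAC subrr add0r.
    have T2E : T2 = 0 by apply/eqP; rewrite eq_le T20 andbT; lra.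
    by rewrite T2E addr0 c1T -c2T T2E c20.
rewrite (act_split c tH T10) ?lerDl// EFinD.
have -> : act H c 0 T1 = act H c1 0 T1.
  by apply: act_eq => t /andP[_ /ltW tT]; rewrite /c tT.
have -> : act H c T1 (T1 + T2) = act H c2 0 T2.
  have := act_shift H c 0 T2 T1; rewrite add0r (addrC T2) => ->.
  by apply: act_eq => t /andP[t0 _]; rewrite /c (_ : (t + T1 <= T1) = false) ?addrK//; apply/negbTE; rewrite -ltNge ltrDr.
exact: lteD.
Qed.

Lemma kern_split H (T1 T2 : R) x z (h : R) : tonelli g H -> 0 <= T1 -> 0 <= T2 ->
  (kern H (T1 + T2) x z < h%:E)%E -> exists y (h1 h2 : R),
  [/\ (kern H T1 x y < h1%:E)%E, (kern H T2 y z < h2%:E)%E & h1 + h2 < h].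
Proof.
move=> tH T10 T20 /ereal_inf_lt[_ [c [ac c0 cT] <-] l].
have [B B0 HB] := lagrangian_lb tH.
have T12 : T1 <= T1 + T2 by rewrite lerDl.
have a1 := act_lb c T10 HB; have a2 := act_lb c T12 HB.
rewrite (act_split c tH T10 T12) in l.
have k1 := kern_le_act H (abs_cont_sub (lexx 0) T12 ac).
have k2 := kern_le_act H (abs_cont_sub T10 (lexx (T1 + T2)) ac).
rewrite c0 subr0 in k1; rewrite cT addrAC subrr add0r in k2.
exists (c T1).
case: (act H c T1 (T1 + T2)) a2 k2 l => [r2| |] // a2 k2;
  case: (act H c 0 T1) a1 k1 => [r1| |] // a1 k1 l.
move: l; rewrite -EFinD lte_fin => l.
(* Half of the gap below [h] is shared between the two bounds, to make them strict; the other half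
   keeps their sum below [h]. *)
exists (r1 + (h - r1 - r2) / 4), (r2 + (h - r1 - r2) / 4); split.
- by apply: (le_lt_trans k1); rewrite lte_fin; lra.
- by apply: (le_lt_trans k2); rewrite lte_fin; lra.
- lra.
Qed.

End kernels.

(** * Action against length; finiteness of the kernels *)

Section action_bounds.
Context (R : realType) (n : nat) (M : topologicalType) (X : C2manifold R n M).
Variable g : riemannian X.
Local Notation mu := (@lebesgue_measure R).
Implicit Types (c : R -> M) (x y z : M) (H : hamiltonian X).

Lemma box_convex (y0 y y' : 'rV[R]_n) (r t : R) : box y0 r y -> box y0 r y' -> 0 <= t <= 1 ->
  box y0 r (y + t *: (y' - y)).
Proof.
move=> by_ by' /andP[t0 t1]; rewrite /box /=.
rewrite (_ : _ - y0 = (1 - t) *: (y - y0) + t *: (y' - y0)).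
  apply: (le_trans (ler_normD _ _)); rewrite !normrZ (ger0_norm t0) ger0_norm ?subr_ge0//.
  have t1' : 0 <= 1 - t by rewrite subr_ge0.
  have h1 := ler_wpM2l t0 by'; have h2 := ler_wpM2l t1' by_; lra.
apply/rowP => i; rewrite !mxE; ring.
Qed.

Lemma low_act H a (y0 : 'rV[R]_n) (r k : R) c (T1 T2 E : R) (q : 'cV[R]_n) :
  goodbox g a y0 r k -> T1 <= T2 -> abs_cont_curve g T1 T2 c ->
  (forall t, T1 <= t <= T2 -> dom a (c t) /\ box y0 (r / 4) (fwd a (c t))) ->
  (forall t, T1 <= t <= T2 -> in_chart H a (fwd a (c t), q) <= E) ->
  ((pairing q (fwd a (c T2) - fwd a (c T1)) - E * (T2 - T1))%:E <= act H c T1 T2)%E.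
Proof.
move=> gb T12 ac inb HE; have [aa [r0 k0] bt h1 h2] := gb.
apply: (@vec_low R n (fwd a \o c)) => //.
  apply: (abs_cont_coord gb ac) => t /inb[? bx]; split => //.
  by move: bx; rewrite /box /=; lra.
move=> t w tI dw.
have tI' : T1 <= t <= T2 by case/andP: tI => /ltW -> /ltW ->.
have [act_ bct] := inb t tI'.
have cc := abs_cont_continuous gb ac tI act_ bct.
have [_ ->] := velocity_chart aa cc act_ dw.
by apply: le_trans (lagrangian_ge H w q aa act_); rewrite lee_fin lerB// HE.
Qed.

Lemma act_reach H : tonelli g H -> forall K : R, 0 < K -> exists2 C : R, 0 <= C &
  forall c (T1 T2 A : R), T1 <= T2 -> abs_cont_curve g T1 T2 c -> (act H c T1 T2 <= A%:E)%E ->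
  exists V, reach g (c T1) V (c T2) /\ K * V <= A + C * (T2 - T1).
Proof.
move=> tH K K0; have [B B0 HB] := lagrangian_lb tH.
have K40 : 0 <= 4 * K by rewrite mulr_ge0// ltW.
have [_ _ /(_ (4 * K) K40) [C0 HC0] _] := tH.
exists (B + `|C0|) => [|c T1 T2 A T12 ac]; first exact: addr_ge0.
set C := B + `|C0|.
have CB : B <= C by rewrite lerDl.
have CC0 : C0 <= C by rewrite (le_trans (ler_norm _))// lerDr.
pose P t1 t2 := forall A : R, (act H c t1 t2 <= A%:E)%E ->
  exists V, reach g (c t1) V (c t2) /\ K * V <= A + C * (t2 - t1).
suff : P T1 T2 by apply.
clear A; apply: interval_ind => //; last first.
  move=> t1 t2 t3 _ t12 t23 _ P1 P2 A l.
  have a1 := act_lb c t12 HB; have a2 := act_lb c t23 HB.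
  rewrite (act_split c tH t12 t23) in l.
  case e1 : (act H c t1 t2) a1 l => [r1| |] // a1;
    case e2 : (act H c t2 t3) a2 => [r2| |] // a2.
  rewrite -EFinD lee_fin => l.
  have le1 : (act H c t1 t2 <= r1%:E)%E by rewrite e1.
  have le2 : (act H c t2 t3 <= r2%:E)%E by rewrite e2.
  have [V1 [rc1 v1]] := P1 _ le1; have [V2 [rc2 v2]] := P2 _ le2.
  exists (V1 + V2); split; first exact: reach_cat rc1 rc2.
  by rewrite mulrDr; lra.
move=> T Ti.
have [a [y0 [r [k [gb [aT eT]]]]]] := goodbox_exists g (c T).
have [aa [r0 k0] bt h1 h2] := gb.
have [e0 e00 He0] : exists2 e : R, 0 < e & forall t, T1 <= t <= T2 -> `|t - T| < e ->
    dom a (c t) /\ box y0 (r / 4) (fwd a (c t)).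
  have bT0 : box y0 (r / 4) (fwd a (c T)).
    by rewrite /box /= eT subrr normr0 divr_ge0// ltW.
  have [rT Ts] := andP Ti.
  have ek : 0 < k * (r / 4) by rewrite mulr_gt0// divr_gt0.
  have [d d0 Hd] := abs_cont_pair ac ek; exists d => // t /andP[rt ts] tT.
  have bT' : box y0 (r / 2) (fwd a (c T)) by rewrite /box /= eT subrr normr0 divr_ge0// ltW.
  have ke : k^-1 * (k * (r / 4)) <= r / 4 by rewrite mulKf ?gt_eqF.
  have [|? h] := @rdist_box_ge _ _ _ _ _ _ _ _ _ gb (c T) (c t) (k * (r / 4)) aT bT' ke.
    move: tT; rewrite ltr_norml => /andP[l1 l2].
    by have [tT|/ltW tT] := leP t T; [right|left]; apply: Hd => //; lra.
  split => //; move: h; rewrite /box /= mulKf ?gt_eqF// eT; lra.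
exists e0 => // t1 t2 r1 t1T Tt2 s2 l1 l2 A l.
have t12 := le_trans t1T Tt2.
have inb t : t1 <= t <= t2 -> dom a (c t) /\ box y0 (r / 4) (fwd a (c t)).
  move=> /andP[u1 u2]; apply: He0; first by apply/andP; split; lra.
  by rewrite ltr_norml; apply/andP; split; lra.
have ac' := abs_cont_sub r1 s2 ac.
have [d1 b1] : dom a (c t1) /\ box y0 (r / 4) (fwd a (c t1)) by apply: inb; rewrite lexx.
have [d2 b2] : dom a (c t2) /\ box y0 (r / 4) (fwd a (c t2)) by apply: inb; rewrite lexx andbT.
have sub (z : 'rV[R]_n) : box y0 (r / 4) z -> box y0 r z by rewrite /box /=; lra.
have b0 : box y0 r y0 by rewrite /box /= subrr normr0 ltW.
set D := fwd a (c t2) - fwd a (c t1).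
set N := cnorm g a y0 D.
have N0 : 0 <= N by rewrite /N cnormE sqrtr_ge0.
exists (2 * N); split.
  rewrite -[2 * N]add0r; apply: (reachS (reach0 _ _)).
  exists a, (fwd a (c t1)), D; split => //; first by rewrite fwdK.
    by rewrite /D addrC subrK fwdK.
  move=> t tI; have bz := box_convex (sub _ b1) (sub _ b2) tI.
  by split; [exact: bt|exact: h2].
have td : 0 <= t2 - t1 by rewrite subr_ge0.
(* A vanishing displacement has no dual direction; there the lower bound of the Lagrangian
   suffices. *)
have [ND|ND] := leP N 0.
  have -> : N = 0 by apply/eqP; rewrite eq_le ND.
  have /le_trans/(_ l) := act_lb c t12 HB; rewrite lee_fin.
  have := ler_wpM2r td CB; lra.
(* The covector dual to [D] for the metric at [y0], scaled to have norm [2 * K] there, so that it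
   pairs with [D] to [K * (2 * N)]. The length allotted to the move is [2 * N], because the metric
   may double within the box; for the same reason the dual norm of [q] is bounded by [4 * K], the
   radius chosen at the start. *)
pose q : 'cV[R]_n := (2 * K * N^-1) *: (gm g a y0 *m D^T).
have qE (w : 'rV[R]_n) : pairing q w = 2 * K * N^-1 * bil (gm g a y0) w D.
  by rewrite /pairing /q -scalemxAr mxE mulmxA.
have pA : forall d : 'rV[R]_n, d != 0 -> 0 < bil (gm g a y0) d d.
  by move=> d; apply: gm_gt0 => //; exact: bt.
have sA := gm_sym g a y0.
have NN : bil (gm g a y0) D D = N ^+ 2.
  rewrite /N cnormE sqr_sqrtr//.
  by have [->|/pA/ltW] := eqVneq D 0; rewrite /bil ?mul0mx ?mxE.
have cq t : t1 <= t <= t2 -> in_chart H a (fwd a (c t), q) <= C.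
  move=> /inb[dt bt']; apply: le_trans CC0; rewrite /in_chart /= fwdK//; apply: HC0.
  apply: (conorm_le aa dt K40).
  move=> w w1; rewrite qE.
  have cs := cauchy_schwarz w D sA pA; rewrite -!cnormE -/N in cs.
  have w2 := h2 y0 _ w b0 (sub _ bt').
  have Ni : 0 < N^-1 by rewrite invr_gt0.
  have NiN : N^-1 * N = 1 by rewrite mulVf ?gt_eqF.
  apply: (@le_trans _ _ (2 * K * N^-1 * (2 * N))); last first.
    by rewrite (_ : _ * _ = 4 * K * (N^-1 * N)); [rewrite NiN mulr1|ring].
  apply: ler_wpM2l; first by rewrite !mulr_ge0// ltW.
  apply: (le_trans cs); apply: ler_wpM2r; first exact: N0.
  by apply: (le_trans w2); rewrite -[leRHS]mulr1; apply: ler_wpM2l.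
have := low_act gb t12 ac' inb cq; move=> /le_trans/(_ l); rewrite lee_fin -/D qE NN.
have -> : 2 * K / N * N ^+ 2 = K * (2 * N).
  by rewrite expr2 -!mulrA (mulrA N^-1) mulVf ?gt_eqF// mul1r; ring.
by rewrite lerBlDr.
Qed.

Lemma kern_reach H : tonelli g H -> forall K : R, 0 < K -> exists2 C : R, 0 <= C &
  forall x y (T A : R), 0 <= T -> (kern g H T x y < A%:E)%E ->
  exists V, reach g x V y /\ K * V <= A + C * T.
Proof.
move=> tH K K0; have [C C0 HC] := act_reach tH K0; exists C => // x y T A T0.
move=> /ereal_inf_lt[_ [c [ac c0 cT] <-] /ltW l].
by have := HC c 0 T A T0 ac l; rewrite c0 cT subr0.
Qed.

Lemma up_kern H a (y0 : 'rV[R]_n) (r k : R) (y y' : 'rV[R]_n) (b E : R) :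
  goodbox g a y0 r k -> 0 < b -> box y0 r y -> box y0 r y' ->
  (forall t : R, 0 <= t <= 1 -> forall q : 'cV[R]_n,
     pairing q (b^-1 *: (y' - y)) - in_chart H a (y + t *: (y' - y), q) <= E) ->
  (kern g H b (bwd a y) (bwd a y') <= (b * E)%:E)%E.
Proof.
move=> gb b0 by_ by' HE; have [aa [r0 k0] bt h1 h2] := gb.
pose p (t : R) := y + (b^-1 * t + 0) *: (y' - y).
pose c t := bwd a (p t).
have pb t : 0 <= t <= b -> 0 <= b^-1 * t + 0 <= 1.
  by move=> /andP[t0 tb]; rewrite addr0 mulr_ge0 ?invr_ge0 ?(ltW b0)//= ler_pdivrMl// mulr1.
have inb t : 0 <= t <= b -> box y0 r (p t) by move=> /pb; exact: box_convex.
have dp (t : R) : is_derive t 1 p (b^-1 *: (y' - y)).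
  exact: (is_derive_scale_vec y (y' - y) (is_derive_aff b^-1 0 t)).
have c0 : c 0 = bwd a y by rewrite /c /p mulr0 addr0 scale0r addr0.
have cb : c b = bwd a y' by rewrite /c /p mulVf ?gt_eqF// addr0 scale1r addrC subrK.
apply: (@le_trans _ _ (act H c 0 b)).
  apply: ereal_inf_lbound; exists c => //; split => // e e0.
  pose L := 4 * (k^-1 * (b^-1 * `|y' - y|)) + 1.
  have L0 : 0 < L.
    by rewrite ltr_wpDl// !mulr_ge0// invr_ge0 ltW.
  exists (e / L) => [|m al bl Hab _]; first exact: divr_gt0.
  rewrite ltr_pdivlMr// => sm.
  apply: (@le_lt_trans _ _ (\sum_(i < m) ((bl i - al i) * L)%:E)%E).
    apply: lee_sum => i _; have [q1 q2 q3] := Hab i.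
    apply: le_trans (rdist_box_le gb _ _) _.
    - by apply: inb; apply/andP; split => //; exact: le_trans q3.
    - by apply: inb; apply/andP; split => //; exact: le_trans q2.
    have -> : p (bl i) - p (al i) = (b^-1 * (bl i - al i)) *: (y' - y).
      by apply/rowP => j; rewrite !mxE; ring.
    have d0 : 0 <= bl i - al i by rewrite subr_ge0.
    rewrite lee_fin normrZ ger0_norm; last by rewrite mulr_ge0// invr_ge0 ltW.
    by rewrite /L; lra.
  by rewrite sumEFin lte_fin -mulr_suml.
rewrite mulrC -[b in (E * b)%:E]subr0 -(integral_cst_itv _ (ltW b0)).
apply: (@le_integral_ae _ _ _ _ ([set 0] `|` [set b])).
- exact: measurableU.
- by apply: null_set_setU => //; exact: lebesgue_measure_set1.
move=> t; rewrite /= in_itv/= => /andP[t0 tb] nt.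
have {}t0 : 0 < t by rewrite lt_neqAle t0 andbT; apply/eqP => e; apply: nt; left.
have {}tb : t < b by rewrite lt_neqAle tb andbT; apply/eqP => e; apply: nt; right.
have tI : 0 <= t <= b by rewrite !ltW.
have tg := bt _ (inb _ tI).
have cc : {for t, continuous c} by exact: (cvg_comp _ _ (is_derive_cont_vec (dp t)) (bwd_cvg tg)).
have dt : dom a (c t) by exact: bwd_dom.
have dv : is_derive t 1 (fwd a \o c) (b^-1 *: (y' - y)).
  apply: near_eq_is_derive (dp t); near=> s.
  rewrite /= /c bwdK//; apply/bt/inb; apply/andP; split; apply/ltW; near: s.
    exact: lt_nbhsr.
  exact: lt_nbhsl.
have [_ ->] := velocity_chart aa cc dt dv.
by apply: lagrangian_le => // q; rewrite /c bwdK//; apply: HE; exact: pb.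
Unshelve. all: end_near. Qed.

(** A slope [K] larger than the metric norm of every admissible [v] is used in the growth condition:
    [K] times the dual norm of the covector exceeds its pairing with [v]. *)
Lemma chart_superlinear H a (y0 : 'rV[R]_n) (r k V : R) : tonelli g H -> goodbox g a y0 r k ->
  0 <= V -> exists2 C : R, 0 <= C & forall (z : 'rV[R]_n) (q : 'cV[R]_n) (v : 'rV[R]_n),
  box y0 r z -> `|v| <= V -> pairing q v - in_chart H a (z, q) <= C.
Proof.
move=> [_ co _ _] gb V0; have [aa [r0 k0] bt h1 h2] := gb.
pose K := k^-1 * V + 1.
have K0 : 0 < K by rewrite ltr_wpDl// mulr_ge0// invr_ge0 ltW.
have [C HC] := co K K0; exists `|C| => // z q v bz vV; apply: le_trans (ler_norm _).
have dz := bwd_dom (bt _ bz).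
have fz : fwd a (bwd a z) = z by rewrite bwdK//; exact: bt.
have h1z (w : 'rV[R]_n) : k * `|w| <= cnorm g a (fwd a (bwd a z)) w.
  by rewrite fz; have /andP[] := h1 z w bz.
have w1 : cnorm g a (fwd a (bwd a z)) (K^-1 *: v) <= 1.
  rewrite fz; have /andP[_ h] := h1 z (K^-1 *: v) bz; apply: (le_trans h).
  rewrite normrZ gtr0_norm ?invr_gt0// mulrCA ler_pdivrMl// mulr1.
  have : k^-1 * `|v| <= k^-1 * V by rewrite ler_wpM2l// invr_ge0 ltW.
  rewrite /K; lra.
have := @conorm_ge _ _ _ _ g a (bwd a z) q _ k aa dz k0 h1z w1; have := HC (bwd a z) (tmx X a (bwd a z) *m q).
rewrite -[H (bwd a z) _]/(in_chart H a (z, q)) /pairing -scalemxAl mxE => l1 l2.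
have := ler_wpM2l (ltW K0) l2; rewrite mulVKf ?gt_eqF//; lra.
Qed.

Lemma kern_box_fin H a (y0 : 'rV[R]_n) (r k b : R) (y y' : 'rV[R]_n) : tonelli g H ->
  goodbox g a y0 r k -> 0 < b -> box y0 r y -> box y0 r y' ->
  (kern g H b (bwd a y) (bwd a y') < +oo)%E.
Proof.
move=> tH gb b0 by_ by'.
have [C C0 HC] := chart_superlinear tH gb (normr_ge0 (b^-1 *: (y' - y))).
apply: le_lt_trans (up_kern gb b0 by_ by' (E := C) _) (ltry _).
by move=> t tI q; apply: HC => //; exact: box_convex.
Qed.

(** The set of points that can be joined to [x] with finite action in every positive time is open
    and closed. Asking for every time leaves half of it for one more local move. *)
Lemma kern_fin H : tonelli g H -> connected [set: M] -> forall x y (T : R), 0 < T ->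
  (kern g H T x y < +oo)%E.
Proof.
move=> tH cM x y.
pose A := [set y | forall T : R, 0 < T -> (kern g H T x y < +oo)%E].
suff AT : A = setT by have : A y by rewrite AT.
have loc z : exists2 U, nbhs z U & forall z1 z2 (T : R), U z1 -> U z2 -> 0 < T ->
    (kern g H T z1 z2 < +oo)%E.
  have [a [y0 [r [k [gb [az ez]]]]]] := goodbox_exists g z.
  have [aa [r0 k0] bt h1 h2] := gb.
  exists (dom a `&` (fun m => box y0 r (fwd a m))).
    apply: filterI; first exact: nbhs_dom.
    apply: (fwd_cvg az); rewrite ez; apply/nbhs_ballP; exists r => // w.
    by rewrite -ball_normE /= distrC => /ltW.
  move=> z1 z2 T [d1 b1] [d2 b2] T0; rewrite -(fwdK d1) -(fwdK d2).
  exact: (kern_box_fin tH gb).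
have ext z1 z2 : A z1 -> (forall T : R, 0 < T -> (kern g H T z1 z2 < +oo)%E) -> A z2.
  move=> A1 h T T0; have T2 : 0 < T / 2 by rewrite divr_gt0.
  have [B _ HB] := lagrangian_lb tH.
  have b1 := kern_lb g x z1 (ltW T2) HB; have b2 := kern_lb g z1 z2 (ltW T2) HB.
  have f1 := A1 _ T2; have f2 := h _ T2.
  have fin (u : \bar R) (b : R) : (b%:E <= u)%E -> (u < +oo)%E -> exists w : R, (u < w%:E)%E.
    by case: u => [u| |] // _ _; exists (u + 1); rewrite lte_fin ltrDl.
  have [w1 l1] := fin _ _ b1 f1; have [w2 l2] := fin _ _ b2 f2.
  have := kern_cat tH (ltW T2) (ltW T2) l1 l2; rewrite (_ : T / 2 + T / 2 = T) => [l|]; last lra.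
  exact: lt_trans l (ltry _).
apply: cM.
- have [U nU HU] := loc x; exists x => T T0; apply: HU => //; exact: nbhs_singleton.
- exists A; last by rewrite setTI.
  rewrite openE => z Az; have [U nU HU] := loc z.
  have Uz := nbhs_singleton nU; apply: filterS nU => z' Uz'.
  by apply: (ext z) => // T; apply: HU.
- exists A; last by rewrite setTI.
  move=> z cz; have [U nU HU] := loc z; have [z' [Az' Uz']] := cz _ nU.
  by apply: (ext z') => // T; apply: HU => //; exact: nbhs_singleton nU.
Qed.

End action_bounds.

(** * Duality between coordinate vectors and covectors *)

Section pairing_theory.
Context (R : realType) (n : nat).
Implicit Types (q p : 'cV[R]_n) (v w : 'rV[R]_n).

Lemma pairingDl q p v : pairing (q + p) v = pairing q v + pairing p v.
Proof. by rewrite /pairing mulmxDr mxE. Qed.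

Lemma pairingBl q p v : pairing (q - p) v = pairing q v - pairing p v.
Proof. by rewrite /pairing mulmxBr !mxE. Qed.

Lemma pairingDr q v w : pairing q (v + w) = pairing q v + pairing q w.
Proof. by rewrite /pairing mulmxDl mxE. Qed.

Lemma pairingBr q v w : pairing q (v - w) = pairing q v - pairing q w.
Proof. by rewrite /pairing mulmxBl !mxE. Qed.

Lemma pairingZl (k : R) q v : pairing (k *: q) v = k * pairing q v.
Proof. by rewrite /pairing -scalemxAr mxE. Qed.

Lemma pairingZr (k : R) q v : pairing q (k *: v) = k * pairing q v.
Proof. by rewrite /pairing -scalemxAl mxE. Qed.

Lemma pairingNr q v : pairing q (- v) = - pairing q v.
Proof. by rewrite -scaleN1r pairingZr mulN1r. Qed.

Lemma pairingNl q v : pairing (- q) v = - pairing q v.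
Proof. by rewrite -scaleN1r pairingZl mulN1r. Qed.

Lemma pairing0r q : pairing q 0 = 0.
Proof. by rewrite /pairing mul0mx mxE. Qed.

Lemma pairing0l v : pairing 0 v = 0.
Proof. by rewrite /pairing mulmx0 mxE. Qed.

Lemma pairing_abs q v : - (n%:R * `|q| * `|v|) <= pairing q v <= n%:R * `|q| * `|v|.
Proof. by rewrite -ler_norml; exact: pairing_le. Qed.

Lemma mx_norm_attained m k (A : 'M[R]_(m, k)) : `|A| != 0 -> exists i j, `|A| = `|A i j|.
Proof.
move=> A0; have [[i j] /= h] : exists ij, mx_norm A = `|A ij.1 ij.2| by exact: mx_norm_neq0.
by exists i, j.
Qed.

(** Vectors and covectors both carry the sup norm; the signed coordinate covector at a largest entry
    of [v] does it. *)
Lemma pairing_dual_l v : exists2 u : 'cV[R]_n, `|u| <= 1 & pairing u v = `|v|.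
Proof.
have [v0|v0] := eqVneq `|v| 0; first by exists 0; rewrite ?normr0// pairing0l v0.
have [i [j vE]] := mx_norm_attained v0.
exists (Num.sg (v 0 j) *: delta_mx j 0); last first.
  by rewrite pairingZl /pairing -colE mxE vE (ord1 i) normrEsg.
rewrite normrZ; apply: mulr_ile1 => //; first by rewrite normr_sg lern1; case: eqP.
by apply: mx_norm_le => // k l; rewrite mxE; case: (_ && _); rewrite ?normr1 ?normr0.
Qed.

Lemma pairing_dual_r q : exists2 u : 'rV[R]_n, `|u| <= 1 & pairing q u = `|q|.
Proof.
have [u u1 uq] := pairing_dual_l q^T; exists u^T; first by rewrite trmx_norm.
rewrite -trmx_norm -uq /pairing.
by rewrite -[in RHS](mxE trmx_key (fun i j => (q^T *m u) j i)) -[RHS]/((q^T *m u)^T 0 0) trmx_mul trmxK.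
Qed.

Lemma cV_ball_compact (P : R) : compact [set q : 'cV[R]_n | `|q| <= P].
Proof.
have -> : [set q : 'cV[R]_n | `|q| <= P] = (fun v : 'rV[R]_n => v^T) @` [set v | `|v| <= P].
  apply/seteqP; split => [q /= h|_ [v /= h <-]]; last by rewrite trmx_norm.
  by exists q^T; rewrite ?trmxK// trmx_norm.
apply: continuous_compact.
  apply: continuous_subspaceT => v; apply: cont_eps => e e0; exists e => // w h.
  by rewrite -raddfB /= trmx_norm.
apply: bounded_closed_compact.
  exists P; split; first by rewrite num_real.
  by move=> x xr v /= h; exact: le_trans (ltW xr).
have -> : [set v : 'rV[R]_n | `|v| <= P] = (fun v : 'rV[R]_n => `|v|) @^-1` [set t | t <= P] by [].
apply: (@closed_comp _ _ (fun y : 'rV[R]_n => `|y|)); last exact: closed_le.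
move=> y _; apply: cont_eps => e e0; exists e => // z h; apply: le_lt_trans h.
exact: ler_dist_dist.
Qed.

End pairing_theory.

(** * The truncated Lagrangian and its first variation *)

Section local_variation.
Context (R : realType) (n : nat).
Implicit Types (x y z v w : 'rV[R]_n) (q p : 'cV[R]_n).
Notation coham := ('rV[R]_n -> 'cV[R]_n -> R).

(* [Fx] and [Fq] are the partial gradients of [F]. *)
Definition local_ham (B : set 'rV[R]_n) (F : coham) (Fx : 'rV[R]_n -> 'cV[R]_n -> 'cV[R]_n)
    (Fq : 'rV[R]_n -> 'cV[R]_n -> 'rV[R]_n) : Prop :=
  [/\ (forall V : R, 0 <= V -> exists2 C : R, 0 <= C & forall z q v,
         B z -> `|v| <= V -> pairing q v - F z q <= C),
      (forall z q p, B z -> F z q + pairing (p - q) (Fq z q) <= F z p) &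
      (forall P : R, 0 <= P -> exists C m : R, [/\ 0 <= C, 0 < m &
         forall x y q p, B x -> B y -> `|q| <= P -> `|p| <= P ->
         [/\ `|F x q| <= C /\ `|Fx x q| <= C, `|Fq x q| <= C,
             `|Fx y p - Fx x q| <= C * (`|y - x| + `|p - q|),
             `|F y p - F x q - pairing (Fx x q) (y - x) - pairing (p - q) (Fq x q)|
                <= C * (`|y - x| ^+ 2 + `|p - q| ^+ 2) &
             F x q + pairing (p - q) (Fq x q) + m * `|p - q| ^+ 2 <= F x p]])].

Definition LP (F : coham) (P : R) x v : R :=
  sup [set pairing q v - F x q | q in [set q : 'cV[R]_n | `|q| <= P]].

Definition maximizer (F : coham) (P : R) x v q : Prop :=
  [/\ `|q| <= P, LP F P x v = pairing q v - F x q &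
     forall p, `|p| <= P -> pairing p v - F x p <= pairing q v - F x q].

Section one_ham.
Variables (B : set 'rV[R]_n) (F : coham) (Fx : 'rV[R]_n -> 'cV[R]_n -> 'cV[R]_n)
  (Fq : 'rV[R]_n -> 'cV[R]_n -> 'rV[R]_n).
Hypothesis hF : local_ham B F Fx Fq.

Lemma LP_maximizer (P : R) x v : 0 <= P -> B x -> exists q, maximizer F P x v q.
Proof.
move=> P0 Bx; have [_ _ loc] := hF; have [C [m [C0 m0 L]]] := loc P P0.
pose K := [set q : 'cV[R]_n | `|q| <= P]; pose f q := pairing q v - F x q.
have lip q p : K q -> K p -> `|f q - f p| <= (n%:R * `|v| + n%:R * C) * `|q - p| + C * `|q - p| ^+ 2.
  move=> Kq Kp; have [[_ _] b1 _ T _] := L x x p q Bx Bx Kp Kq.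
  rewrite subrr normr0 pairing0r subr0 expr0n add0r in T.
  rewrite /f (_ : _ - _ - _ = pairing (q - p) v - pairing (q - p) (Fq x p) -
    (F x q - F x p - pairing (q - p) (Fq x p))); last by rewrite pairingBl; ring.
  apply: (le_trans (ler_normB _ _)); apply: lerD T.
  apply: (le_trans (ler_normB _ _)); rewrite mulrDl; apply: lerD.
    by apply: (le_trans (pairing_le _ _)); rewrite mulrAC.
  apply: (le_trans (pairing_le _ _)); rewrite -!mulrA ler_wpM2l// mulrC ler_wpM2r//.
have K0 : K !=set0 by exists 0; rewrite /K /= normr0.
have cK : compact K by exact: cV_ball_compact.
have cf : {within K, continuous f}.
  apply/subspace_continuousP => q Kq; apply/cvgrPdist_lt => e e0.
  pose D := n%:R * `|v| + n%:R * C + C + 1.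
  have D0 : 0 < D by rewrite ltr_wpDl// !addr_ge0// mulr_ge0.
  rewrite near_withinE; apply/nbhs_ballP; exists (Num.min 1 (e / D)) => /=.
    by rewrite lt_min ltr01 divr_gt0.
  move=> p; rewrite -ball_normE /= lt_min => /andP[h1 h2] Kp.
  apply: (le_lt_trans (lip _ _ Kq Kp)).
  move: h2; rewrite ltr_pdivlMr//; set d := `|q - p| in h1 *; apply: le_lt_trans.
  have d0 : 0 <= d by exact: normr_ge0.
  have : C * d ^+ 2 <= C * d by rewrite ler_wpM2l// expr2 ler_piMl// ltW.
  rewrite /D; lra.
have [q Kq max] := compact_EVT_max K0 cK cf.
rewrite inE in Kq; exists q.
have max' p : `|p| <= P -> f p <= f q by move=> h; apply: max; rewrite inE.
split => //; apply/eqP; rewrite eq_le; apply/andP; split.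
  by apply: ge_sup; [exists (f q), q|move=> _ [p /= h <-]; exact: max'].
by apply: ub_le_sup; [exists (f q) => _ [p /= h <-]; exact: max'|exists q].
Qed.

Lemma LP_ge (P : R) x v q : 0 <= P -> B x -> `|q| <= P -> pairing q v - F x q <= LP F P x v.
Proof. by move=> P0 Bx qP; have [p [_ -> ]] := LP_maximizer v P0 Bx; apply. Qed.

(** First-order optimality on a convex ball: [q] is compared with [q + th *: (p - q)], where [th] is
    so small that the quadratic error is at most [th * e]. *)
Lemma maximizer_variation (P C m : R) x v q p :
  (forall y p, B y -> `|p| <= P ->
     `|F y p - F x q - pairing (Fx x q) (y - x) - pairing (p - q) (Fq x q)|
                <= C * (`|y - x| ^+ 2 + `|p - q| ^+ 2)) ->
  B x -> maximizer F P x v q -> `|p| <= P -> 0 <= C -> pairing (p - q) (v - Fq x q) <= 0.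
Proof.
move=> T Bx [qP _ mx] pP C0; apply/ler_addgt0Pr => e e0; rewrite add0r.
pose D := C * `|p - q| ^+ 2 + 1.
have D0 : 0 < D by rewrite ltr_wpDl// mulr_ge0// sqr_ge0.
pose th := Num.min 1 (e / D).
have th0 : 0 < th by rewrite lt_min ltr01 divr_gt0.
have th1 : th <= 1 by rewrite ge_min lexx.
have thD : th * D <= e by rewrite -ler_pdivlMr// ge_min lexx orbT.
have tP : `|q + th *: (p - q)| <= P.
  rewrite (_ : _ + _ = (1 - th) *: q + th *: p); last first.
    by rewrite scalerBr scalerBl scale1r addrA addrAC.
  apply: (le_trans (ler_normD _ _)); rewrite !normrZ (gtr0_norm th0) ger0_norm ?subr_ge0//.
  have t1 : 0 <= 1 - th by rewrite subr_ge0.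
  have := ler_wpM2l t1 qP; have := ler_wpM2l (ltW th0) pP; lra.
have := mx _ tP; have := T x _ Bx tP.
rewrite subrr normr0 pairing0r subr0 expr0n add0r (addrC q) addrK normrZ (gtr0_norm th0) pairingZl.
rewrite [pairing (_ + q) v]pairingDl [pairing (th *: _) v]pairingZl ler_norml => /andP[_ h1] h2.
rewrite pairingBr -(ler_pM2l th0).
have : C * (th * `|p - q|) ^+ 2 <= th * e.
  rewrite (_ : C * _ = th * (th * (C * `|p - q| ^+ 2))); last by rewrite !exprMn !expr2; ring.
  apply: ler_wpM2l; first exact: ltW.
  by apply: le_trans thD; apply: ler_wpM2l; [exact: ltW|rewrite lerDl].
rewrite mulrBr; lra.
Qed.

Lemma quad_complete (m d u : R) : 0 < m -> u * d - m * d ^+ 2 <= u ^+ 2 / m.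
Proof.
move=> m0; have : 0 <= (u - m * d) ^+ 2 by exact: sqr_ge0.
rewrite ler_pdivlMr// !expr2 => h.
have : 0 <= u * u + (m * d) * (m * d) by rewrite addr_ge0// -expr2 sqr_ge0.
nra.
Qed.

(** Semiconcavity, with a superdifferential read off from a maximizer [q]. A competitor [p] at the
    shifted point loses [m * |p - q| ^ 2] by strong convexity, and this absorbs the cross terms
    between [p - q] and the shifts [z], [w] after completing the square. *)
Lemma LP_superdiff (P : R) : 0 <= P -> exists2 C : R, 0 <= C & forall x v q z w,
  B x -> B (x + z) -> maximizer F P x v q ->
  LP F P (x + z) (v + w) <= LP F P x v + pairing q w - pairing (Fx x q) z + C * (`|z| ^+ 2 + `|w| ^+ 2).
Proof.
move=> P0; have [_ _ loc] := hF; have [C [m [C0 m0 L]]] := loc P P0.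
pose D := C + n%:R ^+ 2 * (C ^+ 2 + 1) * 2 / m.
exists D; first by rewrite addr_ge0// divr_ge0 ?(ltW m0)// !mulr_ge0// ?sqr_ge0// addr_ge0// sqr_ge0.
move=> x v q z w Bx Bz mq; have [qP LE mx] := mq.
rewrite LE; apply: ge_sup.
  by exists (pairing 0 (v + w) - F (x + z) 0), 0; rewrite //= normr0.
move=> _ [p /= pP <-].
have [_ _ _ _ S1] := L x x q p Bx Bx qP pP.
have [_ _ X2 T2 _] := L x (x + z) p p Bx Bz pP pP.
have [_ _ X3 _ _] := L x x q p Bx Bx qP pP.
have VI : pairing (p - q) (v - Fq x q) <= 0.
  apply: (maximizer_variation (C := C)) mq pP C0 => // y p' By p'P.
  by have [] := L x y q p' Bx By qP p'P.
rewrite (addrC x z) addrK subrr normr0 pairing0l subr0 expr0n addr0 in T2.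
rewrite subrr normr0 add0r in X3.
set d := `|p - q| in S1 X3 *; have d0 : 0 <= d by exact: normr_ge0.
have n0 : 0 <= n%:R :> R by [].
have e1 : pairing (Fx x q) z - n%:R * C * d * `|z| <= pairing (Fx x p) z.
  have : pairing (Fx x q - Fx x p) z <= n%:R * (C * d) * `|z|.
    have /andP[_] := pairing_abs (Fx x q - Fx x p) z; move=> /le_trans; apply.
    by rewrite ler_wpM2r// ler_wpM2l// distrC.
  rewrite pairingBl; lra.
have e2 : pairing p w <= pairing q w + n%:R * d * `|w|.
  have /andP[_] := pairing_abs (p - q) w; rewrite pairingBl -/d; lra.
have e3 : pairing p v - F x p <= pairing q v - F x q - m * d ^+ 2.
  by move: VI S1; rewrite pairingBr !pairingBl; lra.
have e4 : F x p + pairing (Fx x p) z - C * `|z| ^+ 2 <= F (z + x) p.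
  by move: T2; rewrite ler_norml => /andP[h _]; move: h; lra.
have qc := quad_complete d (n%:R * C * `|z| + n%:R * `|w|) m0.
have q2 : (n%:R * C * `|z| + n%:R * `|w|) ^+ 2 / m <= n%:R ^+ 2 * (C ^+ 2 + 1) * 2 / m * (`|z| ^+ 2 + `|w| ^+ 2).
  rewrite [leRHS]mulrAC ler_wpM2r ?invr_ge0 ?(ltW m0)//.
  have := sqr_ge0 (n%:R * C * `|z| - n%:R * `|w|).
  have := sqr_ge0 (n%:R * C * `|w|); have := sqr_ge0 (n%:R * `|z|).
  by rewrite !expr2; nra.
have CW := mulr_ge0 C0 (sqr_ge0 `|w|).
rewrite pairingDr /D (addrC x) [(C + _) * _]mulrDl.
set Q := _ * (`|z| ^+ 2 + `|w| ^+ 2) in q2 *.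
by move: qc; rewrite [X in X - _ <= _]mulrDl; lra.
Qed.

(** At a maximizer inside the ball every direction is admissible in the variational inequality; the
    one dual to [v - Fq x q] yields the norm of this vector. *)
Lemma maximizer_velocity (P : R) x v q : 0 <= P -> B x -> maximizer F P x v q -> `|q| < P ->
  v = Fq x q.
Proof.
move=> P0 Bx mq qP; have [_ _ loc] := hF; have [C [m [C0 m0 L]]] := loc P P0.
have [u u1 uE] := pairing_dual_l (v - Fq x q).
have pP : `|q + (P - `|q|) *: u| <= P.
  apply: (le_trans (ler_normD _ _)); rewrite normrZ ger0_norm ?subr_ge0 ?(ltW qP)//.
  have : 0 <= P - `|q| by rewrite subr_ge0 ltW.
  by move=> h; have := ler_wpM2l h u1; lra.
have VI : pairing (q + (P - `|q|) *: u - q) (v - Fq x q) <= 0.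
  apply: (maximizer_variation (C := C)) mq pP C0 => // y p' By p'P.
  by have [] := L x y q p' Bx By (ltW qP) p'P.
move: VI; rewrite (addrC q) addrK pairingZl uE pmulr_rle0 ?subr_gt0// normr_le0.
by rewrite subr_eq0 => /eqP.
Qed.

End one_ham.
End local_variation.

(** * Near minimal chains: discrete Hamilton equation and conservation laws *)

Section chains.
Context (R : realType) (n : nat) (y0 : 'rV[R]_n) (r : R).
Implicit Types (v w z : 'rV[R]_n) (p : 'cV[R]_n) (x d : nat -> 'rV[R]_n) (q : nat -> 'cV[R]_n).
Local Notation B := (box y0 r).

Definition chain (N : nat) x := forall i, (i <= N)%N -> B (x i).
Definition vel (b : R) x (i : nat) := b^-1 *: (x i.+1 - x i).
Definition cost (F : 'rV[R]_n -> 'cV[R]_n -> R) (P b : R) (N : nat) x : R :=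
  \sum_(i < N) b * LP F P (x i) (vel b x i).

Lemma sum_two N (f : 'I_N -> R) (i j : 'I_N) : i != j ->
  (forall k, k != i -> k != j -> f k = 0) -> \sum_k f k = f i + f j.
Proof.
move=> ij f0; rewrite (bigD1 i)//= (bigD1 j) ?(eq_sym j)//= big1 ?addr0// => k /andP[ki kj].
exact: f0.
Qed.

Variables (F : 'rV[R]_n -> 'cV[R]_n -> R) (Fx : 'rV[R]_n -> 'cV[R]_n -> 'cV[R]_n)
  (Fq : 'rV[R]_n -> 'cV[R]_n -> 'rV[R]_n).
Hypothesis hF : local_ham B F Fx Fq.

Definition maximizing (P b : R) N x q :=
  forall i, (i < N)%N -> maximizer F P (x i) (vel b x i) (q i).

Lemma maximizing_exists (P b : R) N x : 0 <= P -> chain N x -> exists q, maximizing P b N x q.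
Proof.
move=> P0 cx; exists (fun i => xget 0 [set p | maximizer F P (x i) (vel b x i) p]) => i iN.
have [p mp] := LP_maximizer hF (vel b x i) P0 (cx i (ltnW iN)).
exact: (xgetPex 0 (ex_intro _ p mp)).
Qed.

Lemma cost_perturb (P : R) : 0 <= P -> exists2 C : R, 0 <= C & forall (b : R) N x q d, 0 < b ->
  chain N x -> chain N (fun i => x i + d i) -> maximizing P b N x q ->
  cost F P b N (fun i => x i + d i) <= cost F P b N x + \sum_(i < N)
    (pairing (q i) (d i.+1 - d i) - b * pairing (Fx (x i) (q i)) (d i) +
     b * C * (`|d i| ^+ 2 + (b^-1 * `|d i.+1 - d i|) ^+ 2)).
Proof.
move=> P0; have [C C0 SD] := LP_superdiff hF P0; exists C => // b N x q d b0 cx cxd mq.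
rewrite /cost -big_split /=; apply: ler_sum => i _.
have iN := ltn_ord i.
have := SD _ _ _ (d i) (b^-1 *: (d i.+1 - d i)) (cx i (ltnW iN)) (cxd i (ltnW iN)) (mq i iN).
have -> : vel b x i + b^-1 *: (d i.+1 - d i) = vel b (fun i => x i + d i) i.
  rewrite /vel -scalerDr; congr (_ *: _); apply/rowP => j; rewrite !mxE; ring.
move=> /(ler_wpM2l (ltW b0)) => h; apply: (le_trans h).
rewrite pairingZr normrZ gtr0_norm ?invr_gt0// !mulrDr mulrN (mulrA b b^-1) mulfV ?gt_eqF// mul1r.
by rewrite -!addrA !mulrA.
Qed.

(** Testing the momentum 0 bounds the costs below, so they have an infimum. If [x0] itself is
    already within [e] of it, it is kept, so that the cost stays below [h] in all cases. *)
Lemma chain_near_min (P b h e : R) N x0 : 0 <= P -> 0 < b -> 0 < e -> chain N x0 ->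
  cost F P b N x0 < h -> exists x, [/\ chain N x, x 0%N = x0 0%N, x N = x0 N,
    cost F P b N x < h & forall x', chain N x' -> x' 0%N = x 0%N -> x' N = x N ->
      cost F P b N x <= cost F P b N x' + e].
Proof.
move=> P0 b0 e0 c0 h0.
pose S := [set cost F P b N x | x in [set x | [/\ chain N x, x 0%N = x0 0%N & x N = x0 N]]].
have [_ _ /(_ 0 (lexx _))[C [m [C0 _ L]]]] := hF.
have hS : has_inf S.
  split; first by exists (cost F P b N x0), x0.
  exists (\sum_(i < N) b * - C) => _ [x [cx _ _] <-]; apply: ler_sum => i _.
  have Bx := cx i (ltnW (ltn_ord i)).
  apply: ler_wpM2l; first exact: ltW.
  apply: le_trans (LP_ge hF (vel b x i) P0 Bx (q := 0) _); last by rewrite normr0.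
  rewrite pairing0l add0r lerN2.
  have z0 : `|0 : 'cV[R]_n| <= 0 by rewrite normr0.
  have [[h1 _] _ _ _ _] := L (x i) (x i) 0 0 Bx Bx z0 z0.
  exact: le_trans (ler_norm _) h1.
have [hm|hm] := ltP (inf S + e) (cost F P b N x0); last first.
  exists x0; split => // x' cx' e1 e2; apply: (le_trans hm); rewrite lerD2r.
  by apply: ge_inf; [exact: hS.2|exists x'].
have [_ [x [cx e1 e2] <-] hx] := inf_adherent e0 hS.
exists x; split => //; first exact: lt_trans hx (lt_trans hm h0).
move=> x' cx' e1' e2'; apply: (le_trans (ltW hx)); rewrite lerD2r.
by apply: ge_inf; [exact: hS.2|exists x' => //; split => //; [rewrite e1'|rewrite e2']].
Qed.

(** Only the vertex [k.+1] is moved, by [s] against a direction dual to the residual [u] of the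
    Hamilton equation. The gain [s * |u|] is at most the second-order term [D * s ^ 2] plus the
    defect of minimality [s * b ^ 2 / 2]. The choice of [s] makes [D * s] at most [b ^ 2 / 2] and
    keeps the vertex in the box. *)
Lemma chain_EL (P : R) : 0 <= P -> 0 < r -> forall b : R, 0 < b -> exists2 e0 : R, 0 < e0 &
  forall N x q k, chain N x -> maximizing P b N x q -> (k.+1 < N)%N -> box y0 (r / 2) (x k.+1) ->
  (forall x', chain N x' -> x' 0%N = x 0%N -> x' N = x N ->
      cost F P b N x <= cost F P b N x' + e0) ->
  `|q k - q k.+1 - b *: Fx (x k.+1) (q k.+1)| <= b ^+ 2.
Proof.
move=> P0 r0 b b0; have [C C0 H] := cost_perturb P0.
pose D := b * C * (1 + 2 * b^-1 ^+ 2) + 1.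
have D0 : 0 < D by rewrite ltr_wpDl// !mulr_ge0 ?(ltW b0)// addr_ge0// mulr_ge0// sqr_ge0.
pose s := Num.min (r / 2) (b ^+ 2 / (2 * D)).
have b20 : 0 < b ^+ 2 by rewrite exprn_gt0.
have s0 : 0 < s by rewrite lt_min !divr_gt0// mulr_gt0.
exists (s * (b ^+ 2 / 2)); first by rewrite mulr_gt0// divr_gt0.
move=> N x q k cx mq kN bk mn.
set u := q k - q k.+1 - _.
have [w w1 wE] := pairing_dual_r u.
pose z := (- s) *: w.
have zs : `|z| <= s by rewrite normrZ normrN (gtr0_norm s0) ler_piMr// ltW.
pose d (i : nat) := if i == k.+1 then z else 0 : 'rV[R]_n.
have cxd : chain N (fun i => x i + d i).
  move=> i iN; rewrite /d; case: eqP => [->|_]; last by rewrite addr0; exact: cx.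
  rewrite /box /= addrAC; apply: (le_trans (ler_normD _ _)).
  have : s <= r / 2 by rewrite ge_min lexx.
  move: bk; rewrite /box /=; lra.
have d0 : d 0%N = 0 by [].
have dN : d N = 0 by rewrite /d gtn_eqF.
have := le_trans (mn _ cxd _ _) (lerD (H b N x q d b0 cx cxd mq) (lexx _)).
rewrite d0 dN !addr0 => /(_ erefl erefl); rewrite -addrA lerDl.
pose i0 := Ordinal (ltnW kN); pose i1 := Ordinal kN.
have i01 : i0 != i1 by rewrite -val_eqE /= neq_ltn ltnSn.
rewrite (sum_two i01); last first.
  move=> j j0 j1; rewrite /d (negbTE (_ : (j : nat) != k.+1))// (negbTE (_ : (j : nat).+1 != k.+1)).
    by rewrite subrr pairing0r normr0 pairing0r !mulr0 expr0n /= addr0 mulr0 !subr0 addr0.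
  by rewrite eqSS.
have dk : d k = 0 by rewrite /d ltn_eqF.
have dk1 : d k.+1 = z by rewrite /d eqxx.
have dk2 : d k.+2 = 0 by rewrite /d gtn_eqF.
have z2 : (0 : R) ^+ 2 = 0 by rewrite expr0n.
rewrite -[d i0]/(d k) -[d i0.+1]/(d k.+1) -[d i1]/(d k.+1) -[d i1.+1]/(d k.+2) dk dk1 dk2.
rewrite -[q i0]/(q k) -[q i1]/(q k.+1) -[x i1]/(x k.+1).
rewrite !subr0 sub0r normrN pairingNr !pairing0r normr0 mulr0 subr0 z2 add0r.
have E : pairing (q k) z - pairing (q k.+1) z - b * pairing (Fx (x k.+1) (q k.+1)) z = - (s * `|u|).
  by rewrite -pairingZl -!pairingBl -/u /z pairingZr wE mulNr.
have zz : `|z| ^+ 2 <= s ^+ 2 by rewrite !expr2 ler_pM.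
have bz : (b^-1 * `|z|) ^+ 2 = b^-1 ^+ 2 * `|z| ^+ 2 by rewrite exprMn.
move=> main.
have l1 : s * `|u| <= D * s ^+ 2 + s * (b ^+ 2 / 2).
  have : b * C * (1 + 2 * b^-1 ^+ 2) * `|z| ^+ 2 <= D * s ^+ 2.
    apply: ler_pM; [|exact: sqr_ge0|by rewrite lerDl|exact: zz].
    by rewrite !mulr_ge0 ?(ltW b0)// addr_ge0// mulr_ge0// sqr_ge0.
  by move: main E; rewrite bz; lra.
have l2 : s * `|u| <= s * (D * s + b ^+ 2 / 2).
  by apply: (le_trans l1); rewrite mulrDr expr2; lra.
rewrite ler_pM2l// in l2; apply: (le_trans l2).
have : s <= b ^+ 2 / (2 * D) by rewrite ge_min lexx orbT.
rewrite ler_pdivlMr ?mulr_gt0//; lra.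
Qed.

(** In the Taylor expansion of [G] at [(z, p)] the terms of first order in [b] form the Poisson
    bracket, which vanishes by hypothesis. What remains is the residual of the discrete Hamilton
    equation and quadratic terms. For [G := F] the hypothesis is trivial, and this is the
    conservation of energy. *)
Lemma conservation_step (P : R) (G : 'rV[R]_n -> 'cV[R]_n -> R) Gx Gq : 0 <= P ->
  local_ham B G Gx Gq ->
  (forall z p, B z -> pairing (Gx z p) (Fq z p) = pairing (Fx z p) (Gq z p)) ->
  exists2 D : R, 0 <= D & forall (b : R) (z z' : 'rV[R]_n) (p p' : 'cV[R]_n), 0 < b -> b <= 1 ->
  B z -> B z' -> `|p| <= P -> `|p'| <= P -> z' - z = b *: Fq z p ->
  `|p - p' - b *: Fx z' p'| <= b ^+ 2 -> `|G z' p' - G z p| <= D * b ^+ 2.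
Proof.
move=> P0 hG pois.
have [_ _ /(_ P P0)[C1 [m1 [C10 _ L1]]]] := hF; have [_ _ /(_ P P0)[C2 [m2 [C20 _ L2]]]] := hG.
pose C := C1 + C2; have C0 : 0 <= C by exact: addr_ge0.
exists (C * (C ^+ 2 + (C + 1) ^+ 2) + n%:R * (1 + C * (2 * C + 1)) * C).
  have C20' := sqr_ge0 C; have C21 := sqr_ge0 (C + 1).
  by apply: addr_ge0; [apply: mulr_ge0|apply: mulr_ge0 => //; apply: mulr_ge0] => //;
    rewrite ?addr_ge0// mulr_ge0// addr_ge0// mulr_ge0.
move=> b z z' p p' b0 b1 Bz Bz' pP pP' zE el.
have [[_ f1] f2 f3 _ _] := L1 z z' p p' Bz Bz' pP pP'.
have [[_ f1'] _ _ _ _] := L1 z' z' p' p' Bz' Bz' pP' pP'.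
have [_ g2 _ g4 _] := L2 z z' p p' Bz Bz' pP pP'.
have CC1 : C1 <= C by rewrite lerDl.
have CC2 : C2 <= C by rewrite lerDr.
have bb : b ^+ 2 <= b by rewrite expr2 ler_piMl// ltW.
have nz : `|z' - z| <= C * b.
  by rewrite zE normrZ gtr0_norm// mulrC ler_wpM2r ?(ltW b0)// (le_trans f2).
have np : `|p' - p| <= (C + 1) * b.
  rewrite distrC (_ : p - p' = (p - p' - b *: Fx z' p') + b *: Fx z' p'); last by rewrite subrK.
  apply: (le_trans (ler_normD _ _)); rewrite normrZ gtr0_norm//.
  have : b * `|Fx z' p'| <= b * C by rewrite ler_wpM2l ?(ltW b0)// (le_trans f1').
  lra.
have e0 : 0 <= `|z' - z| by []. have e0' : 0 <= `|p' - p| by [].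
have fd : `|Fx z' p' - Fx z p| <= C * ((2 * C + 1) * b).
  by apply: (le_trans f3); apply: ler_pM => //; lra.
have nu : `|p' - p + b *: Fx z p| <= (1 + C * (2 * C + 1)) * b ^+ 2.
  rewrite (_ : _ + _ = - (p - p' - b *: Fx z' p') - b *: (Fx z' p' - Fx z p)); last first.
    by rewrite scalerBr; apply/colP => j; rewrite !mxE; ring.
  apply: (le_trans (ler_normB _ _)); rewrite normrN normrZ gtr0_norm//.
  have := ler_wpM2l (ltW b0) fd; rewrite expr2 in el *; lra.
have GE : pairing (Gx z p) (z' - z) + pairing (p' - p) (Gq z p) =
    pairing (p' - p + b *: Fx z p) (Gq z p).
  by rewrite zE (pairingDl (p' - p)) pairingZr (pairingZl b (Fx z p)) pois// addrC.
rewrite (_ : G z' p' - G z p = (G z' p' - G z p - pairing (Gx z p) (z' - z) - pairing (p' - p) (Gq z p))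
   + pairing (p' - p + b *: Fx z p) (Gq z p)); last by rewrite -GE; ring.
apply: (le_trans (ler_normD _ _)); rewrite mulrDl; apply: lerD.
  apply: (le_trans g4); rewrite -mulrA; apply: ler_pM => //.
  rewrite mulrDl -!exprMn; apply: lerD; rewrite !expr2; apply: ler_pM => //.
apply: (le_trans (pairing_le _ _)); rewrite [leRHS]mulrAC; apply: ler_pM => //.
  by rewrite -mulrA ler_wpM2l.
exact: le_trans CC2.
Qed.

Lemma energy_momentum (E : R) : exists2 P1 : R, 0 <= P1 & forall z p, B z -> F z p <= E -> `|p| <= P1.
Proof.
have [/(_ 1 ler01)[C C0 H] _ _] := hF; exists (`|C + E|) => // z p Bz FE.
have [u u1 uE] := pairing_dual_r p; have := H z p u Bz u1; rewrite uE => h.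
apply: le_trans (ler_norm _); lra.
Qed.

(** The bound does not depend on the truncation level [P], which can therefore be chosen after it.
    The maximizer is compared with the momentum 0, and the growth condition is used at the speed
    [V + 1]. *)
Lemma velocity_momentum (V : R) : 0 <= V -> exists2 P0 : R, 0 <= P0 & forall P z v p, 0 <= P ->
  B z -> `|v| <= V -> maximizer F P z v p -> `|p| <= P0.
Proof.
move=> V0; have [/(_ (V + 1) (addr_ge0 V0 ler01))[C C0 H] _ /(_ 0 (lexx _))[C' [m [C'0 _ L]]]] := hF.
exists (C + C'); first exact: addr_ge0.
move=> P z v p P0 Bz vV [pP _ mx].
have [u u1 uE] := pairing_dual_r p.
have vu : `|v + u| <= V + 1 by apply: (le_trans (ler_normD _ _)); exact: lerD.
have z0 : `|0 : 'cV[R]_n| <= 0 by rewrite normr0.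
have [[h1 _] _ _ _ _] := L z z 0 0 Bz Bz z0 z0.
have := mx 0; rewrite normr0 pairing0l => /(_ P0) h2.
have := H z p _ Bz vu; rewrite pairingDr uE => h3.
have := ler_norm (F z 0); lra.
Qed.

Lemma seg_low (K CK P b : R) z w : 0 < K -> K <= P -> 0 < b ->
  (forall z p, B z -> `|p| <= K -> F z p <= CK) -> B z ->
  K * `|w| - b * CK <= b * LP F P z (b^-1 *: w).
Proof.
move=> K0 KP b0 HK Bz; have [u u1 uE] := pairing_dual_l w.
have uK : `|K *: u| <= K by rewrite normrZ gtr0_norm// ler_piMr// ltW.
have P0 : 0 <= P by apply: le_trans KP; exact: ltW.
have := LP_ge hF (b^-1 *: w) P0 Bz (le_trans uK KP).
rewrite pairingZl pairingZr uE => /(ler_wpM2l (ltW b0)); apply: le_trans.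
have := ler_wpM2l (ltW b0) (HK z _ Bz uK).
rewrite mulrBr (mulrCA b) mulVKf ?gt_eqF//; lra.
Qed.

Lemma chain_length (K CK P b : R) N x : 0 < K -> K <= P -> 0 < b ->
  (forall z p, B z -> `|p| <= K -> F z p <= CK) -> chain N x ->
  K * (\sum_(i < N) `|x i.+1 - x i|) <= cost F P b N x + CK * (b * N%:R).
Proof.
move=> K0 KP b0 HK cx.
have -> : CK * (b * N%:R) = \sum_(i < N) b * CK.
  by rewrite sumr_const card_ord -mulr_natr; ring.
rewrite mulr_sumr /cost -big_split /=; apply: ler_sum => i _.
have := seg_low (x i.+1 - x i) K0 KP b0 HK (cx i (ltnW (ltn_ord i))).
rewrite -/(vel b x i); lra.
Qed.

Lemma displacement_le N x i : (i <= N)%N -> `|x i - x 0%N| <= \sum_(j < N) `|x j.+1 - x j|.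
Proof.
elim: N i => [|N IH] i; first by rewrite leqn0 => /eqP ->; rewrite subrr normr0 big_ord0.
rewrite leq_eqVlt big_ord_recr /= => /orP[/eqP ->|iN].
  rewrite (_ : x N.+1 - x 0%N = (x N - x 0%N) + (x N.+1 - x N)).
    by apply: (le_trans (ler_normD _ _)); rewrite lerD2r; exact: IH.
  by apply/rowP => j; rewrite !mxE; ring.
by apply: ler_wpDr => //; exact: IH.
Qed.

Lemma sum_average N (f : 'I_N -> R) (S : R) : (0 < N)%N -> \sum_i f i <= S ->
  exists i, f i * N%:R <= S.
Proof.
move=> N0 fS; apply: contrapT => h.
have lt i : S / N%:R < f i.
  by rewrite ltNge ler_pdivlMr ?ltr0n//; apply/negP => hi; apply: h; exists i.
have : \sum_(i < N) S / N%:R < \sum_i f i.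
  apply: ltr_sum => //; by apply/hasP; exists (Ordinal N0); rewrite ?mem_index_enum.
rewrite sumr_const card_ord -[(_ / _) *+ N]mulr_natr divfK ?pnatr_eq0 -?lt0n// => h2.
by move: (lt_le_trans h2 fS); rewrite ltxx.
Qed.

Variables (G : 'rV[R]_n -> 'cV[R]_n -> R) (Gx : 'rV[R]_n -> 'cV[R]_n -> 'cV[R]_n)
  (Gq : 'rV[R]_n -> 'cV[R]_n -> 'rV[R]_n).
Hypothesis hG : local_ham B G Gx Gq.
Hypothesis pois : forall z p, B z -> pairing (Gx z p) (Fq z p) = pairing (Fx z p) (Gq z p).

(** The chain is short, so one of its segments is slow; there the momentum and the energy are
    bounded. Conservation of [F] carries the bound on the energy to all segments, forwards and
    backwards, since the accumulated error [t * DF * b] is at most 1. With the momenta bounded, the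
    conservation of [G] can be summed along the chain. *)
Lemma chain_claim (K CK t : R) : 0 < r -> 0 < K -> 0 <= CK -> 0 < t ->
  (forall z p, B z -> `|p| <= K -> F z p <= CK) ->
  exists P P1 : R, [/\ K <= P, 0 <= P1 & P1 < P] /\ forall e : R, 0 < e -> exists N0, forall M,
  (N0 <= M)%N -> let b := t / M.+2%:R in exists2 Cb : R, 0 <= Cb & forall x0 (h : R),
  chain M.+2 x0 -> box y0 (r / 4) (x0 0%N) -> cost F P b M.+2 x0 < h -> h + CK * t <= K * (r / 4) ->
  exists x q, [/\ [/\ chain M.+2 x, maximizing P b M.+2 x q & cost F P b M.+2 x < h],
    x 0%N = x0 0%N /\ x M.+2 = x0 M.+2,
    (forall i, (i < M.+2)%N -> `|q i| <= P1 /\ vel b x i = Fq (x i) (q i)),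
    `|G (x M.+2) (q M.+1) - G (x 0%N) (q 0%N)| <= e &
    forall z w, B (x 0%N + z) -> B (x M.+2 + w) -> exists x',
      [/\ chain M.+2 x', x' 0%N = x 0%N + z, x' M.+2 = x M.+2 + w &
        cost F P b M.+2 x' <= cost F P b M.+2 x - pairing (q 0%N) z + pairing (q M.+1) w +
          e * `|z| + Cb * (`|z| ^+ 2 + `|w| ^+ 2)]].
Proof.
move=> r0 K0 CK0 t0 HK.
have [P0 P00 HP0] := velocity_momentum (divr_ge0 (ltW r0) (ltW t0)).
have [_ _ /(_ P0 P00)[E1 [m1 [E10 _ LE]]]] := hF.
have [P1 P10 HP1] := energy_momentum (E1 + 1).
(* [P1] bounds the momenta of energy at most [E1 + 1]. The summand 1 leaves room for one backward
   step of the momentum, taken before its energy is known; [K] makes the length estimate available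
   for the truncated cost. *)
pose P := P1 + 1 + K.
have PP : 0 <= P by rewrite !addr_ge0// ltW.
have P1P : P1 < P by rewrite /P; lra.
have KP : K <= P by rewrite /P; lra.
exists P, P1; split => // e e0.
have [_ _ /(_ P PP)[C1 [mm1 [C10 _ L1]]]] := hF.
have [_ _ /(_ P PP)[C2 [mm2 [C20 _ L2]]]] := hG.
have [DF DF0 consF] := conservation_step PP hF (fun z p _ => erefl).
have [DG DG0 consG] := conservation_step PP hG pois.
(* The sum of all the constants that will be multiplied by the time step [b]; the number of segments
   is chosen so that [b * Q <= Num.min 1 e]. *)
pose Q := 1 + (C1 + 1) + t * DF + (t * DG + (n%:R * C2 * C1 + C2 * C1 ^+ 2)) + n%:R * C1.
have tDF : 0 <= t * DF by rewrite mulr_ge0// ltW.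
have tDG : 0 <= t * DG by rewrite mulr_ge0// ltW.
have nC : 0 <= n%:R * C2 * C1 + C2 * C1 ^+ 2 by rewrite addr_ge0// !mulr_ge0// sqr_ge0.
have nC1 : 0 <= n%:R * C1 by rewrite mulr_ge0.
have Q1 : 1 <= Q by rewrite /Q; move: C10 tDF tDG nC nC1; clear -hF hG pois; lra.
have Q0 : 0 < Q by exact: lt_le_trans Q1.
pose e1 := Num.min 1 e.
have e10 : 0 < e1 by rewrite lt_min ltr01.
have tQ : 0 <= t * Q / e1 by rewrite divr_ge0 ?mulr_ge0 ?ltW.
exists (Num.bound (t * Q / e1)) => M NM b.
have N0 : 0 < M.+2%:R :> R by rewrite ltr0n.
have b0 : 0 < b by rewrite divr_gt0.
have bQ : b * Q <= e1.
  rewrite /b mulrAC ler_pdivrMr// -ler_pdivrMl// [leLHS]mulrC.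
  apply: (le_trans (ltW (archi_boundP tQ))); rewrite ler_nat; apply: leq_trans NM _.
  by rewrite ltnW.
have bN : b * M.+2%:R = t by rewrite /b divfK// gt_eqF.
have be1 (c : R) : c <= Q -> b * c <= 1 /\ b * c <= e.
  move=> cQ; have h : b * c <= e1 by apply: le_trans bQ; rewrite ler_wpM2l// ltW.
  by split; apply: (le_trans h); rewrite ge_min lexx// orbT.
have b1 : b <= 1 by rewrite -[b]mulr1; have [] := be1 1 Q1.
have [c1 _] : b * (C1 + 1) <= 1 /\ b * (C1 + 1) <= e by apply: be1; rewrite /Q; move: C10 tDF tDG nC nC1; clear -hF hG pois; lra.
have [c2 _] : b * (t * DF) <= 1 /\ b * (t * DF) <= e by apply: be1; rewrite /Q; move: C10 tDF tDG nC nC1; clear -hF hG pois; lra.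
have [_ c3] : b * (t * DG + (n%:R * C2 * C1 + C2 * C1 ^+ 2)) <= 1 /\
  b * (t * DG + (n%:R * C2 * C1 + C2 * C1 ^+ 2)) <= e by apply: be1; rewrite /Q; move: C10 tDF tDG nC nC1; clear -hF hG pois; lra.
have [_ c4] : b * (n%:R * C1) <= 1 /\ b * (n%:R * C1) <= e by apply: be1; rewrite /Q; move: C10 tDF tDG nC nC1; clear -hF hG pois; lra.
have [CP CP0 pert] := cost_perturb PP.
have [e2 e20 EL] := chain_EL PP r0 b0.
(* The displacement of an end vertex is taken up by a single segment, whose velocity changes by
   [b^-1] times as much. *)
exists (b * CP * (1 + b^-1 ^+ 2)).
  by apply: mulr_ge0; [apply: mulr_ge0; [exact: ltW|exact: CP0]|apply: addr_ge0; [exact: ler01|exact: sqr_ge0]].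
move=> x0 h cx0 bx0 ch hK.
have [x [cx x0E xNE cxh near_min]] := chain_near_min PP b0 e20 cx0 ch.
have [q mq] := maximizing_exists b PP cx.
have len := chain_length K0 KP b0 HK cx.
rewrite bN in len.
have {}len : \sum_(i < M.+2) `|x i.+1 - x i| <= r / 4.
  by rewrite -(ler_pM2l K0); apply: (le_trans len); move: hK cxh; clear -hF hG pois; lra.
have inb i : (i <= M.+2)%N -> box y0 (r / 2) (x i).
  move=> iN; have := le_trans (displacement_le x iN) len.
  move: bx0; rewrite -x0E /box /= => h1 h2.
  rewrite (_ : _ - y0 = (x i - x 0%N) + (x 0%N - y0)); last by rewrite addrA subrK.
  by apply: (le_trans (ler_normD _ _)); move: h1 h2; clear -hF hG pois; lra.
have qP i : (i < M.+2)%N -> `|q i| <= P by move=> /mq[].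
have el k : (k.+1 < M.+2)%N -> `|q k - q k.+1 - b *: Fx (x k.+1) (q k.+1)| <= b ^+ 2.
  by move=> kM; apply: (EL _ _ _ _ cx mq kM (inb _ (ltnW kM)) near_min).
have velE i : (i < M.+2)%N -> `|q i| <= P1 -> vel b x i = Fq (x i) (q i).
  move=> iN qi; apply: (maximizer_velocity hF PP (cx _ (ltnW iN)) (mq _ iN)).
  exact: le_lt_trans P1P.
have stepE i : (i < M.+2)%N -> vel b x i = Fq (x i) (q i) -> x i.+1 - x i = b *: Fq (x i) (q i).
  by move=> iN <-; rewrite /vel scalerA mulfV ?gt_eqF// scale1r.
(* A segment of at most average length; its speed is at most [r / t], for which [P0] bounds the
   momentum. *)
have [i0 [i0N Fi0]] : exists i0, (i0 < M.+2)%N /\ F (x i0) (q i0) <= E1.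
  have [[i iN] /= hi] := sum_average (ltn0Sn M.+1) len.
  exists i; split => //; have Bi := cx _ (ltnW iN).
  have vi : `|vel b x i| <= r / t.
    rewrite /vel normrZ gtr0_norm ?invr_gt0// /b invf_div mulrAC ler_pM2r ?invr_gt0//.
    by rewrite mulrC; apply: (le_trans hi); rewrite ler_pdivrMr// ler_peMr ?(ltW r0)// (ler_nat R 1 4).
  have qi := HP0 _ _ _ _ PP Bi vi (mq _ iN).
  by have [[h1 _] _ _ _ _] := LE _ _ _ _ Bi Bi qi qi; exact: le_trans (ler_norm _) h1.
have sq (D : R) : M.+2%:R * (D * b ^+ 2) = b * (t * D) by rewrite -bN; ring.
have small (d : nat) : (d <= M.+2)%N -> d%:R * (DF * b ^+ 2) <= 1.
  move=> dM; apply: le_trans c2; rewrite -sq.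
  by rewrite ler_wpM2r ?ler_nat// !mulr_ge0// ltW.
have en_mom i (d : nat) : (i < M.+2)%N -> (d <= M.+2)%N -> F (x i) (q i) <= E1 + d%:R * (DF * b ^+ 2) ->
    `|q i| <= P1.
  move=> iN dM Fi; apply: (HP1 (x i)); first exact: cx _ (ltnW iN).
  by apply: (le_trans Fi); rewrite lerD2l; exact: small.
have consk i (Phi : 'rV[R]_n -> 'cV[R]_n -> R) (D : R) :
    (forall (b : R) (z z' : 'rV[R]_n) (p p' : 'cV[R]_n), 0 < b -> b <= 1 ->
      B z -> B z' -> `|p| <= P -> `|p'| <= P -> z' - z = b *: Fq z p ->
      `|p - p' - b *: Fx z' p'| <= b ^+ 2 -> `|Phi z' p' - Phi z p| <= D * b ^+ 2) ->
    (i.+1 < M.+2)%N -> vel b x i = Fq (x i) (q i) ->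
    `|Phi (x i.+1) (q i.+1) - Phi (x i) (q i)| <= D * b ^+ 2.
  move=> cons iN vi; have iN' := ltnW iN.
  apply: (cons b _ _ _ _ b0 b1) (el _ iN); [exact: cx (ltnW iN')|exact: cx (ltnW iN)|
    exact: qP|exact: qP|exact: stepE].
have up (d : nat) : (i0 + d < M.+2)%N -> F (x (i0 + d)%N) (q (i0 + d)%N) <= E1 + d%:R * (DF * b ^+ 2).
  elim: d => [|d IH]; first by rewrite addn0 mul0r addr0.
  rewrite addnS => iN; have {}IH := IH (ltnW iN).
  have dM : (d <= M.+2)%N by apply: leq_trans (leq_addl i0 d) _; exact: ltnW (ltnW iN).
  have qd := en_mom _ _ (ltnW iN) dM IH.
  have := consk _ _ _ consF iN (velE _ (ltnW iN) qd).
  rewrite ler_norml => /andP[_ hF1]; rewrite mulrSr mulrDl mul1r; move: hF1 IH; clear -hF hG pois; lra.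
have down (d : nat) : (d <= i0)%N -> F (x (i0 - d)%N) (q (i0 - d)%N) <= E1 + d%:R * (DF * b ^+ 2).
  elim: d => [|d IH]; first by rewrite subn0 mul0r addr0.
  move=> di; have {}IH := IH (ltnW di).
  have jE : (i0 - d = (i0 - d.+1).+1)%N by rewrite subnSK.
  rewrite jE in IH; set j := (i0 - d.+1)%N in IH *.
  have jN : (j.+1 < M.+2)%N by rewrite -jE; apply: leq_ltn_trans i0N; exact: leq_subr.
  have dM : (d <= M.+2)%N by apply: leq_trans (ltnW di) (ltnW i0N).
  have qd := en_mom _ _ jN dM IH.
  have Bj := cx _ (ltnW jN).
  have [[_ f1] _ _ _ _] := L1 _ _ _ _ Bj Bj (qP _ jN) (qP _ jN).
  (* Comparing the energies at [j] and [j.+1] presupposes the velocity equation at [j], hence that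
     the maximizer [q j] is inside the ball. The discrete Hamilton equation gives this from the
     bound at [j.+1]. *)
  have qj : `|q j| < P.
    rewrite (_ : q j = (q j - q j.+1 - b *: Fx (x j.+1) (q j.+1)) + (q j.+1 + b *: Fx (x j.+1) (q j.+1))); last first.
      by apply/colP => k; rewrite !mxE; ring.
    apply: (le_lt_trans (ler_normD _ _)).
    have := ler_normD (q j.+1) (b *: Fx (x j.+1) (q j.+1)); rewrite normrZ gtr0_norm//.
    have := ler_wpM2l (ltW b0) f1; have := el _ jN.
    have : b ^+ 2 <= b by rewrite expr2 ler_piMl// ltW.
    rewrite /P; move: qd c1 K0; clear -hF hG pois; lra.
  have vj := maximizer_velocity hF PP (cx _ (ltnW (ltnW jN))) (mq _ (ltnW jN)) qj.
  have := consk _ _ _ consF jN vj.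
  rewrite ler_norml => /andP[hF1 _]; rewrite mulrSr mulrDl mul1r; move: hF1 IH; clear -hF hG pois; lra.
have allq i : (i < M.+2)%N -> `|q i| <= P1.
  move=> iN; have [ii|/ltnW ii] := leqP i0 i.
    have := up (i - i0)%N; rewrite subnKC// => /(_ iN); apply: en_mom => //.
    by apply: leq_trans (leq_subr _ _) (ltnW iN).
  have := down (i0 - i)%N (leq_subr _ _); rewrite subKn//; apply: en_mom => //.
  by apply: leq_trans (leq_subr _ _) (ltnW i0N).
have Gc (d : nat) : (d < M.+2)%N -> `|G (x d) (q d) - G (x 0%N) (q 0%N)| <= d%:R * (DG * b ^+ 2).
  elim: d => [|d IH] dN; first by rewrite subrr normr0 mul0r.
  have {}IH := IH (ltnW dN).
  have := consk _ _ _ consG dN (velE _ (ltnW dN) (allq _ (ltnW dN))) => h1.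
  rewrite (_ : _ - _ = (G (x d.+1) (q d.+1) - G (x d) (q d)) + (G (x d) (q d) - G (x 0%N) (q 0%N))); last by ring.
  by apply: (le_trans (ler_normD _ _)); rewrite mulrSr mulrDl mul1r; move: h1 IH; clear -hF hG pois; lra.
exists x, q; split => //.
- by move=> i iN; split; [exact: allq|exact: velE (allq _ iN)].
- have iN := ltnSn M.+1.
  have st := stepE _ iN (velE _ iN (allq _ iN)).
  have B1 := cx _ (ltnW iN); have B2 := cx _ (leqnn M.+2); have Pq := qP _ iN.
  have [_ f2 _ _ _] := L1 _ _ _ _ B1 B1 Pq Pq.
  have [[_ g1] _ _ g4 _] := L2 _ _ _ _ B1 B2 Pq Pq.
  rewrite subrr normr0 pairing0l subr0 expr0n addr0 in g4.
  have nx : `|x M.+2 - x M.+1| <= C1 * b.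
    by rewrite st normrZ gtr0_norm// mulrC ler_wpM2r// ltW.
  have g5 : `|pairing (Gx (x M.+1) (q M.+1)) (x M.+2 - x M.+1)| <= n%:R * C2 * (C1 * b).
    by apply: (le_trans (pairing_le _ _)); apply: ler_pM => //; rewrite ler_wpM2l.
  have g6 : C2 * `|x M.+2 - x M.+1| ^+ 2 <= C2 * (C1 * b) ^+ 2.
    by apply: ler_wpM2l => //; rewrite !expr2; exact: ler_pM.
  have g7 : C2 * (C1 * b) ^+ 2 <= b * (C2 * C1 ^+ 2).
    rewrite (_ : _ * _ = b * (b * (C2 * C1 ^+ 2))); last by ring.
    by rewrite ler_wpM2l ?(ltW b0)// ler_piMl// mulr_ge0// sqr_ge0.
  have g8 : M.+1%:R * (DG * b ^+ 2) <= b * (t * DG).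
    rewrite -sq.
    by rewrite ler_wpM2r ?ler_nat// mulr_ge0// sqr_ge0.
  have := Gc _ iN; set g0 := G (x 0%N) _; set gM := G (x M.+1) _; set gN := G (x M.+2) _ in g4 *.
  move=> g9; rewrite (_ : gN - g0 = (gN - gM - pairing (Gx (x M.+1) (q M.+1)) (x M.+2 - x M.+1)) +
    pairing (Gx (x M.+1) (q M.+1)) (x M.+2 - x M.+1) + (gM - g0)); last by ring.
  apply: (le_trans (ler_normD _ _)).
  have := ler_normD (gN - gM - pairing (Gx (x M.+1) (q M.+1)) (x M.+2 - x M.+1))
    (pairing (Gx (x M.+1) (q M.+1)) (x M.+2 - x M.+1)).
  rewrite -/gM in g4; move: c3 g4 g5 g6 g7 g8 g9; clear -hF hG pois; lra.
move=> z w Bz Bw.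
(* Only the two end vertices move, so the first variation reduces to the boundary terms. The term in
   [Fx] at the first vertex carries a factor [b] and becomes [e * |z|]. *)
pose d i := if i == 0%N then z else if i == M.+2 then w else 0 : 'rV[R]_n.
have d0 : d 0%N = z by [].
have dN : d M.+2 = w by rewrite /d eqxx.
have dm i : (0 < i)%N -> (i < M.+2)%N -> d i = 0 by move=> i1 i2; rewrite /d gtn_eqF// ltn_eqF.
have cxd : chain M.+2 (fun i => x i + d i).
  move=> i iN; have [->|i1] := posnP i; first by rewrite d0.
  move: iN; rewrite leq_eqVlt => /orP[/eqP->|iN]; first by rewrite dN.
  by rewrite dm// addr0; exact: cx (ltnW iN).
exists (fun i => x i + d i); split => //; first by rewrite dN.
have := pert b M.+2 x q d b0 cx cxd mq.
(* There are at least two segments, so the first one and the last one are different. *)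
pose k0 : 'I_M.+2 := ord0; pose k1 : 'I_M.+2 := ord_max.
have k01 : k0 != k1 by [].
have z2 : (0 : R) ^+ 2 = 0 by rewrite expr0n.
rewrite (sum_two k01); last first.
  move=> k kk0 kk1; have kp : (0 < k)%N by rewrite lt0n.
  have kM : (k.+1 < M.+2)%N.
    by rewrite ltnS ltn_neqAle -ltnS ltn_ord andbT; exact: kk1.
  by rewrite !dm// subrr pairing0r normr0 pairing0r !mulr0 z2 addr0 mulr0 subr0 addr0.
rewrite -[d k0]/(d 0%N) -[d k0.+1]/(d 1%N) -[d k1]/(d M.+1) -[d k1.+1]/(d M.+2).
rewrite -[q k0]/(q 0%N) -[q k1]/(q M.+1) -[x k0]/(x 0%N) -[x k1]/(x M.+1).
rewrite d0 dN !dm// sub0r subr0 normrN pairingNr !pairing0r normr0 !mulr0 subr0 z2 add0r.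
have [[_ f1] _ _ _ _] := L1 _ _ _ _ (cx 0%N (leq0n _)) (cx 0%N (leq0n _)) (qP 0%N (ltn0Sn _)) (qP 0%N (ltn0Sn _)).
have h1 : - (e * `|z|) <= b * pairing (Fx (x 0%N) (q 0%N)) z.
  have /andP[h2 _] := pairing_abs (Fx (x 0%N) (q 0%N)) z.
  have := ler_wpM2l (ltW b0) h2; apply: le_trans; rewrite mulrN lerN2.
  rewrite (_ : b * _ = (b * (n%:R * `|Fx (x 0%N) (q 0%N)|)) * `|z|); last by rewrite !mulrA.
  rewrite ler_wpM2r//; apply: le_trans c4; rewrite ler_wpM2l ?(ltW b0)//.
  by rewrite ler_wpM2l.
move=> h2; apply: (le_trans h2); rewrite !exprMn.
have h3 : 0 <= b * CP * `|w| ^+ 2.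
  by apply: mulr_ge0; [apply: mulr_ge0; [exact: ltW|exact: CP0]|exact: sqr_ge0].
by move: h1 h3; clear; lra.
Qed.

End chains.

(** * Coordinates of phase space and the symplectic form *)

Section phase_space.
Context (R : realType) (n : nat).
Local Notation V := ('rV[R]_n * 'cV[R]_n)%type.
Implicit Types (z k : V) (x w : 'rV[R]_n) (q p : 'cV[R]_n).

Definition pbasis (i : 'I_n + 'I_n) : V :=
  match i with inl j => (delta_mx 0 j, 0) | inr j => (0, delta_mx j 0) end.

Definition pcoef (i : 'I_n + 'I_n) (z : V) : R :=
  match i with inl j => z.1 0 j | inr j => z.2 j 0 end.

Lemma prod_norm z : `|z| = Num.max `|z.1| `|z.2|. Proof. by []. Qed.

Lemma sum_fst (I : finType) (h : I -> V) : (\sum_i h i).1 = \sum_i (h i).1.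
Proof. by elim/big_rec2 : _ => //= i u v _ <-. Qed.

Lemma sum_snd (I : finType) (h : I -> V) : (\sum_i h i).2 = \sum_i (h i).2.
Proof. by elim/big_rec2 : _ => //= i u v _ <-. Qed.

Lemma pcoefE z : z = \sum_i pcoef i z *: pbasis i.
Proof.
case: z => x q; rewrite big_sumType /=; apply/pair_equal_spec; split.
  rewrite !sum_fst /= [X in _ + X]big1 ?addr0; last by move=> i _; rewrite /= scaler0.
  by rewrite {1}[x]row_sum_delta.
rewrite !sum_snd /= [X in X + _]big1 ?add0r; last by move=> i _; rewrite /= scaler0.
rewrite {1}[q]matrix_sum_delta; apply: eq_bigr => i _; by rewrite big_ord1.
Qed.

Lemma pcoef_le i z : `|pcoef i z| <= `|z|.
Proof.
rewrite prod_norm le_max; apply/orP; case: i => j /=; [left|right]; exact: mx_entry_le.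
Qed.

Lemma pbasis_norm i : `|pbasis i| <= 1.
Proof.
by rewrite prod_norm ge_max; case: i => j /=; rewrite normr0 ler01 ?andbT;
  apply: mx_norm_le => // k l; rewrite mxE; case: (_ && _); rewrite ?normr1 ?normr0.
Qed.

Definition pgrad1 (f : V -> R) x q : 'cV[R]_n := \col_j 'D_(pbasis (inl j)) f (x, q).
Definition pgrad2 (f : V -> R) x q : 'rV[R]_n := \row_j 'D_(pbasis (inr j)) f (x, q).

Variables (U : set V) (f : V -> R).
Hypotheses (oU : open U) (C2 : Ck 2 U f).

Lemma pgradE x q k : U (x, q) ->
  'D_k f (x, q) = pairing (pgrad1 f x q) k.1 + pairing k.2 (pgrad2 f x q).
Proof.
move=> Uz; rewrite (C2_derivative_sum pcoefE C2 k Uz) big_sumType /= /pairing !mxE.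
by congr (_ + _); apply: eq_bigr => j _; rewrite /= !mxE// mulrC.
Qed.

Lemma hessianE x q k : U (x, q) ->
  'D_k ('D_k f) (x, q) = \sum_j \sum_i pcoef j k * pcoef i k * 'D_(pbasis i) ('D_(pbasis j) f) (x, q).
Proof.
move=> Uz; rewrite (C2_derivative2_sum pcoefE oU C2 k k Uz); apply: eq_bigr => j _.
have d := C2_differentiable1 C2 (pbasis j) Uz.
rewrite deriveE// [X in 'd _ _ X]pcoefE linear_sum mulr_sumr; apply: eq_bigr => i _.
by rewrite linearZ /= -mulrA -deriveE.
Qed.

End phase_space.

Section fiber.
Context (R : realType) (n : nat).

Lemma fiber_derive (Phi : 'rV[R]_n * 'cV[R]_n -> R) (phi : 'cV[R]_n -> R) (T : 'M[R]_n)
    (y : 'rV[R]_n) (w : 'cV[R]_n) : (forall q, Phi (y, q) = phi (T *m q)) ->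
  forall q, 'D_((0 : 'rV[R]_n), w) Phi (y, q) = 'D_(T *m w) phi (T *m q).
Proof.
move=> H q; rewrite /derive.
suff -> : (fun h => h^-1 *: ((Phi \o shift (y, q)) (h *: ((0 : 'rV[R]_n), w)) - Phi (y, q))) =
  (fun h => h^-1 *: ((phi \o shift (T *m q)) (h *: (T *m w)) - phi (T *m q))) by [].
apply/funext => h /=; rewrite H; congr (_ *: (_ - _)).
rewrite -[X in Phi X]/((h *: (0 : 'rV[R]_n) + y, h *: w + q)) scaler0 add0r H.
by rewrite mulmxDr scalemxAr.
Qed.

Lemma derive_lin (W : normedModType R) (L : W -> R) (z xi : W) :
  (forall h : R, L (h *: xi + z) = h * L xi + L z) -> 'D_xi L z = L xi.
Proof.
move=> H; rewrite /derive; apply: lim_near_cst; first exact: Rhausdorff.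
near=> h; rewrite /= H addrK -[_ *: _]/(_ * _) mulKf//.
by near: h; exact: nbhs_dnbhs_neq.
Unshelve. all: end_near. Qed.

(** The Liouville form is linear in the base point, so its directional derivatives are again its
    values. *)
Lemma OmegaE (z xi eta : 'rV[R]_n * 'cV[R]_n) :
  Omega z xi eta = pairing eta.2 xi.1 - pairing xi.2 eta.1.
Proof.
rewrite /Omega /extd /liouville !derive_lin ?opprB// => h.
  by rewrite /= pairingDl pairingZl.
by rewrite /= pairingDl pairingZl.
Qed.

End fiber.

(** * Tonelli Hamiltonians in a box *)

Section chart_hamiltonian.
Context (R : realType) (n : nat) (M : topologicalType) (X : C2manifold R n M).
Variable g : riemannian X.
Local Notation V := ('rV[R]_n * 'cV[R]_n)%type.
Implicit Types (H G : hamiltonian X) (x w : 'rV[R]_n) (q p : 'cV[R]_n).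

Definition ham H a x q := in_chart H a (x, q).

Lemma phase_open (a : chart R n M) : open [set z : V | tgt a z.1].
Proof.
apply: (@open_comp _ _ (fst : V -> 'rV[R]_n) (tgt a)); last exact: tgt_open.
by move=> z _; exact: cvg_fst.
Qed.

Lemma fiber_hessian H a x q (w' : 'cV[R]_n) : tonelli g H -> atlas X a -> tgt a x -> w' != 0 ->
  0 < 'D_((0 : 'rV[R]_n), w') ('D_((0 : 'rV[R]_n), w') (in_chart H a)) (x, q).
Proof.
move=> [_ _ _ cx] aa ax w0; pose T := tmx X a (bwd a x).
have TU : T \in unitmx by apply: tmx_unit => //; exact: bwd_dom.
have e1 : forall q, in_chart H a (x, q) = (H (bwd a x) : 'cV[R]_n -> R) (T *m q) by [].
have e2 := fiber_derive w' e1.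
rewrite (@fiber_derive _ _ _ ('D_(T *m w') (H (bwd a x) : 'cV[R]_n -> R)) T x w' e2); apply: cx.
by apply: contra w0 => /eqP h; rewrite -[w'](mulKmx TU) h mulmx0.
Qed.

(** In these coordinates the Hamiltonian vector of [F] has components [F_q] and [- F_x], and [Omega]
    of two such vectors is the Poisson bracket. *)
Lemma pois_chart H G a x q : tonelli g H -> tonelli g G -> poisson_commute G H -> atlas X a ->
  tgt a x -> pairing (pgrad1 (in_chart G a) x q) (pgrad2 (in_chart H a) x q) =
    pairing (pgrad1 (in_chart H a) x q) (pgrad2 (in_chart G a) x q).
Proof.
move=> tH tG PC aa ax.
have hv (F : hamiltonian X) : tonelli g F -> is_hamiltonian_vector (in_chart F a) (x, q)
    (pgrad2 (in_chart F a) x q, - pgrad1 (in_chart F a) x q).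
  move=> [/(_ a aa) C2 _ _ _] eta; have U : [set z : V | tgt a z.1] (x, q) by [].
  rewrite OmegaE /= pairingNl opprK -deriveE; last exact: (C2_differentiable C2 U).
  by rewrite (pgradE C2 eta U) addrC.
have := PC a aa (x, q) ax _ _ (hv _ tG) (hv _ tH).
by rewrite OmegaE /= !pairingNl opprK addrC => /eqP; rewrite subr_eq0 => /eqP.
Qed.

Section chart_box.
Variables (H : hamiltonian X) (a : chart R n M) (y0 : 'rV[R]_n) (r k : R).
Hypotheses (tH : tonelli g H) (gb : goodbox g a y0 r k).
Local Notation B := (box y0 r).
Local Notation F := (in_chart H a).
Let U := [set z : V | tgt a z.1].

Let aa : atlas X a. Proof. by case: gb. Qed.

Let BU x q : B x -> U (x, q). Proof. by case: gb => _ _ bt _ _; exact: bt. Qed.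

Let C2 : Ck 2 U F. Proof. by case: tH => /(_ a aa). Qed.

Let oU : open U := @phase_open a.

Definition pcompact (P : R) : set V := B `*` [set q : 'cV[R]_n | `|q| <= P].

Lemma pcompact_compact P : compact (pcompact P).
Proof.
apply: compact_setX; last exact: cV_ball_compact.
apply: bounded_closed_compact.
  exists (`|y0| + r); split; first by rewrite num_real.
  move=> x xr y /=; rewrite /box /= => h; apply: le_trans (ltW xr).
  by rewrite -(subrK y0 y) addrC; apply: (le_trans (ler_normD _ _)); rewrite lerD2l.
have -> : box y0 r = (fun y : 'rV[R]_n => `|y - y0|) @^-1` [set t | t <= r] by [].
apply: (@closed_comp _ _ (fun y : 'rV[R]_n => `|y - y0|)); last exact: closed_le.
move=> y _; apply: cont_eps => e e0; exists e => // z h; apply: le_lt_trans h.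
by apply: le_trans (ler_dist_dist _ _) _; rewrite opprB addrA subrK.
Qed.

Lemma pcompact_segment P x q x' q' (t : R) : pcompact P (x, q) -> pcompact P (x', q') ->
  0 <= t <= 1 -> pcompact P ((x, q) + t *: (x' - x, q' - q)).
Proof.
move=> [/= b1 q1] [/= b2 q2] tI; split => /=; first exact: box_convex.
have [t0 t1] := andP tI.
rewrite (_ : q + _ = (1 - t) *: q + t *: q'); last first.
  by rewrite scalerBr scalerBl scale1r addrA addrAC.
apply: (le_trans (ler_normD _ _)); rewrite !normrZ (ger0_norm t0) ger0_norm ?subr_ge0//.
have t1' : 0 <= 1 - t by rewrite subr_ge0.
have := ler_wpM2l t0 q2; have := ler_wpM2l t1' q1; lra.
Qed.

(** The constant is the minimum of the fiber Hessian over points of the box, bounded momenta and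
    unit covectors, a compact set. *)
Lemma fiber_convexity P : exists2 m : R, 0 < m & forall x q (w : 'cV[R]_n), B x -> `|q| <= P ->
  m * `|w| ^+ 2 <= 'D_((0 : 'rV[R]_n), w) ('D_((0 : 'rV[R]_n), w) F) (x, q).
Proof.
pose S := [set w : 'cV[R]_n | `|w| = 1].
pose A := pcompact P `*` S.
(* Written with basis directions, the Hessian is jointly continuous in the point and in the
   covector; the iterated derivative along a varying [w] does not show this. *)
pose h (zw : V * 'cV[R]_n) := \sum_j \sum_i pcoef j ((0 : 'rV[R]_n), zw.2) * pcoef i ((0 : 'rV[R]_n), zw.2) *
    'D_(pbasis R i) ('D_(pbasis R j) F) zw.1.
have hE x q (w : 'cV[R]_n) : B x -> h ((x, q), w) = 'D_((0 : 'rV[R]_n), w) ('D_((0 : 'rV[R]_n), w) F) (x, q).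
  by move=> Bx; rewrite (hessianE oU C2)//; exact: BU.
have homog x q (w : 'cV[R]_n) (c : R) : h ((x, q), c *: w) = c ^+ 2 * h ((x, q), w).
  rewrite /h mulr_sumr; apply: eq_bigr => j _; rewrite mulr_sumr; apply: eq_bigr => i _.
  have pc l : pcoef l ((0 : 'rV[R]_n), c *: w) = c * pcoef l ((0 : 'rV[R]_n), w).
    by case: l => l /=; rewrite !mxE ?mulr0.
  by rewrite /= !pc; ring.
have z2 : (0 : R) ^+ 2 = 0 by rewrite expr0n.
have h0 x q : h ((x, q), 0) = 0.
  by have := homog x q 0 0; rewrite scaler0 z2 mul0r.
have key (K0 : R) : (forall zw, A zw -> K0 <= h zw) -> forall x q (w : 'cV[R]_n), B x ->
    `|q| <= P -> K0 * `|w| ^+ 2 <= 'D_((0 : 'rV[R]_n), w) ('D_((0 : 'rV[R]_n), w) F) (x, q).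
  move=> hm x q w Bx qP; have [wz|wn0] := eqVneq w 0.
    have E0 : 'D_((0 : 'rV[R]_n), w) ('D_((0 : 'rV[R]_n), w) F) (x, q) = 0.
      by rewrite -hE// wz; exact: h0.
    by rewrite E0 wz normr0 z2 mulr0.
  have wn : `|w| != 0 by rewrite normr_eq0.
  have E1 : 'D_((0 : 'rV[R]_n), w) ('D_((0 : 'rV[R]_n), w) F) (x, q) =
      `|w| ^+ 2 * h ((x, q), `|w|^-1 *: w).
    by rewrite -homog scalerA mulfV// scale1r hE.
  rewrite E1 mulrC; apply: ler_wpM2l; first exact: sqr_ge0.
  apply: hm; split => //=.
  by rewrite /S /= normrZ normfV normr_id mulVf.
have [A0|A0] := pselect (A !=set0); last first.
  exists 1 => // x q w Bx qP; have [w0|w0] := eqVneq w 0.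
    by rewrite -hE// w0 h0 normr0 z2 mulr0.
  exfalso; apply: A0; exists ((x, q), `|w|^-1 *: w); split => //=.
  by rewrite /S /= normrZ normfV normr_id mulVf// normr_eq0.
have cS : compact S.
  have -> : S = [set w : 'cV[R]_n | `|w| <= 1] `&` [set w | 1 <= `|w|].
    apply/seteqP; split => w /=; rewrite /S /=; first by move=> ->.
    by move=> [h1 h2]; apply/eqP; rewrite eq_le h1.
  apply: compact_closedI; first exact: cV_ball_compact.
  have -> : [set w : 'cV[R]_n | 1 <= `|w|] = (fun w : 'cV[R]_n => `|w|) @^-1` [set t : R | 1 <= t] by [].
  apply: (@closed_comp _ _ (fun w : 'cV[R]_n => `|w|)); last exact: closed_ge.
  move=> y _; apply: cont_eps => e e0; exists e => // z; apply: le_lt_trans.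
  exact: ler_dist_dist.
have cA : compact A by apply: compact_setX => //; exact: pcompact_compact.
have ch : {within A, continuous h}.
  apply: continuous_in_subspaceT => -[[x q] w]; rewrite inE => -[[/= Bx _] _].
  have Uz : U (x, q) by exact: BU.
  have cpc l : {for ((x, q), w), continuous (fun zw : V * 'cV[R]_n => pcoef l ((0 : 'rV[R]_n), zw.2))}.
    apply: cont_eps => e e0; exists e => // -[z' w'] hh.
    have hw : `|w - w'| < e.
      apply: le_lt_trans hh.
      rewrite -[leRHS]/(Num.max `|(x, q) - z'| `|w - w'|) le_max lexx orbT.
      by [].
    apply: le_lt_trans hw; case: l => l /=; first by rewrite mxE subrr normr0.
    by have := mx_entry_le (w - w') l 0; rewrite !mxE.
  apply: cvg_big; first exact: add_continuous.
  move=> j _; apply: cvg_big; first exact: add_continuous.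
  move=> i _; apply: cvgM; first by apply: cvgM; exact: cpc.
  have c2 : {for (x, q), continuous ('D_(pbasis R i) ('D_(pbasis R j) F))}.
    exact: (C2_continuous2 oU C2 Uz).
  have cD : {for ((x, q), w), continuous
      (fun zw : V * 'cV[R]_n => 'D_(pbasis R i) ('D_(pbasis R j) F) zw.1)}.
    apply: cont_eps => e e0; have [d d0 Hd] := cont_inv c2 e0; exists d => // -[z' w'] hh.
    apply: Hd; apply: le_lt_trans hh.
    rewrite -[leRHS]/(Num.max `|(x, q) - z'| `|w - w'|) le_max lexx.
    by [].
  exact: cD.
have [zw zwA hm] := compact_EVT_min A0 cA ch.
move: zwA hm; case: zw => [[x0 q0] w0]; rewrite inE => -[[/= Bx0 q0P] w01] hm.
have m0 : 0 < h ((x0, q0), w0).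
  rewrite hE//; apply: fiber_hessian => //; first exact: (BU q0 Bx0).
  by rewrite -normr_eq0 w01 oner_neq0.
exists (h ((x0, q0), w0)); first exact: m0.
by apply: key => zw Azw; apply: hm; rewrite inE.
Qed.

(** Convexity for all momenta is the Taylor lower bound with a nonnegative second derivative. The
    constants for momenta of norm at most [P] come from the bound of the Hessian on [pcompact P],
    and the values from those at [(y0, 0)]. Strong convexity holds with [m / 2], the factor of the
    quadratic Taylor term. *)
Lemma chart_local_ham : local_ham B (ham H a) (pgrad1 F) (pgrad2 F).
Proof.
have taylor0 P x q (w : 'cV[R]_n) (c : R) : B x -> `|q| <= P -> `|q + w| <= P ->
    (forall (t : R), 0 <= t <= 1 -> c <= 'D_((0 : 'rV[R]_n), w) ('D_((0 : 'rV[R]_n), w) F) (x, q + t *: w)) ->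
    ham H a x q + pairing w (pgrad2 F x q) + c / 2 <= ham H a x (q + w).
  move=> Bx qP wP hc; have tE (t : R) : (x, q) + t *: ((0 : 'rV[R]_n), w) = (x, q + t *: w).
    by rewrite -[LHS]/((x + t *: 0, q + t *: w)) scaler0 addr0.
  have E1 : (x, q) + ((0 : 'rV[R]_n), w) = (x, q + w) by have := tE 1; rewrite !scale1r.
  have := @C2_taylor_ge R V U F C2 (x, q) ((0 : 'rV[R]_n), w) c.
  rewrite (pgradE C2 _ (BU q Bx)) /= pairing0r add0r E1 => h; apply: h => t tI; rewrite tE.
    exact: BU.
  exact: hc.
split.
- move=> W W0; have [C C0 HC] := chart_superlinear tH gb W0; exists C => // z q v Bz vW; exact: HC.
- move=> z q p Bz; have := @taylor0 (`|q| + `|p|) z q (p - q) 0 Bz.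
  rewrite mul0r addr0 (addrC q) subrK; apply.
  + by rewrite lerDl.
  + by rewrite lerDr.
  + move=> t _; have [->|pq] := eqVneq (p - q) 0; last first.
      by apply/ltW/fiber_hessian => //; exact: (BU q Bz).
    by rewrite (hessianE oU C2 _ (BU _ Bz)) big1// => j _; rewrite big1// => i _;
      case: j => j; case: i => i /=; rewrite !mxE ?mulr0 ?mul0r.
move=> P P0.
have pU : pcompact P `<=` U by move=> [x q] [h _]; exact: (BU q h).
have [C C0 HC] := C2_hessian_bound (@pcoefE R n) (@pcoef_le R n) oU C2 (@pcompact_compact P) pU.
have [m m0 Hm] := fiber_convexity P.
have [r0 k0] : 0 < r /\ 0 < k by case: gb.
have By0 : B y0 by rewrite /box /= subrr normr0 ltW.
pose c0 := `|ham H a y0 0|; pose c1 := `|pgrad1 F y0 0|; pose c2 := `|pgrad2 F y0 0|.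
have segU x q x' q' (t : R) : B x -> B x' -> `|q| <= P -> `|q'| <= P -> 0 <= t <= 1 ->
    U ((x, q) + t *: (x' - x, q' - q)) /\ pcompact P ((x, q) + t *: (x' - x, q' - q)).
  move=> Bx Bx' qP q'P tI; have h := @pcompact_segment P x q x' q' t (conj Bx qP) (conj Bx' q'P) tI.
  split => //; move: h; case: (_ + _) => u v [h _]; exact: BU.
have kle x q x' q' : `|((x' - x, q' - q) : V)| <= `|x' - x| + `|q' - q|.
  by rewrite prod_norm ge_max /= lerDl lerDr !normr_ge0.
have ksq x q x' q' : `|((x' - x, q' - q) : V)| ^+ 2 <= `|x' - x| ^+ 2 + `|q' - q| ^+ 2.
  by rewrite prod_norm /= /Num.max; case: ifP => _; rewrite ?lerDl ?lerDr sqr_ge0.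
have endE x q x' q' : (x, q) + ((x' - x, q' - q) : V) = (x', q').
  by rewrite -[LHS]/((x + (x' - x), q + (q' - q))) !(addrC _ (_ - _)) !subrK.
have tay x q x' q' : B x -> B x' -> `|q| <= P -> `|q'| <= P ->
    `|ham H a x' q' - ham H a x q - pairing (pgrad1 F x q) (x' - x) - pairing (q' - q) (pgrad2 F x q)|
      <= C * (`|x' - x| ^+ 2 + `|q' - q| ^+ 2).
  move=> Bx Bx' qP q'P; pose kk : V := (x' - x, q' - q).
  have hk : C * `|kk| ^+ 2 <= C * (`|x' - x| ^+ 2 + `|q' - q| ^+ 2) by apply: (ler_wpM2l C0); exact: ksq.
  have hk0 : 0 <= C * `|kk| ^+ 2 by rewrite mulr_ge0// sqr_ge0.
  have hb (t : R) : 0 <= t <= 1 -> `|'D_kk ('D_kk F) ((x, q) + t *: kk)| <= C * `|kk| ^+ 2.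
    move=> tI; have [_ h] := segU x q x' q' t Bx Bx' qP q'P tI.
    by have := HC _ kk kk h; rewrite -mulrA -expr2.
  have l1 := @C2_taylor_ge R V U F C2 (x, q) kk (- (C * `|kk| ^+ 2))
    (fun t tI => (segU x q x' q' t Bx Bx' qP q'P tI).1)
    (fun t tI => (andP (etrans (esym (ler_norml _ _)) (hb t tI))).1).
  have l2 := @C2_taylor_le R V U F C2 (x, q) kk (C * `|kk| ^+ 2)
    (fun t tI => (segU x q x' q' t Bx Bx' qP q'P tI).1)
    (fun t tI => (andP (etrans (esym (ler_norml _ _)) (hb t tI))).2).
  rewrite endE (pgradE C2 _ (BU q Bx)) /= in l1; rewrite endE (pgradE C2 _ (BU q Bx)) /= in l2.
  by rewrite /ham ler_norml; apply/andP; split; move: l1 l2 hk hk0; lra.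
have lip e x q x' q' : `|(e : V)| <= 1 -> B x -> B x' -> `|q| <= P -> `|q'| <= P ->
    `|'D_e F (x', q') - 'D_e F (x, q)| <= C * (`|x' - x| + `|q' - q|).
  move=> e1 Bx Bx' qP q'P; pose kk : V := (x' - x, q' - q).
  have := @C2_derive_lipschitz R V U F C2 (x, q) kk e (C * `|kk|)
    (fun t tI => (segU x q x' q' t Bx Bx' qP q'P tI).1).
  rewrite endE => h; apply: (le_trans (h _)).
    move=> t tI; have [_ hh] := segU x q x' q' t Bx Bx' qP q'P tI.
    apply: (le_trans (HC _ kk e hh)); rewrite ler_piMr// mulr_ge0//.
  by rewrite ler_wpM2l// kle.
have lip1 x q x' q' : B x -> B x' -> `|q| <= P -> `|q'| <= P ->
    `|pgrad1 F x' q' - pgrad1 F x q| <= C * (`|x' - x| + `|q' - q|).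
  move=> Bx Bx' qP q'P; apply: mx_norm_le => [|i j]; first by rewrite mulr_ge0// addr_ge0.
  by rewrite !mxE; apply: lip => //; exact: pbasis_norm.
have lip2 x q x' q' : B x -> B x' -> `|q| <= P -> `|q'| <= P ->
    `|pgrad2 F x' q' - pgrad2 F x q| <= C * (`|x' - x| + `|q' - q|).
  move=> Bx Bx' qP q'P; apply: mx_norm_le => [|i j]; first by rewrite mulr_ge0// addr_ge0.
  by rewrite !mxE; apply: lip => //; exact: pbasis_norm.
have z0 : `|0 : 'cV[R]_n| <= P by rewrite normr0.
pose E := c0 + n%:R * c1 * r + n%:R * P * c2 + C * (r ^+ 2 + P ^+ 2).
have [c00 [c10 c20]] : 0 <= c0 /\ 0 <= c1 /\ 0 <= c2 by rewrite !normr_ge0.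
have nr : 0 <= n%:R * c1 * r by rewrite !mulr_ge0// ltW.
have nP : 0 <= n%:R * P * c2 by rewrite !mulr_ge0.
have CrP : 0 <= C * (r ^+ 2 + P ^+ 2) by rewrite mulr_ge0// addr_ge0// sqr_ge0.
have CrP1 : 0 <= C * (r + P) by rewrite mulr_ge0// addr_ge0// ltW.
have bE x q : B x -> `|q| <= P -> `|ham H a x q| <= E.
  move=> Bx qP; have h := tay y0 0 x q By0 Bx z0 qP; rewrite subr0 in h.
  have h1 : `|pairing (pgrad1 F y0 0) (x - y0)| <= n%:R * c1 * r.
    by apply: (le_trans (pairing_le _ _)); apply: ler_wpM2l => //; rewrite mulr_ge0.
  have h2 : `|pairing q (pgrad2 F y0 0)| <= n%:R * P * c2.
    by apply: (le_trans (pairing_le _ _)); apply: ler_wpM2r => //; rewrite ler_wpM2l.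
  have h3 : C * (`|x - y0| ^+ 2 + `|q| ^+ 2) <= C * (r ^+ 2 + P ^+ 2).
    by rewrite ler_wpM2l// lerD// !expr2 ler_pM.
  have := le_trans h h3; set u := pairing _ (x - y0) in h1 *; set v := pairing q _ in h2 *.
  rewrite (_ : ham H a x q = (ham H a x q - ham H a y0 0 - u - v) + u + v + ham H a y0 0); last by ring.
  move=> h4; apply: (le_trans (ler_normD _ _)); rewrite -/c0.
  have := ler_normD (ham H a x q - ham H a y0 0 - u - v + u) v.
  have := ler_normD (ham H a x q - ham H a y0 0 - u - v) u.
  by rewrite /E; move: h1 h2 h4; lra.
have bg x q : B x -> `|q| <= P -> `|pgrad1 F x q| <= c1 + C * (r + P) /\ `|pgrad2 F x q| <= c2 + C * (r + P).
  move=> Bx qP; have hh : C * (`|x - y0| + `|q - 0|) <= C * (r + P).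
    by rewrite subr0 ler_wpM2l// lerD.
  have h1 := le_trans (lip1 y0 0 x q By0 Bx z0 qP) hh.
  have h2 := le_trans (lip2 y0 0 x q By0 Bx z0 qP) hh.
  split.
    rewrite -(subrK (pgrad1 F y0 0) (pgrad1 F x q)) addrC.
    by apply: (le_trans (ler_normD _ _)); rewrite lerD2l.
  rewrite -(subrK (pgrad2 F y0 0) (pgrad2 F x q)) addrC.
  by apply: (le_trans (ler_normD _ _)); rewrite lerD2l.
exists (E + (c1 + C * (r + P)) + (c2 + C * (r + P)) + C), (m / 2).
have E0 : 0 <= E by rewrite /E !addr_ge0.
set D := _ + C.
have DE : E <= D by rewrite /D; move: c10 c20 CrP1 C0; lra.
have D1 : c1 + C * (r + P) <= D by rewrite /D; move: E0 c10 c20 CrP1 C0; lra.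
have D2 : c2 + C * (r + P) <= D by rewrite /D; move: E0 c10 c20 CrP1 C0; lra.
have DC : C <= D by rewrite /D; move: E0 c10 c20 CrP1 C0; lra.
split; [exact: le_trans DE|by rewrite divr_gt0|].
move=> x y q p Bx By qP pP; have [g1 g2] := bg x q Bx qP; split.
- by split; [exact: le_trans (bE x q Bx qP) DE|exact: le_trans g1 D1].
- exact: le_trans g2 D2.
- by apply: (le_trans (lip1 x q y p Bx By qP pP)); rewrite ler_wpM2r// addr_ge0.
- by apply: (le_trans (tay x q y p Bx By qP pP)); rewrite ler_wpM2r// addr_ge0// sqr_ge0.
- have := @taylor0 P x q (p - q) (m * `|p - q| ^+ 2) Bx qP; rewrite (addrC q) subrK => h.
  rewrite [m / 2 * _]mulrAC; apply: h => // t tI; apply: Hm => //.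
  have [_] := segU x q x p t Bx Bx qP pP tI.
  by rewrite -[X in pcompact _ X]/((x + t *: (x - x), q + t *: (p - q))) => -[].
Qed.

End chart_box.
End chart_hamiltonian.

(** * From curves to chains and back *)

Section local_estimates.
Context (R : realType) (n : nat) (M : topologicalType) (X : C2manifold R n M).
Variable g : riemannian X.
Implicit Types (H G : hamiltonian X) (y z : 'rV[R]_n) (q p : 'cV[R]_n) (c : R -> M).

Lemma ham_lip (y0 : 'rV[R]_n) (r : R) F Fx Fq : 0 < r -> local_ham (box y0 r) F Fx Fq ->
  forall P : R, 0 <= P -> exists2 L : R, 0 < L & forall (x y : 'rV[R]_n) q, box y0 r x -> box y0 r y ->
  `|q| <= P -> `|F y q - F x q| <= L * `|y - x|.
Proof.
move=> r0 [_ _ loc] P P0; have [C [m [C0 m0 H]]] := loc P P0.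
exists (n%:R * C + C * (2 * r) + 1); first by rewrite ltr_wpDl// addr_ge0// !mulr_ge0// ltW.
move=> x y q Bx By qP; have [[_ h1] _ _ h2 _] := H x y q q Bx By qP qP.
rewrite subrr normr0 pairing0l subr0 expr0n addr0 in h2.
have h3 : `|pairing (Fx x q) (y - x)| <= n%:R * C * `|y - x|.
  by apply: (le_trans (pairing_le _ _)); rewrite ler_wpM2r// ler_wpM2l.
have h4 : `|y - x| <= 2 * r.
  rewrite (_ : y - x = (y - y0) - (x - y0)); last by rewrite opprB addrA subrK.
  by apply: (le_trans (ler_normB _ _)); move: Bx By; rewrite /box /=; lra.
have h5 : C * `|y - x| ^+ 2 <= C * (2 * r) * `|y - x|.
  by rewrite -mulrA ler_wpM2l// expr2 ler_wpM2r.
have h6 := ler_normD (F y q - F x q - pairing (Fx x q) (y - x)) (pairing (Fx x q) (y - x)).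
rewrite subrK in h6; apply: (le_trans h6); have := normr_ge0 (y - x).
rewrite !mulrDl mul1r; lra.
Qed.

(** The Lagrangian at the velocity [Fq z p] varies little with the base point. As [q] is arbitrary,
    large [q] are discarded first: by the growth condition their value is below [- C3], a lower
    bound of the value at [p]. For the others [ham_lip] applies. *)
Lemma up_uniform (y0 : 'rV[R]_n) (r : R) F Fx Fq : 0 < r -> local_ham (box y0 r) F Fx Fq ->
  forall P e : R, 0 <= P -> 0 < e -> exists2 d : R, 0 < d & forall z z' p q, box y0 r z ->
  box y0 r z' -> `|z' - z| <= d -> `|p| <= P ->
  pairing q (Fq z p) - F z' q <= pairing p (Fq z p) - F z p + e.
Proof.
move=> r0 hF P e P0 e0; have [sup conv loc] := hF.
have [C1 [m1 [C10 _ L1]]] := loc P P0.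
have [C2 C20 L2] := sup (C1 + 1) (addr_ge0 C10 ler01).
have z00 : `|0 : 'cV[R]_n| <= 0 by rewrite normr0.
have [C3 [m3 [C30 _ L3]]] := loc 0 (lexx _).
have P20 : 0 <= C2 + C3 by rewrite addr_ge0.
have [L L0 HL] := ham_lip r0 hF P20.
exists (e / L) => [|z z' p q Bz Bz' zz pP]; first exact: divr_gt0.
have [_ vC _ _ _] := L1 z z p p Bz Bz pP pP.
set v := Fq z p in vC *.
have low : - C3 <= pairing p v - F z p.
  have := conv z p 0 Bz; rewrite sub0r pairingNl -/v.
  have [[h _] _ _ _ _] := L3 z z 0 0 Bz Bz z00 z00; have := ler_norm (F z 0); lra.
have [qs|qb] := leP `|q| (C2 + C3).
  have h1 := HL _ _ _ Bz Bz' qs.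
  have h2 : L * `|z' - z| <= e by rewrite mulrC -ler_pdivlMr.
  have h3 := conv z p q Bz; rewrite pairingBl -/v in h3.
  have := ler_norm (- (F z' q - F z q)); rewrite normrN; lra.
have [u u1 uE] := pairing_dual_r q.
have vu : `|v + u| <= C1 + 1 by apply: (le_trans (ler_normD _ _)); exact: lerD.
have := L2 z' q _ Bz' vu; rewrite pairingDr uE; lra.
Qed.

Lemma ham_velocity_low (K CK : R) (y0 : 'rV[R]_n) (r : R) F Fx Fq :
  local_ham (box y0 r) F Fx Fq -> 0 < K ->
  (forall z p, box y0 r z -> `|p| <= K -> F z p <= CK) ->
  forall z p, box y0 r z -> K * `|Fq z p| - CK <= pairing p (Fq z p) - F z p.
Proof.
move=> [_ conv _] K0 HK z p Bz; have [u u1 uE] := pairing_dual_l (Fq z p).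
have uK : `|K *: u| <= K by rewrite normrZ gtr0_norm// ler_piMr// ltW.
have := conv z p (K *: u) Bz; have := HK _ _ Bz uK.
rewrite pairingBl pairingZl uE; lra.
Qed.

(** The action of each piece is bounded below and their sum is below [h], so each piece is finite;
    [al] is the action counted from 0. *)
Lemma act_real H c (T h : R) : tonelli g H -> 0 <= T -> (act H c 0 T < h%:E)%E ->
  exists al : R -> R, al 0 = 0 /\
    forall u v : R, 0 <= u -> u <= v -> v <= T -> act H c u v = (al v - al u)%:E.
Proof.
move=> tH T0 l; have [B B0 HB] := lagrangian_lb tH.
have fin (u v : R) : 0 <= u -> u <= v -> v <= T -> act H c u v \is a fin_num.
  move=> u0 uv vT.
  have b1 := act_lb c u0 HB; have b2 := act_lb c uv HB; have b3 := act_lb c vT HB.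
  have := l; rewrite (act_split c tH (le_trans u0 uv) vT) (act_split c tH u0 uv).
  by case: (act H c 0 u) b1 => [a1| |] //; case: (act H c u v) b2 => [a2| |] //;
    case: (act H c v T) b3 => [a3| |].
exists (fun v => fine (act H c 0 v)); split.
  have f0 := fin 0 0 (lexx _) (lexx _) T0.
  have := act_split c tH (lexx (0 : R)) (lexx 0); rewrite -(fineK f0) -EFinD => -[]; lra.
move=> u v u0 uv vT; have f1 := fin 0 u (lexx _) u0 (le_trans uv vT).
have f2 := fin u v u0 uv vT; have f3 := fin 0 v (lexx _) (le_trans u0 uv) vT.
have := act_split c tH u0 uv; rewrite -(fineK f1) -(fineK f2) -(fineK f3) -EFinD => -[->].
by congr EFin; rewrite addrC addKr.
Qed.

Lemma kern0 H (x : M) (e : R) : 0 < e -> (kern g H 0 x x < e%:E)%E.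
Proof.
move=> e0; apply: (@le_lt_trans _ _ (act H (cst x) 0 0)).
  apply: ereal_inf_lbound; exists (cst x) => //; split => // e1 e10; exists 1 => // m a b Hab _ _.
  rewrite big1// => i _; have [a0 ab b0] := Hab i; apply/eqP; rewrite eq_le rdist_ge0 andbT.
  by have := reach_rdist (reach0 g x); rewrite mulr0.
have -> : act H (cst x) 0 0 = 0%E; last by rewrite lte_fin.
rewrite /act (@itv_ae_eq R _ (fun=> 0%E) 0 0) ?integral0// => t /andP[t0 /(lt_trans t0)].
by rewrite ltxx.
Qed.

Section box_estimates.
Variables (a : chart R n M) (y0 : 'rV[R]_n) (r k : R).
Hypothesis gb : goodbox g a y0 r k.
Local Notation B := (box y0 r).

Lemma coord_unif c (T : R) : abs_cont_curve g 0 T c ->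
  (forall t, 0 <= t <= T -> dom a (c t) /\ box y0 (r / 4) (fwd a (c t))) ->
  forall d : R, 0 < d -> exists2 e : R, 0 < e & forall u v : R, 0 <= u -> u <= v -> v <= T -> v - u < e ->
    `|fwd a (c v) - fwd a (c u)| <= d.
Proof.
move=> ac inb d d0; have [aa [r0 k0] bt _ _] := gb.
pose e1 := k * Num.min (r / 4) d.
have e10 : 0 < e1 by rewrite mulr_gt0// lt_min d0 divr_gt0.
have ke : k^-1 * e1 = Num.min (r / 4) d by rewrite mulKf ?gt_eqF.
have [e e0 He] := abs_cont_pair ac e10; exists e => // u v u0 uv vT uve.
have [du bu] : dom a (c u) /\ box y0 (r / 4) (fwd a (c u)).
  by apply: inb; rewrite u0 (le_trans uv).
have bu' : box y0 (r / 2) (fwd a (c u)) by move: bu; rewrite /box /=; lra.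
have [|_ h] := rdist_box_ge gb du bu' _ (or_introl (He u v u0 uv vT uve)).
  by rewrite ke ge_min lexx.
by apply: (le_trans h); rewrite ke ge_min lexx orbT.
Qed.

(** Each initial piece of the curve has action at most [A], so [act_reach] bounds the distance of
    each of its points from the start. *)
Lemma curve_in_box H (A K : R) C c (T : R) : 0 < K -> tonelli g H -> 0 <= C ->
  (forall c (T1 T2 A : R), T1 <= T2 -> abs_cont_curve g T1 T2 c -> (act H c T1 T2 <= A%:E)%E ->
    exists V, reach g (c T1) V (c T2) /\ K * V <= A + C * (T2 - T1)) ->
  abs_cont_curve g 0 T c -> (forall t, 0 <= t <= T -> (act H c 0 t <= A%:E)%E) ->
  A + C * T < K * (k * (r / 128)) -> dom a (c 0) -> box y0 (r / 4) (fwd a (c 0)) ->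
  forall t, 0 <= t <= T -> dom a (c t) /\ `|fwd a (c t) - fwd a (c 0)| <= r / 32.
Proof.
move=> K0 tH C0 HC ac Hact hA d0 b0 t tI; have [aa [r0 k0] bt _ _] := gb.
have /andP[t0 tT] := tI.
have [V [rc KV]] := HC c 0 t A t0 (abs_cont_sub (lexx _) tT ac) (Hact t tI).
(* The radius [r / 32] becomes [r / 128] because passing from [reach] to [rdist] costs a factor
   4. *)
have V1 : V < k * (r / 128).
  rewrite -(ltr_pM2l K0); apply: (le_lt_trans KV); apply: le_lt_trans hA; rewrite subr0 lerD2l.
  by rewrite ler_wpM2l.
have rd : (rdist g (c 0%R) (c t) < (k * (r / 32))%:E)%E.
  by apply: (le_lt_trans (reach_rdist rc)); rewrite lte_fin; lra.
have kr : k^-1 * (k * (r / 32)) = r / 32 by rewrite mulKf ?gt_eqF.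
have b0' : box y0 (r / 2) (fwd a (c 0)) by move: b0; rewrite /box /=; lra.
have [|dt ht] := rdist_box_ge gb d0 b0' _ (or_introl rd); first by rewrite kr; lra.
by rewrite kr in ht.
Qed.

Variables (H : hamiltonian X).
Hypothesis tH : tonelli g H.
Local Notation F := (ham H a).

(** On each sampling interval, the maximizing momentum of the sampled segment is tested along the
    curve with [low_act]. The mesh is so fine that [F] at this momentum changes by at most [e]
    there. *)
Lemma start_chain c (T h : R) (P e : R) : 0 <= P -> 0 < e -> 0 < T -> abs_cont_curve g 0 T c ->
  (forall t, 0 <= t <= T -> dom a (c t) /\ box y0 (r / 4) (fwd a (c t))) ->
  (act H c 0 T < h%:E)%E -> exists N0, forall M, (N0 <= M)%N ->
  let b := T / M.+2%:R in exists x : nat -> 'rV[R]_n, [/\ chain y0 r M.+2 x, x 0%N = fwd a (c 0),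
    x M.+2 = fwd a (c T) & cost F P b M.+2 x < h + T * e].
Proof.
move=> P0 e0 T0 ac inb l; have [aa [r0 k0] bt _ _] := gb.
have hF := chart_local_ham tH gb.
have [L L0 HL] := ham_lip r0 hF P0.
have [d d0 Hd] := coord_unif ac inb (divr_gt0 e0 L0).
have [al [al0 alE]] := act_real tH (ltW T0) l.
have Td : 0 <= T / d by rewrite divr_ge0// ltW.
exists (Num.bound (T / d)) => N NM b.
have N0 : 0 < N.+2%:R :> R by rewrite ltr0n.
have b0 : 0 < b by rewrite divr_gt0.
have bN : N.+2%:R * b = T by rewrite /b mulrC divfK// gt_eqF.
have bd : b < d.
  rewrite /b ltr_pdivrMr// -ltr_pdivrMl// [ltLHS]mulrC.
  apply: (lt_le_trans (archi_boundP Td)); rewrite ler_nat; apply: leq_trans NM _.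
  by rewrite ltnW.
have tI (i : nat) : (i <= N.+2)%N -> 0 <= i%:R * b <= T.
  by move=> iN; rewrite mulr_ge0 ?(ltW b0)//= -bN ler_wpM2r ?(ltW b0)// ler_nat.
have sub z : box y0 (r / 4) z -> B z by rewrite /box /=; lra.
pose x (i : nat) := fwd a (c (i%:R * b)).
have cx : chain y0 r N.+2 x.
  by move=> i /tI/inb[_ h1]; exact: sub.
exists x; split => //; [by rewrite /x mul0r|by rewrite /x bN|].
suff main (i : nat) : (i <= N.+2)%N -> \sum_(j < i) b * LP F P (x j) (vel b x j) <= al (i%:R * b) + i%:R * b * e.
  have := main _ (leqnn _); rewrite bN => hm; apply: (le_lt_trans hm).
  by move: l; rewrite (alE 0 T)// ?(ltW T0)// al0 subr0 lte_fin; lra.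
elim: i => [|i IH] iN; first by rewrite big_ord0 !mul0r al0 addr0.
rewrite big_ord_recr /=; have {}IH := IH (ltnW iN).
have [q [qP LE _]] := LP_maximizer hF (vel b x i) P0 (cx i (ltnW iN)).
have /andP[u0 uT] := tI _ (ltnW iN); have /andP[v0 vT] := tI _ iN.
have uv : i%:R * b <= i.+1%:R * b by rewrite ler_wpM2r ?(ltW b0)// ler_nat.
have vE : i.+1%:R * b - i%:R * b = b by rewrite -mulrBl -natrB// subSnn mul1r.
have inb' t : i%:R * b <= t <= i.+1%:R * b -> dom a (c t) /\ box y0 (r / 4) (fwd a (c t)).
  by move=> /andP[t1 t2]; apply: inb; rewrite (le_trans u0)// (le_trans t2).
have low := @low_act _ _ _ _ g H a y0 r k c _ _ (F (x i) q + e) q gb uv (abs_cont_sub u0 vT ac) inb'.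
have {}low := low _; rewrite alE// lee_fin vE in low.
have := low _; rewrite LE /vel pairingZr => h1.
have {}h1 : pairing q (x i.+1 - x i) - (F (x i) q + e) * b <= al (i.+1%:R * b) - al (i%:R * b).
  apply: h1 => t tI'; have /andP[t1 t2] := tI'; have [dt bt'] := inb' t tI'.
  have h2 := HL (x i) (fwd a (c t)) q (cx i (ltnW iN)) (sub _ bt') qP.
  have h3 : `|fwd a (c t) - x i| <= e / L.
    by apply: Hd => //; [exact: le_trans t2 vT|apply: le_lt_trans bd; move: vE t2; lra].
  have h4 : L * `|fwd a (c t) - x i| <= e by rewrite mulrC -ler_pdivlMr.
  by rewrite -[leLHS]/(F (fwd a (c t)) q) -lerBlDl; exact: le_trans (ler_norm _) (le_trans h2 h4).
rewrite mulrBr mulVKf ?gt_eqF//.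
have -> : i.+1%:R * b * e = i%:R * b * e + b * e by rewrite -natr1; ring.
move: IH h1; set S := \sum_(_ < i) _; lra.
Qed.

(** Momenta below [P1 < P] give the velocities as [Fq], and convexity makes the truncated cost of a
    segment its true Lagrangian. Each segment is run at constant speed; [e] pays for the motion of
    the base point, the second [e] makes the bound strict. *)
Lemma final_chain (P P1 e b : R) (N : nat) (x : nat -> 'rV[R]_n) (q : nat -> 'cV[R]_n) : 0 <= P1 -> P1 < P -> 0 < e -> 0 < b ->
  chain y0 r N x -> maximizing F P b N x q ->
  (forall i, (i < N)%N -> `|q i| <= P1 /\ vel b x i = pgrad2 (in_chart H a) (x i) (q i)) ->
  (forall z z' p q, B z -> B z' -> `|z' - z| <= b * `|pgrad2 (in_chart H a) z p| -> `|p| <= P1 ->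
     pairing q (pgrad2 (in_chart H a) z p) - F z' q <= pairing p (pgrad2 (in_chart H a) z p) - F z p + e) ->
  (kern g H (N%:R * b) (bwd a (x 0%N)) (bwd a (x N)) < (cost F P b N x + N%:R * b * (2 * e) + e)%:E)%E.
Proof.
move=> P10 P1P e0 b0 cx mq velE up.
suff main (i : nat) : (i <= N)%N -> (kern g H (i%:R * b) (bwd a (x 0%N)) (bwd a (x i)) <
   (\sum_(j < i) b * LP F P (x j) (vel b x j) + i%:R * b * (2 * e) + e)%:E)%E by exact: main.
elim: i => [|i IH] iN; first by rewrite big_ord0 !mul0r !add0r; exact: kern0.
have {}IH := IH (ltnW iN); have [qP1 vE] := velE i iN; have [_ LE _] := mq i iN.
have Bi := cx i (ltnW iN); have Bi1 := cx _ iN.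
have E : pgrad2 (in_chart H a) (x i) (q i) = b^-1 *: (x i.+1 - x i) by rewrite -vE.
have step : (kern g H b (bwd a (x i)) (bwd a (x i.+1)) <= (b * (LP F P (x i) (vel b x i) + e))%:E)%E.
  apply: (up_kern gb b0 Bi Bi1) => t tI q'; rewrite -E LE vE; apply: up => //.
    exact: box_convex.
  have /andP[t0 t1] := tI.
  rewrite addrC addKr normrZ (ger0_norm t0) E normrZ gtr0_norm ?invr_gt0// mulVKf ?gt_eqF//.
  by rewrite ler_piMl.
have step' : (kern g H b (bwd a (x i)) (bwd a (x i.+1)) < (b * (LP F P (x i) (vel b x i) + 2 * e))%:E)%E.
  by apply: (le_lt_trans step); rewrite lte_fin ltr_pM2l// ltrD2l; lra.
have ib : 0 <= i%:R * b by rewrite mulr_ge0// ltW.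
have := kern_cat tH ib (ltW b0) IH step'.
have -> : i%:R * b + b = i.+1%:R * b by rewrite -natr1; ring.
rewrite big_ord_recr /=; congr (_ < _)%E; congr EFin; rewrite -natr1; ring.
Qed.

End box_estimates.
End local_estimates.

(** * The local exchange *)

Lemma swap_step_arith (R : realType) (D pv px Gy Gz e Cb nv nx C1 CK da h U : R) :
  0 <= D -> 0 <= e -> nv <= C1 -> px - D * (Gy + e) <= da -> Gy - Gz <= e ->
  Cb * nx ^+ 2 <= e * (da + CK * D) -> Cb * (D * nv) ^+ 2 <= D * e ->
  (h - D * pv + px + e * (D * nv) + Cb * ((D * nv) ^+ 2 + nx ^+ 2)) + (U + D * (pv - Gz)) <=
  h + U + da + e * (da + CK * D) + D * (e * (3 + C1)).
Proof.
move=> D0 e0 h1 h2 h3 h4 h5.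
have h6 : e * (D * nv) <= e * (D * C1) by rewrite !ler_wpM2l.
have h7 : D * (Gy - Gz) <= D * e by rewrite ler_wpM2l.
rewrite mulrDr; lra.
Qed.

Lemma mesh (R : realType) (s d : R) : 0 < s -> 0 < d -> exists m : nat, s / m.+1%:R <= d.
Proof.
move=> s0 d0; have sd : 0 <= s / d by rewrite divr_ge0// ltW.
exists (Num.bound (s / d)); rewrite ler_pdivrMr ?ltr0n// -ler_pdivrMl// [leLHS]mulrC.
by apply: (le_trans (ltW (archi_boundP sd))); rewrite ler_nat.
Qed.

(** The end of the chain slides along the given [G]-curve while its initial point moves with
    velocity [dG/dp]; the path of the initial point is the new [G]-curve, and the chain at the end
    of the motion is the new [H]-curve. *)
Lemma swap_chain (R : realType) (n : nat) (M : topologicalType) (X : C2manifold R n M)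
  (g : riemannian X) (a : chart R n M) (y0 : 'rV[R]_n) (r k : R) (G H : hamiltonian X)
  (gb : goodbox g a y0 r k) (tG : tonelli g G) (tH : tonelli g H) (PC : poisson_commute G H)
  (t s K CK h1 h2 : R) (c : R -> M) (zc : 'rV[R]_n) :
  0 < t -> 0 < s -> 0 < K -> 0 <= CK ->
  (forall (z : 'rV[R]_n) (p : 'cV[R]_n), box y0 r z -> `|p| <= K -> (ham H a) z p <= CK /\ (ham G a) z p <= CK) ->
  (forall P e : R, 0 <= P -> 0 < e -> exists N0, forall N, (N0 <= N)%N -> exists x : nat -> 'rV[R]_n,
     [/\ chain y0 r N.+2 x, x 0%N = zc, x N.+2 = fwd a (c 0) &
       cost (ham H a) P (t / N.+2%:R) N.+2 x < h1 + e]) ->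
  abs_cont_curve g 0 s c ->
  (forall u, 0 <= u <= s -> dom a (c u) /\ box y0 (r / 8) (fwd a (c u))) ->
  (act G c 0 s < h2%:E)%E -> box y0 (r / 8) zc ->
  h1 + h2 + 3 * (CK * (t + s)) + 3 <= K * (r / 8) ->
  forall e : R, 0 < e -> exists (z' : M) (u v : R), [/\ (kern g G s (bwd a zc) z' < u%:E)%E,
    (kern g H t z' (c s) < v%:E)%E & u + v < h1 + h2 + e].
Proof.
move=> t0 s0 K0 CK0 HK start ac inb8 lG zc8 size es es0.
have [aa [r0 k0] bt _ _] := gb.
have hH := chart_local_ham tH gb; have hG := chart_local_ham tG gb.
have pois (z : 'rV[R]_n) (p : 'cV[R]_n) : box y0 r z -> pairing (pgrad1 (in_chart G a) z p) ((pgrad2 (in_chart H a)) z p) =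
    pairing (pgrad1 (in_chart H a) z p) ((pgrad2 (in_chart G a)) z p).
  by move=> Bz; apply: (pois_chart _ tH tG PC aa); exact: bt.
have HKH (z : 'rV[R]_n) (p : 'cV[R]_n) : box y0 r z -> `|p| <= K -> (ham H a) z p <= CK by move=> Bz /(HK z p Bz)[].
have HKG (z : 'rV[R]_n) (p : 'cV[R]_n) : box y0 r z -> `|p| <= K -> (ham G a) z p <= CK by move=> Bz /(HK z p Bz)[].
have sub4 (z : 'rV[R]_n) : box y0 (r / 4) z -> box y0 r z by rewrite /box /=; lra.
have inb u : 0 <= u <= s -> dom a (c u) /\ box y0 (r / 4) (fwd a (c u)).
  by move=> /inb8[d1 b1]; split => //; move: b1; rewrite /box /=; lra.
have [al [al0 alE]] := act_real tG (ltW s0) lG.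
have als : al s < h2.
  by move: lG; rewrite (alE 0 s)// ?(ltW s0)// al0 subr0 lte_fin.
have lowG u v (q : 'cV[R]_n) E : 0 <= u -> u <= v -> v <= s ->
    (forall w, u <= w <= v -> in_chart G a (fwd a (c w), q) <= E) ->
    pairing q (fwd a (c v) - fwd a (c u)) - E * (v - u) <= al v - al u.
  move=> u0 uv vs HE; rewrite -lee_fin -alE//.
  apply: (low_act gb uv (abs_cont_sub u0 vs ac)) => // w /andP[w1 w2].
  by apply: inb; rewrite (le_trans u0)// (le_trans w2).
have lowK u v : 0 <= u -> u <= v -> v <= s -> K * `|fwd a (c v) - fwd a (c u)| <= al v - al u + CK * (v - u).
  move=> u0 uv vs; have [w w1 wE] := pairing_dual_l (fwd a (c v) - fwd a (c u)).
  have wK : `|K *: w| <= K by rewrite normrZ gtr0_norm// ler_piMr// ltW.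
  have := lowG u v (K *: w) CK u0 uv vs; rewrite pairingZl wE => h.
  rewrite -lerBlDr; apply: h => x /andP[x1 x2]; apply: HKG => //.
  by apply/sub4; have [] := inb x; rewrite ?(le_trans u0)// (le_trans x2).
(* A shifted action: nondecreasing, with increments at least [K] times the displacement. Errors
   proportional to these increments add up to [e * be s]. *)
pose be u := al u + CK * u.
have be_mono u v : 0 <= u -> u <= v -> v <= s -> be u <= be v.
  move=> u0 uv vs; have := lowK u v u0 uv vs.
  have : 0 <= K * `|fwd a (c v) - fwd a (c u)| by rewrite mulr_ge0// ltW.
  by rewrite /be; clear; lra.
have be0 : be 0 = 0 by rewrite /be al0 mulr0 addr0.
have [P [P1 [[KP P10 P1P] claim]]] := chain_claim hH hG pois r0 K0 CK0 t0 HKH.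
have P0 : 0 <= P by apply: le_trans KP; exact: ltW.
have [_ _ /(_ P1 P10)[C1 [m1 [C10 _ L1]]]] := hG.
have [_ _ /(_ P1 P10)[C2 [m2 [C20 _ L2]]]] := hH.
have bes : 0 <= be s by rewrite -be0; apply: be_mono => //; exact: ltW.
(* [e * W] bounds all the errors together: those of the sliding steps, and those of turning the
   discrete paths into curves at the end. *)
pose W := be s + s * (3 + C1) + 2 * s + 2 * t + 4.
have sC : 0 <= s * (3 + C1) by rewrite mulr_ge0 ?(ltW s0)// addr_ge0.
have W1 : 1 <= W by rewrite /W; move: (ltW s0) (ltW t0) bes sC; lra.
have W0 : 0 < W by apply: lt_le_trans W1.
pose e := Num.min 1 es / W.
have e0 : 0 < e by rewrite divr_gt0// lt_min ltr01.
have eW : e * W = Num.min 1 es by rewrite /e divfK// gt_eqF.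
have eW1 : e * W <= 1 by rewrite eW ge_min lexx.
have eWs : e * W <= es by rewrite eW ge_min lexx orbT.
have e1 : e <= 1 by apply: le_trans eW1; rewrite ler_peMr// ltW.
have [N1 cl1] := claim e e0.
have [N2 st2] := start P e P0 e0.
have [dG dG0 upG] := up_uniform r0 hG P10 e0.
have [dH dH0 upH] := up_uniform r0 hH P10 e0.
have [N3 mesh3] := mesh t0 (divr_gt0 dH0 (ltr_wpDl C20 ltr01)).
pose N := maxn N1 (maxn N2 N3).
have [NN1 [NN2 NN3]] : (N1 <= N)%N /\ (N2 <= N)%N /\ (N3 <= N)%N.
  by rewrite /N !leq_max !leqnn !orbT.
have {cl1} := cl1 N NN1; set b := t / N.+2%:R => -[Cb Cb0 cl].
have b0 : 0 < b by rewrite divr_gt0// ltr0n.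
have bN : N.+2%:R * b = t by rewrite /b mulrC divfK// pnatr_eq0.
have bC2 : b * (C2 + 1) <= dH.
  rewrite -ler_pdivlMr ?ltr_wpDl//; apply: le_trans mesh3.
  rewrite /b ler_wpM2l ?(ltW t0)// lef_pV2 ?posrE ?ltr0n// ler_nat.
  by rewrite ltnS (leq_trans NN3).
have [x00 [cx00 x000 x00N cost00]] := st2 N NN2.
have [L L0 lipG] := ham_lip r0 hG P10.
have Cb1 : 0 < Cb + 1 by rewrite ltr_wpDl.
have d'0 : 0 < Num.min (e / L) (e * K / (Cb + 1)) by rewrite lt_min; apply/andP; split; apply: divr_gt0 => //; apply: mulr_gt0.
have [eu eu0 unif] := coord_unif gb ac inb d'0.
have C11 : 0 < C1 + 1 by rewrite ltr_wpDl.
have CC1 : 0 < Cb * C1 ^+ 2 + 1 by rewrite ltr_wpDl// mulr_ge0// sqr_ge0.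
(* The sliding step is chosen after the chain, as [Cb] depends on [b]. It keeps each displacement of
   the initial point within the box and within the range of [up_uniform], each increment of the
   curve within the modulus [eu], and the quadratic error [Cb * (D * C1) ^ 2] below [D * e]. *)
pose D0 := Num.min (eu / 2) (Num.min (Num.min dG (r / 8) / (C1 + 1)) (e / (Cb * C1 ^+ 2 + 1))).
have D00 : 0 < D0.
  have r8 : 0 < r / 8 by rewrite divr_gt0.
  have mG : 0 < Num.min dG (r / 8) by rewrite lt_min dG0.
  rewrite lt_min; apply/andP; split; first by rewrite divr_gt0.
  by rewrite lt_min; apply/andP; split; exact: divr_gt0.
have [m Dm] := mesh s0 D00; set D := s / m.+1%:R in Dm.
have Dp : 0 < D by rewrite divr_gt0// ltr0n.
have Dms : m.+1%:R * D = s by rewrite /D mulrC divfK// pnatr_eq0.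
have [D1 [D2 D3]] : D <= eu / 2 /\ D <= Num.min dG (r / 8) / (C1 + 1) /\ D <= e / (Cb * C1 ^+ 2 + 1).
  by move: Dm; rewrite !le_min => /and3P[? ? ?].
have Deu : D < eu by apply: (le_lt_trans D1); rewrite ltr_pdivrMr// ltr_pMr// (ltr_nat R 1 2).
have DC1 : D * (C1 + 1) <= Num.min dG (r / 8) by rewrite -ler_pdivlMr.
have DCb : D * (Cb * C1 ^+ 2 + 1) <= e by rewrite -ler_pdivlMr.
pose err (i : nat) := e * be (i%:R * D) + i%:R * D * (e * (3 + C1)).
have iI (i : nat) : (i <= m.+1)%N -> 0 <= i%:R * D <= s.
  by move=> im; rewrite mulr_ge0 ?(ltW Dp)//= -Dms ler_wpM2r ?(ltW Dp)// ler_nat.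
have errW (i : nat) : (i <= m.+1)%N -> err i + e * (2 * s + 2 * t + 4) <= e * W.
  move=> /iI/andP[i0 i1]; have := be_mono _ _ i0 i1 (lexx s).
  rewrite -(ler_pM2l e0) => l1.
  have l2 : i%:R * D * (e * (3 + C1)) <= s * (e * (3 + C1)).
    by rewrite ler_wpM2r// mulr_ge0 ?(ltW e0)// addr_ge0.
  by move: l1 l2; rewrite /err /W; clear; lra.
have CKt : 0 <= CK * t by rewrite mulr_ge0// ltW.
have CKs : 0 <= CK * s by rewrite mulr_ge0// ltW.
have e2 : 0 <= e * (2 * s + 2 * t) by rewrite mulr_ge0 ?(ltW e0)// addr_ge0// mulr_ge0// ltW.
(* After [i] steps, [z] is reached from [zc] by a [G]-curve of action about [U], and an [H]-chain of
   cost below [h] leads from [z] to the given curve at time [i * D]. The third condition keeps [z]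
   in the box; the last one says that the total exceeds the initial cost plus the action already
   spent on the given curve by at most [err i]. *)
pose state (i : nat) := exists (z : 'rV[R]_n) (x : nat -> 'rV[R]_n) (U h : R),
  [/\ [/\ chain y0 r N.+2 x, x 0%N = z, x N.+2 = fwd a (c (i%:R * D)) & cost (ham H a) P b N.+2 x < h],
   (kern g G (i%:R * D) (bwd a zc) (bwd a z) < (U + i%:R * D * (2 * e) + e)%:E)%E,
   K * `|z - zc| <= U + CK * (i%:R * D) &
   h + U <= h1 + e + al (i%:R * D) + err i].
have near (i : nat) (z : 'rV[R]_n) (x : nat -> 'rV[R]_n) (U h : R) : (i <= m.+1)%N ->
    chain y0 r N.+2 x -> cost (ham H a) P b N.+2 x < h ->
    K * `|z - zc| <= U + CK * (i%:R * D) -> h + U <= h1 + e + al (i%:R * D) + err i ->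
    box y0 (r / 4) z /\ h + CK * t <= K * (r / 4).
  move=> im cx ch KU hU; have /andP[i0 i1] := iI i im.
  have len := chain_length hH K0 KP b0 HKH cx; rewrite (mulrC b) bN in len.
  have s1 : 0 <= \sum_(j < N.+2) `|x j.+1 - x j| by apply: sumr_ge0.
  have len0 : 0 <= cost (ham H a) P b N.+2 x + CK * t by apply: le_trans len; rewrite mulr_ge0// ltW.
  have ee := errW i im.
  have CKi : CK * (i%:R * D) <= CK * s by rewrite ler_wpM2l.
  have ali : al (i%:R * D) <= h2 + CK * s - CK * (i%:R * D).
    by have := be_mono _ _ i0 i1 (lexx s); rewrite /be; move: als; clear; lra.
  have KU0 : 0 <= U + CK * (i%:R * D) by apply: le_trans KU; rewrite mulr_ge0// ltW.
  have e04 := ltW e0; have Kr : 0 <= K * (r / 8) by rewrite mulr_ge0 ?ltW// divr_gt0.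
  split.
    have : K * `|z - zc| <= K * (r / 8).
      apply: (le_trans KU); apply: le_trans size.
      by move: len0 ch hU ee eW1 ali CKt CKs e2 e04 CKi; clear; lra.
    rewrite ler_pM2l// => hz; move: zc8; rewrite /box /= => hzc.
    rewrite (_ : z - y0 = (z - zc) + (zc - y0)); last by rewrite addrA subrK.
    by apply: (le_trans (ler_normD _ _)); move: hz hzc; clear; lra.
  apply: (@le_trans _ _ (K * (r / 8))); last by rewrite ler_pM2l//; move: r0; clear; lra.
  apply: le_trans size.
  by move: KU0 hU ee eW1 ali CKt CKs e2 e04 CKi; clear; lra.
have steps (i : nat) : (i <= m.+1)%N -> state i.
  elim: i => [|i IH] im.
    exists zc, x00, 0, (h1 + e); split => //.
    - by rewrite mul0r x00N.
    - by rewrite !mul0r !add0r; exact: kern0.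
    - by rewrite subrr normr0 mulr0 mul0r mulr0 addr0.
    - by rewrite /err !mul0r al0 be0 mulr0 !addr0.
  have [z [x [U [h [[cx xz xN ch] kG KU hU]]]]] := IH (ltnW im).
  have [zb hb] := near i z x U h (ltnW im) cx ch KU hU.
  have xb : box y0 (r / 4) (x 0%N) by rewrite xz.
  (* At every step the chain is first replaced by a near minimal one with the same ends, as the slid
     chain need not satisfy a Hamilton equation. *)
  have [x1 [q [[cx1 mq ch1] [x10 x1N] velE consG pert]]] := cl x h cx xb ch hb.
  rewrite xz in x10; rewrite xN in x1N.
  have /andP[i0 i1] := iI i (ltnW im); have /andP[j0 j1] := iI i.+1 im.
  have ijE : i.+1%:R * D = i%:R * D + D by rewrite -natr1; ring.
  have ij : i%:R * D <= i.+1%:R * D by rewrite ijE lerDl ltW.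
  have ijD : i.+1%:R * D - i%:R * D = D by rewrite ijE addrC addKr.
  set y := fwd a (c (i%:R * D)) in x1N *; set y' := fwd a (c (i.+1%:R * D)).
  set p := q 0%N in consG pert *; set p' := q N.+1 in consG pert *.
  have [pP _] := velE 0%N (ltn0Sn _); have [p'P _] := velE N.+1 (ltnSn _).
  have Bz := sub4 z zb.
  have [_ vC _ _ _] := L1 z z p p Bz Bz pP pP.
  set v := (pgrad2 (in_chart G a)) z p in vC *.
  have nv : `|D *: v| = D * `|v| by rewrite normrZ gtr0_norm.
  have Dv : D * `|v| <= Num.min dG (r / 8).
    by apply: le_trans DC1; rewrite ler_wpM2l ?(ltW Dp)//; move: vC; clear; lra.
  have Bz' : box y0 r (z + D *: v).
    rewrite /box /= addrAC; apply: (le_trans (ler_normD _ _)); rewrite nv.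
    have : D * `|v| <= r / 8 by apply: (le_trans Dv); rewrite ge_min lexx orbT.
    by move: zb r0; rewrite /box /=; clear; lra.
  have by' : box y0 (r / 4) y' by have [] := inb (i.+1%:R * D) (iI i.+1 im).
  have pB1 : box y0 r (x1 0%N + D *: v) by rewrite x10.
  have pB2 : box y0 r (x1 N.+2 + (y' - y)) by rewrite x1N addrC subrK; exact: sub4.
  have [x' [cx' x'0 x'N cost']] := pert (D *: v) (y' - y) pB1 pB2.
  rewrite x10 in x'0; rewrite x1N addrC subrK in x'N.
  rewrite pairingZr nv in cost'.
  have unif' w : i%:R * D <= w <= i.+1%:R * D -> `|fwd a (c w) - y| <= Num.min (e / L) (e * K / (Cb + 1)).
    move=> /andP[w1 w2]; apply: unif => //; first exact: le_trans w2 j1.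
    by apply: (@le_lt_trans _ _ (i.+1%:R * D - i%:R * D)); [rewrite lerB|rewrite ijD].
  have By : box y0 r y by apply: sub4; have [] := inb (i%:R * D) (iI i (ltnW im)).
  have lowp : pairing p' (y' - y) - ((ham G a) y p' + e) * D <= al (i.+1%:R * D) - al (i%:R * D).
    rewrite -[X in _ * X]ijD; apply: lowG => // w wI.
    have Bw : box y0 r (fwd a (c w)).
      apply: sub4; have [] // := inb w; have /andP[w1 w2] := wI.
      by rewrite (le_trans i0)// (le_trans w2).
    have l1 := lipG y (fwd a (c w)) p' By Bw p'P.
    have l2 : L * `|fwd a (c w) - y| <= e.
      by rewrite mulrC -ler_pdivlMr//; apply: (le_trans (unif' w wI)); rewrite ge_min lexx.
    by rewrite -[leLHS]/((ham G a) (fwd a (c w)) p') -lerBlDl; exact: le_trans (ler_norm _) (le_trans l1 l2).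
  have lowx := lowK _ _ i0 ij j1; rewrite ijD -/y -/y' in lowx.
  have nx : `|y' - y| <= e * K / (Cb + 1).
    apply: (le_trans (unif' (i.+1%:R * D) _)); first by rewrite ij lexx.
    by rewrite ge_min lexx orbT.
  set da := al (i.+1%:R * D) - al (i%:R * D) in lowp lowx.
  (* Of the two factors [|y' - y|], one is small by uniform continuity, and the other is at most
     [(da + CK * D) / K]. No bound of the order of [D] is available for an absolutely continuous
     curve. *)
  have Cbx : Cb * `|y' - y| ^+ 2 <= e * (da + CK * D).
    apply: (@le_trans _ _ (e * (K * `|y' - y|))); last by rewrite ler_wpM2l// ltW.
    rewrite expr2 !mulrA ler_wpM2r//.
    rewrite ler_pdivlMr// in nx; apply: le_trans nx.
    by have := normr_ge0 (y' - y); move: Cb0; clear; lra.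
  have Cbv : Cb * (D * `|v|) ^+ 2 <= D * e.
    rewrite (_ : Cb * _ = D * (D * (Cb * `|v| ^+ 2))); last by rewrite exprMn !expr2; ring.
    rewrite ler_wpM2l ?(ltW Dp)//; apply: le_trans DCb; rewrite ler_wpM2l ?(ltW Dp)//.
    have : Cb * `|v| ^+ 2 <= Cb * C1 ^+ 2 by rewrite ler_wpM2l// !expr2 ler_pM.
    by clear; lra.
  have GG : (ham G a) y p' - (ham G a) z p <= e.
    by rewrite x10 x1N in consG; exact: le_trans (ler_norm _) consG.
  have lowp2 : pairing p' (y' - y) - D * ((ham G a) y p' + e) <= da by rewrite (mulrC D).
  (* The chain gains [D * pairing p v] at its start, and the new [G]-piece costs
     [D * (pairing p v - G z p)]: the pairings cancel. By conservation [- G z p] is about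
     [- G y p'], and [pairing p' (y' - y) - D * G y p'] is at most the action [da] of the given
     piece by the Fenchel inequality [lowp]. *)
  have arith := swap_step_arith (pairing p v) h U (ltW Dp) (ltW e0) vC lowp2 GG Cbx Cbv.
  exists (z + D *: v), x', (U + D * (pairing p v - (ham G a) z p)),
    (h - D * pairing p v + pairing p' (y' - y) + e * (D * `|v|) + Cb * ((D * `|v|) ^+ 2 + `|y' - y| ^+ 2)).
  split.
  - by split => //; apply: (le_lt_trans cost'); move: ch1; clear; lra.
  - have vE : D^-1 *: (z + D *: v - z) = v.
      by rewrite addrC addKr scalerA mulVf ?gt_eqF// scale1r.
    have kst : (kern g G D (bwd a z) (bwd a (z + D *: v)) <= (D * (pairing p v - (ham G a) z p + e))%:E)%E.
      apply: (up_kern gb Dp Bz Bz') => w wI q'; rewrite vE; apply: upG => //.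
        exact: box_convex.
      have /andP[w0 w1] := wI.
      rewrite addrC addKr normrZ (ger0_norm w0) addrC addKr nv.
      apply: (@le_trans _ _ (D * `|v|)); first by rewrite ler_piMl// mulr_ge0// ltW.
      by apply: (le_trans Dv); rewrite ge_min lexx.
    have kst' : (kern g G D (bwd a z) (bwd a (z + D *: v)) < (D * (pairing p v - (ham G a) z p + 2 * e))%:E)%E.
      by apply: (le_lt_trans kst); rewrite lte_fin ltr_pM2l// ltrD2l; move: e0; clear; lra.
    have := kern_cat tG i0 (ltW Dp) kG kst'; rewrite -ijE.
    congr (_ < _)%E; congr EFin; rewrite ijE; ring.
  - have lv := ham_velocity_low hG K0 HKG p Bz; rewrite -/v in lv.
    have lv' := ler_wpM2l (ltW Dp) lv.
    have tri : `|z + D *: v - zc| <= D * `|v| + `|z - zc|.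
      rewrite -nv (_ : z + D *: v - zc = D *: v + (z - zc)); first exact: ler_normD.
      by rewrite addrA (addrC (D *: v)).
    have := ler_wpM2l (ltW K0) tri; rewrite ijE.
    by move: KU lv'; clear; lra.
  - apply: (le_trans arith); rewrite /err.
    have -> : be (i.+1%:R * D) = be (i%:R * D) + (da + CK * D).
      by rewrite /be /da ijE; ring.
    have E3 : i.+1%:R * D * (e * (3 + C1)) = i%:R * D * (e * (3 + C1)) + D * (e * (3 + C1)).
      by rewrite ijE; ring.
    by rewrite E3 /da; move: hU; rewrite /err; clear; lra.
have [z [x [U [h [[cx xz xN ch] kG KU hU]]]]] := steps m.+1 (leqnn _).
have [zb hb] := near m.+1 z x U h (leqnn _) cx ch KU hU.
have xb : box y0 (r / 4) (x 0%N) by rewrite xz.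
have [x1 [q [[cx1 mq ch1] [x10 x1N] velE _ _]]] := cl x h cx xb ch hb.
rewrite Dms in xN kG hU.
have := final_chain gb tH P10 P1P e0 b0 cx1 mq velE _.
rewrite bN x10 x1N xz xN fwdK; last by have [] := inb s; rewrite ?(ltW s0)/=.
move=> fin; exists (bwd a z), (U + s * (2 * e) + e), (h + t * (2 * e) + e); split => //.
  apply: lt_trans (fin _) _; last by rewrite lte_fin; move: ch1; clear; lra.
  move=> w w' p' q' Bw Bw' ww pP; apply: upH => //; apply: (le_trans ww).
  have [_ vC _ _ _] := L2 w w p' p' Bw Bw pP pP.
  by apply: le_trans bC2; rewrite ler_wpM2l ?(ltW b0)//; move: vC; clear; lra.
have ee := errW m.+1 (leqnn _).
by move: hU ee eWs als e0; clear; lra.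
Qed.

(** * Uniform exchange near a point, and exchange over a grid *)

Section global_swap.
Context (R : realType) (n : nat) (M : topologicalType) (X : C2manifold R n M).
Variable g : riemannian X.
Implicit Types (H G : hamiltonian X) (x y z w : M) (c : R -> M).

Lemma act_prefix H c (B T h u : R) : tonelli g H -> 0 <= B ->
  (forall x (v : tangent X x), ((- B)%:E <= lagrangian H v)%E) ->
  (act H c 0 T < h%:E)%E -> 0 <= u <= T -> (act H c 0 u <= (h + B * T)%:E)%E.
Proof.
move=> tH B0 HB l /andP[u0 uT]; have T0 := le_trans u0 uT.
have [al [al0 alE]] := act_real tH T0 l.
have := act_lb c uT HB; move: l; rewrite !alE// al0 !subr0 !lee_fin lte_fin.
have : B * (T - u) <= B * T by rewrite ler_wpM2l// lerBlDr lerDl.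
lra.
Qed.

Lemma local_swap G H (p0 : M) (A0 : R) : tonelli g G -> tonelli g H -> poisson_commute G H ->
  exists U : set M, exists tau : R, [/\ nbhs p0 U, 0 < tau & forall z y x (t s h1 h2 : R), U z ->
    0 < t -> t < tau -> 0 < s -> s < tau ->
    (kern g H t z y < h1%:E)%E -> (kern g G s y x < h2%:E)%E -> h1 + h2 <= A0 ->
    forall e : R, 0 < e -> exists (z' : M) (u v : R), [/\ (kern g G s z z' < u%:E)%E,
    (kern g H t z' x < v%:E)%E & u + v < h1 + h2 + e]].
Proof.
move=> tG tH PC.
have [a [y0 [r [k [gb [d0 f0]]]]]] := goodbox_exists g p0.
have [aa [r0 k0] bt hk1 hk2] := gb.
have [BH BH0 lbH] := lagrangian_lb tH; have [BG BG0 lbG] := lagrangian_lb tG.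
pose A := `|A0|; have AA : A0 <= A by exact: ler_norm.
have A00 : 0 <= A by exact: normr_ge0.
(* With this slope an action budget of [A + 4] allows a displacement of at most [k * r / 128] in
   [reach], hence [r / 32] in coordinates. *)
pose K1 := 128 * (A + 4) / (k * r).
have kr : 0 < k * r by rewrite mulr_gt0.
have K10 : 0 < K1 by rewrite divr_gt0// mulr_gt0// ltr_wpDl.
have K1E : K1 * (k * (r / 128)) = A + 4.
  rewrite /K1 (_ : k * (r / 128) = k * r / 128); last by rewrite mulrA.
  rewrite mulrACA -mulrA; field; rewrite gt_eqF//=.
  by rewrite gt_eqF.
have [CH CH0 rH] := act_reach tH K10; have [CG CG0 rG] := act_reach tG K10.
pose K := 8 * (A + 9) / r.
have K0 : 0 < K by rewrite divr_gt0// mulr_gt0// ltr_wpDl.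
have KE : K * (r / 8) = A + 9 by rewrite /K; field; rewrite gt_eqF.
have [_ _ /(_ K (ltW K0))[C1 [m1 [C10 _ L1]]]] := chart_local_ham tH gb.
have [_ _ /(_ K (ltW K0))[C2 [m2 [C20 _ L2]]]] := chart_local_ham tG gb.
pose CK := C1 + C2; have CK0 : 0 <= CK by exact: addr_ge0.
have HK (z : 'rV[R]_n) (p : 'cV[R]_n) : box y0 r z -> `|p| <= K -> ham H a z p <= CK /\ ham G a z p <= CK.
  move=> Bz pK; have [[l1 _] _ _ _ _] := L1 z z p p Bz Bz pK pK.
  have [[l2 _] _ _ _ _] := L2 z z p p Bz Bz pK pK.
  have := ler_norm (ham H a z p); have := ler_norm (ham G a z p); rewrite /CK; move: l1 l2 C10 C20; clear => *; split; lra.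
(* For times below [S^-1], each of the constants times a time is at most 1. Thus the budgets [A + 4]
   and [A + 9], fixed before these constants were known, suffice. *)
pose S := 1 + BH + BG + CH + CG + CK.
have S1 : 1 <= S by rewrite /S; move: BH0 BG0 CH0 CG0 CK0; clear; lra.
have S0 : 0 < S by apply: lt_le_trans S1.
exists (dom a `&` (fun m => `|fwd a m - y0| < r / 32)), S^-1; split.
- apply: filterI; first exact: nbhs_dom.
  have nb : nbhs (fwd a p0) [set w : 'rV[R]_n | `|w - y0| < r / 32].
    rewrite f0; apply/nbhs_ballP; exists (r / 32); first by rewrite /= divr_gt0.
    by move=> w; rewrite -ball_normE /= distrC.
  exact: (fwd_cvg d0 nb).
- by rewrite invr_gt0.
move=> z y x t s h1 h2 [dz bz] t0 tt s0 ss kH kG hA e e0.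
have sm (C u : R) : 0 <= C -> C <= S -> 0 < u -> u < S^-1 -> C * u <= 1.
  move=> C0 CS u0 uS; apply: (@le_trans _ _ (S * u)); first by rewrite ler_wpM2r// ltW.
  by rewrite -ler_pdivlMl// mulr1 ltW.
have [BHS [BGS [CHS [CGS CKS]]]] : BH <= S /\ BG <= S /\ CH <= S /\ CG <= S /\ CK <= S.
  by rewrite /S; move: BH0 BG0 CH0 CG0 CK0; clear => *; do !split; lra.
have q1 := sm _ _ BH0 BHS t0 tt; have q2 := sm _ _ BG0 BGS s0 ss.
have q3 := sm _ _ CH0 CHS t0 tt; have q4 := sm _ _ CG0 CGS s0 ss.
have q5 := sm _ _ CK0 CKS t0 tt; have q6 := sm _ _ CK0 CKS s0 ss.
have lH : - 1 < h1.
  by rewrite -lte_fin; apply: le_lt_trans kH; apply: le_trans (kern_lb g z y (ltW t0) lbH); rewrite lee_fin lerN2.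
have lG : - 1 < h2.
  by rewrite -lte_fin; apply: le_lt_trans kG; apply: le_trans (kern_lb g y x (ltW s0) lbG); rewrite lee_fin lerN2.
have [_ [c1 [ac1 c10 c1t] <-] l1] := ereal_inf_lt kH.
have [_ [c2 [ac2 c20 c2s] <-] l2] := ereal_inf_lt kG.
have pre1 u (uI : 0 <= u <= t) := act_prefix tH BH0 lbH l1 uI.
have pre2 u (uI : 0 <= u <= s) := act_prefix tG BG0 lbG l2 uI.
have dz1 : dom a (c1 0) by rewrite c10.
have bz1 : box y0 (r / 4) (fwd a (c1 0)) by rewrite c10 /box /=; move: bz r0; clear; lra.
have bd1 : h1 + BH * t + CH * t < K1 * (k * (r / 128)).
  by rewrite K1E; move: AA hA lG q1 q3; clear; lra.
have in1 := curve_in_box gb K10 tH CH0 rH ac1 pre1 bd1 dz1 bz1.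
have in1' u : 0 <= u <= t -> dom a (c1 u) /\ `|fwd a (c1 u) - y0| <= r / 16.
  move=> /in1[du]; rewrite c10 => hu; split => //.
  rewrite (_ : fwd a (c1 u) - y0 = (fwd a (c1 u) - fwd a z) + (fwd a z - y0)); last by rewrite addrA subrK.
  by apply: (le_trans (ler_normD _ _)); move: hu bz; clear; lra.
have [dy by_] : dom a y /\ `|fwd a y - y0| <= r / 16.
  by rewrite -c1t; apply: in1'; rewrite lexx ltW.
have dy2 : dom a (c2 0) by rewrite c20.
have by2 : box y0 (r / 4) (fwd a (c2 0)) by rewrite c20 /box /=; move: by_ r0; clear; lra.
have bd2 : h2 + BG * s + CG * s < K1 * (k * (r / 128)).
  by rewrite K1E; move: AA hA lH q2 q4; clear; lra.
have in2 := curve_in_box gb K10 tG CG0 rG ac2 pre2 bd2 dy2 by2.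
have in2' u : 0 <= u <= s -> dom a (c2 u) /\ box y0 (r / 8) (fwd a (c2 u)).
  move=> /in2[du]; rewrite c20 => hu; split => //; rewrite /box /=.
  rewrite (_ : fwd a (c2 u) - y0 = (fwd a (c2 u) - fwd a y) + (fwd a y - y0)); last by rewrite addrA subrK.
  by apply: (le_trans (ler_normD _ _)); move: hu by_ r0; clear; lra.
have in14 u : 0 <= u <= t -> dom a (c1 u) /\ box y0 (r / 4) (fwd a (c1 u)).
  by move=> /in1'[? hu]; split => //; rewrite /box /=; move: hu r0; clear; lra.
have start (P e' : R) : 0 <= P -> 0 < e' -> exists N0, forall N, (N0 <= N)%N -> exists x : nat -> 'rV[R]_n,
     [/\ chain y0 r N.+2 x, x 0%N = fwd a z, x N.+2 = fwd a (c2 0) &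
       cost (ham H a) P (t / N.+2%:R) N.+2 x < h1 + e'].
  move=> P0 e'0; have et : 0 < e' / t by rewrite divr_gt0.
  have [N0 HN] := start_chain gb tH P0 et t0 ac1 in14 l1; exists N0 => N NN.
  have [xx [cx x0 xN xc]] := HN N NN; exists xx; rewrite c20 -c1t -c10; split => //.
  by move: xc; rewrite mulrCA mulfV ?gt_eqF// mulr1.
have bz8 : box y0 (r / 8) (fwd a z) by rewrite /box /=; move: bz r0; clear; lra.
have size : h1 + h2 + 3 * (CK * (t + s)) + 3 <= K * (r / 8).
  by rewrite KE; move: AA hA q5 q6; clear; lra.
have [z' [u [v [ku kv uv]]]] := swap_chain gb tG tH PC t0 s0 K0 CK0 HK start ac2 in2' l2 bz8 size e0.
by exists z', u, v; rewrite fwdK// in ku; rewrite c2s in kv; split.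
Qed.

Section grid.
Variables (G H : hamiltonian X) (tG : tonelli g G) (tH : tonelli g H).
Variables (C1 K CK A s t eps Tmax : R) (z : M).
Hypotheses (s0 : 0 < s) (t0 : 0 < t) (eps0 : 0 < eps).
Hypothesis lbH : forall x y (T h : R), 0 <= T -> (kern g H T x y < h%:E)%E -> - (C1 * T) < h.
Hypothesis lbG : forall x y (T h : R), 0 <= T -> (kern g G T x y < h%:E)%E -> - (C1 * T) < h.
Hypothesis rH : forall x y (T h : R), 0 <= T -> (kern g H T x y < h%:E)%E ->
  exists V, reach g x V y /\ K * V <= h + CK * T.
Hypothesis rG : forall x y (T h : R), 0 <= T -> (kern g G T x y < h%:E)%E ->
  exists V, reach g x V y /\ K * V <= h + CK * T.

(** [h] and [T] stand for the action and the time spent on the way from [z] to [w]; only the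
    resulting bound on the length is recorded. *)
Definition budget w (h T : R) := exists V, reach g z V w /\ K * V <= h + CK * T.

(** The exchange succeeds on the small rectangle at [w] with loss [eps]. The terms in [C1]
    compensate for negative kernels: with them the condition on the total cost passes to the parts
    of a path. *)
Definition good w := forall y x (h1 h2 : R), (kern g H t w y < h1%:E)%E ->
  (kern g G s y x < h2%:E)%E -> h1 + h2 + C1 * (s + t) + eps <= A ->
  exists (z' : M) (u v : R), [/\ (kern g G s w z' < u%:E)%E,
    (kern g H t z' x < v%:E)%E & u + v < h1 + h2 + eps].

Hypothesis allgood : forall w h T, budget w h T -> h + C1 * T <= A -> T <= Tmax -> good w.

(** The [G]-step is carried across the [H]-pieces from the last one to the first one, and each
    exchange loses [eps]. The starting point of each elementary square lies on the original
    [H]-path, so its budget is known. *)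
Lemma grid_row i w y x (h T h1 h2 : R) : budget w h T ->
  (kern g H (i.+1%:R * t) w y < h1%:E)%E -> (kern g G s y x < h2%:E)%E ->
  0 <= h + C1 * T -> h + h1 + h2 + C1 * (T + i.+1%:R * t + s) + i.+1%:R * eps <= A ->
  T + i.+1%:R * t <= Tmax ->
  exists (z' : M) (u v : R), [/\ (kern g G s w z' < u%:E)%E,
    (kern g H (i.+1%:R * t) z' x < v%:E)%E & u + v < h1 + h2 + i.+1%:R * eps].
Proof.
elim: i w y x h T h1 h2 => [|i IH] w y x h T h1 h2 bw kH kG hT hA TT.
  rewrite !mul1r in kH hA TT *; apply: (allgood bw _ _ kH kG).
  - have := lbH (ltW t0) kH; have := lbG (ltW s0) kG.
    by move: hA eps0; rewrite !mulrDr; lra.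
  - by apply: le_trans TT; rewrite lerDl ltW.
  - by move: hA hT; rewrite !mulrDr; lra.
have it0 : 0 <= i.+1%:R * t by rewrite mulr_ge0// ltW.
have itE : i.+2%:R * t = i.+1%:R * t + t by rewrite -[i.+2%:R]natr1; ring.
have ieE : i.+2%:R * eps = i.+1%:R * eps + eps by rewrite -[i.+2%:R]natr1; ring.
rewrite itE in kH hA TT *; rewrite ieE in hA *.
have [w1 [k1 [k2 [kw kw1 kk]]]] := kern_split tH it0 (ltW t0) kH.
have [V [rV KV]] := rH it0 kw.
have bw1 : budget w1 (h + k1) (T + i.+1%:R * t).
  have [V0 [rV0 KV0]] := bw; exists (V0 + V); split; first exact: reach_cat rV0 rV.
  by rewrite !mulrDr; move: KV KV0; lra.
have lk1 := lbH it0 kw; have lk2 := lbH (ltW t0) kw1; have lh2 := lbG (ltW s0) kG.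
have ie0 : 0 < i.+1%:R * eps by rewrite mulr_gt0// ltr0n.
have g1 : h + k1 + C1 * (T + i.+1%:R * t) <= A.
  by move: hA lk2 lh2 kk eps0 ie0; rewrite !mulrDr; lra.
have g2 : T + i.+1%:R * t <= Tmax by apply: le_trans TT; rewrite addrA lerDl ltW.
have [|w' [u [v [ku kv uv]]]] := allgood bw1 g1 g2 kw1 kG.
  by move: hA hT lk1 kk ie0; rewrite !mulrDr; lra.
have lv := lbH (ltW t0) kv.
have [| |z' [u' [v' [ku' kv' uv']]]] := IH w w1 w' h T k1 u bw kw ku hT.
- by move: hA lv uv kk; rewrite !mulrDr; lra.
- exact: g2.
exists z', u', (v' + v); split => //; first exact: (kern_cat tH it0 (ltW t0) kv' kv).
by move: uv uv' kk; lra.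
Qed.

(** The [G]-pieces are carried one after the other across the whole [H]-path, beginning with the
    first. The budget grows along the new [G]-path, since the next row starts at its current end.
    The loss counts the squares. *)
Lemma grid_col i j w y x (h T h1 h2 : R) : budget w h T ->
  (kern g H (i.+1%:R * t) w y < h1%:E)%E -> (kern g G (j.+1%:R * s) y x < h2%:E)%E ->
  0 <= h + C1 * T ->
  h + h1 + h2 + C1 * (T + i.+1%:R * t + j.+1%:R * s) + j.+1%:R * (i.+1%:R * eps) <= A ->
  T + i.+1%:R * t + j.+1%:R * s <= Tmax ->
  exists (z' : M) (u v : R), [/\ (kern g G (j.+1%:R * s) w z' < u%:E)%E,
    (kern g H (i.+1%:R * t) z' x < v%:E)%E & u + v < h1 + h2 + j.+1%:R * (i.+1%:R * eps)].
Proof.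
have it0 : 0 <= i.+1%:R * t by rewrite mulr_ge0// ltW.
have ie0 : 0 < i.+1%:R * eps by rewrite mulr_gt0// ltr0n.
elim: j w y x h T h1 h2 => [|j IH] w y x h T h1 h2 bw kH kG hT hA TT.
  rewrite !mul1r in kG hA TT *; apply: (grid_row bw kH kG hT hA).
  by apply: le_trans TT; rewrite lerDl ltW.
have js0 : 0 <= j.+1%:R * s by rewrite mulr_ge0// ltW.
have jsE : j.+2%:R * s = s + j.+1%:R * s by rewrite -[j.+2%:R]natr1; ring.
have jeE : j.+2%:R * (i.+1%:R * eps) = j.+1%:R * (i.+1%:R * eps) + i.+1%:R * eps.
  by rewrite -[j.+2%:R]natr1; ring.
rewrite jsE in kG hA TT *; rewrite jeE in hA *.
have je0 : 0 < j.+1%:R * (i.+1%:R * eps) by rewrite mulr_gt0// ltr0n.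
have [y1 [k1 [k2 [ky ky1 kk]]]] := kern_split tG (ltW s0) js0 kG.
have l1 := lbG (ltW s0) ky; have l2 := lbG js0 ky1; have l3 := lbH it0 kH.
have [| |w' [u [v [ku kv uv]]]] := grid_row bw kH ky hT.
- by move: hA l2 kk je0; rewrite !mulrDr; lra.
- by apply: le_trans TT; rewrite lerDl addr_ge0// ltW.
have lu := lbG (ltW s0) ku; have lv := lbH it0 kv.
have [V [rV KV]] := rG (ltW s0) ku.
have bw' : budget w' (h + u) (T + s).
  have [V0 [rV0 KV0]] := bw; exists (V0 + V); split; first exact: reach_cat rV0 rV.
  by rewrite !mulrDr; move: KV KV0; lra.
have [| | |z' [u' [v' [ku' kv' uv']]]] := IH w' y1 x (h + u) (T + s) v k2 bw' kv ky1.
- by move: hT lu; rewrite !mulrDr; lra.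
- by move: hA uv kk; rewrite !mulrDr; lra.
- by move: TT; lra.
exists z', (u + u'), v'; split => //; first exact: (kern_cat tG (ltW s0) js0 ku ku').
by move: uv uv' kk; lra.
Qed.

End grid.
End global_swap.

(** * Descent to small squares, and the semigroups *)

Section assembly.
Context (R : realType) (n : nat) (M : topologicalType) (X : C2manifold R n M).
Variable g : riemannian X.
Implicit Types (G H : hamiltonian X) (x y z w : M) (c : R -> M).

Lemma kern_bounds G H : tonelli g G -> tonelli g H -> forall K : R, 0 < K -> exists2 C : R, 0 <= C &
  [/\ (forall x y (T h : R), 0 <= T -> (kern g H T x y < h%:E)%E -> - (C * T) < h),
    (forall x y (T h : R), 0 <= T -> (kern g G T x y < h%:E)%E -> - (C * T) < h),
    (forall x y (T h : R), 0 <= T -> (kern g H T x y < h%:E)%E ->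
      exists V, reach g x V y /\ K * V <= h + C * T) &
    (forall x y (T h : R), 0 <= T -> (kern g G T x y < h%:E)%E ->
      exists V, reach g x V y /\ K * V <= h + C * T)].
Proof.
move=> tG tH K K0.
have [BH BH0 lbH] := lagrangian_lb tH; have [BG BG0 lbG] := lagrangian_lb tG.
have [CH CH0 rH] := kern_reach tH K0; have [CG CG0 rG] := kern_reach tG K0.
exists (BH + BG + CH + CG); first by rewrite !addr_ge0.
have mono (C T : R) : C <= BH + BG + CH + CG -> 0 <= T -> C * T <= (BH + BG + CH + CG) * T.
  by move=> *; rewrite ler_wpM2r.
split => x y T h T0 l.
- rewrite -lte_fin; apply: le_lt_trans l; apply: le_trans (kern_lb g x y T0 lbH).
  by rewrite lee_fin lerN2 mono//; lra.
- rewrite -lte_fin; apply: le_lt_trans l; apply: le_trans (kern_lb g x y T0 lbG).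
  by rewrite lee_fin lerN2 mono//; lra.
- have [V [rV KV]] := rH x y T h T0 l; exists V; split => //; apply: (le_trans KV).
  by rewrite lerD2l mono//; lra.
- have [V [rV KV]] := rG x y T h T0 l; exists V; split => //; apply: (le_trans KV).
  by rewrite lerD2l mono//; lra.
Qed.

(** The lengths from the index [k] on add up to at most [2 * 2^-1 ^+ k]; the factor 4 of
    [reach_rdist] turns the 2 into the 8 below. *)
Lemma reach_Cauchy (z : nat -> M) : rcomplete g ->
  (forall k, exists V, reach g (z k) V (z k.+1) /\ V <= 2^-1 ^+ k) -> exists p : M, z @ \oo --> p.
Proof.
move=> rc Hz; apply: rc => e e0.
have far k l : exists V, reach g (z k) V (z (k + l)%N) /\ V <= 2 * 2^-1 ^+ k - 2 * 2^-1 ^+ (k + l).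
  elim: l => [|l [V [rV hV]]]; first by exists 0; rewrite addn0 subrr; split => //; exact: reach0.
  have [W [rW hW]] := Hz (k + l)%N; exists (V + W); rewrite addnS; split; first exact: reach_cat rV rW.
  by rewrite exprS; lra.
have [N HN] : exists N : nat, 8 * 2^-1 ^+ N < e.
  have e8 : 0 <= 8 / e by rewrite divr_ge0// ltW.
  exists (Num.bound (8 / e)); have b1 := archi_boundP e8; set N := Num.bound _ in b1 *.
  rewrite exprVn ltr_pdivrMr ?exprn_gt0// -ltr_pdivrMl// [ltLHS]mulrC.
  apply: (lt_trans b1); rewrite -natrX ltr_nat; exact: ltn_expl.
have bnd i l : (N <= i)%N -> exists V, reach g (z i) V (z (i + l)%N) /\ 4 * V < e.
  move=> Ni; have [V [rV hV]] := far i l; exists V; split => //; apply: le_lt_trans HN.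
  have : 2^-1 ^+ i <= 2^-1 ^+ N :> R.
    by apply: ler_wiXn2l => //; rewrite ?invr_ge0// invf_le1// ler1n.
  have : 0 <= 2^-1 ^+ (i + l) :> R by rewrite exprn_ge0// invr_ge0.
  lra.
exists N => i j Ni Nj; have [ij|/ltnW ji] := leqP i j.
  have [V [rV hV]] := bnd i (j - i)%N Ni; rewrite subnKC// in rV.
  by apply: le_lt_trans (reach_rdist rV) _; rewrite lte_fin.
have [V [rV hV]] := bnd j (i - j)%N Nj; rewrite subnKC// in rV.
by apply: le_lt_trans (reach_rdist (reach_sym rV)) _; rewrite lte_fin.
Qed.

Lemma kern_swap G H : tonelli g G -> tonelli g H -> poisson_commute G H -> rcomplete g ->
  forall z y x (t s h1 h2 : R), 0 < t -> 0 < s ->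
    (kern g H t z y < h1%:E)%E -> (kern g G s y x < h2%:E)%E ->
    forall e : R, 0 < e -> exists (z' : M) (u v : R), [/\ (kern g G s z z' < u%:E)%E,
    (kern g H t z' x < v%:E)%E & u + v < h1 + h2 + e].
Proof.
move=> tG tH PC rc z y x t s h1 h2 t0 s0 kH kG e e0.
have [C1 C10 [lbH lbG _ _]] := kern_bounds tG tH ltr01.
pose A := h1 + h2 + C1 * (s + t) + e.
have A0 : 0 < A.
  by have := lbH _ _ _ _ (ltW t0) kH; have := lbG _ _ _ _ (ltW s0) kG; rewrite /A mulrDr; lra.
pose sz (N : nat) (u : R) := u / N.+1%:R.
(* The loss is divided by the square of the number of pieces, as the area of the rectangle is: then
   the losses of the squares of a finer grid add up to the loss allowed for the coarse rectangle. *)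
pose Good (N : nat) w := good g G H C1 A (sz N s) (sz N t) (e / N.+1%:R ^+ 2) w.
have [g0|bad0] := pselect (Good 0%N z).
  have := g0 y x h1 h2; rewrite /sz !divr1 expr1n divr1; apply => //.
exfalso.
have sz0 N u : 0 < u -> 0 < sz N u by move=> u0; rewrite divr_gt0// ltr0n.
have szD N u : 0 < u -> 0 <= sz N u by move=> u0; exact: ltW (sz0 N u u0).
have st0 : 0 < s + t by exact: addr_gt0.
(* If all the points within the budget from a bad point were good at a finer level, [grid_col] would
   make this point good. So there is a bad point at a level as fine as desired, and its distance is
   controlled with any prescribed slope [K]. *)
have refine (p : nat * M) (K C d : R) : 0 <= C -> 0 < d ->
    (forall x y (T h : R), 0 <= T -> (kern g H T x y < h%:E)%E ->
      exists V, reach g x V y /\ K * V <= h + C * T) ->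
    (forall x y (T h : R), 0 <= T -> (kern g G T x y < h%:E)%E ->
      exists V, reach g x V y /\ K * V <= h + C * T) -> ~ Good p.1 p.2 ->
    exists p' : nat * M, [/\ ~ Good p'.1 p'.2, sz p'.1 (s + t) <= d &
      exists V : R, reach g p.2 V p'.2 /\ K * V <= A + (C + C1) * sz p.1 (s + t)].
  case: p => N w /= C0 d0 rH rG bad; apply: contrapT => none.
  have [J HJ] := mesh st0 d0.
  pose N' := (N.+1 * J.+1).-1.
  have N'E : N'.+1 = (N.+1 * J.+1)%N by [].
  have N0 : N.+1%:R != 0 :> R by rewrite pnatr_eq0.
  have J0 : J.+1%:R != 0 :> R by rewrite pnatr_eq0.
  have szE u : J.+1%:R * sz N' u = sz N u.
    have aux (p q : R) : p != 0 -> q != 0 -> q * (u / (p * q)) = u / p by move=> p0 q0; field; rewrite p0 q0.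
    by rewrite /sz N'E natrM; exact: aux.
  have epsE : J.+1%:R * (J.+1%:R * (e / N'.+1%:R ^+ 2)) = e / N.+1%:R ^+ 2.
    have aux (p q : R) : p != 0 -> q != 0 -> q * (q * (e / (p * q) ^+ 2)) = e / p ^+ 2.
      by move=> p0 q0; field; rewrite p0 q0.
    by rewrite N'E natrM; exact: aux.
  have szd : sz N' (s + t) <= d.
    apply: le_trans HJ; rewrite /sz ler_wpM2l ?(ltW st0)// lef_pV2 ?posrE ?ltr0n// ler_nat N'E.
    by rewrite leq_pmull.
  have mono (T : R) : 0 <= T -> C * T <= (C + C1) * T by move=> T0; rewrite ler_wpM2r// lerDl.
  have rH' x' y' (T h : R) : 0 <= T -> (kern g H T x' y' < h%:E)%E ->
      exists V, reach g x' V y' /\ K * V <= h + (C + C1) * T.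
    move=> T0 l; have [V [rV KV]] := rH x' y' T h T0 l; exists V; split => //.
    by apply: (le_trans KV); rewrite lerD2l mono.
  have rG' x' y' (T h : R) : 0 <= T -> (kern g G T x' y' < h%:E)%E ->
      exists V, reach g x' V y' /\ K * V <= h + (C + C1) * T.
    move=> T0 l; have [V [rV KV]] := rG x' y' T h T0 l; exists V; split => //.
    by apply: (le_trans KV); rewrite lerD2l mono.
  have allgood w' (h T : R) : budget g K (C + C1) w w' h T -> h + C1 * T <= A ->
      T <= sz N (s + t) -> good g G H C1 A (sz N' s) (sz N' t) (e / N'.+1%:R ^+ 2) w'.
    move=> [V [rV KV]] hA TT; apply: contrapT => bad'; apply: none; exists (N', w'); split => //=.
    exists V; split => //; apply: (le_trans KV).
    have : C * T <= C * sz N (s + t) by rewrite ler_wpM2l.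
    have : 0 <= C1 * sz N (s + t) by rewrite mulr_ge0// szD.
    rewrite !mulrDl; move: hA; clear; lra.
  have eN : 0 < e / N'.+1%:R ^+ 2 by rewrite divr_gt0// exprn_gt0// ltr0n.
  apply: bad => y' x' k1 k2 kk1 kk2 kA.
  have := @grid_col R n M X g G H tG tH C1 K (C + C1) A (sz N' s) (sz N' t) (e / N'.+1%:R ^+ 2) (sz N (s + t)) w
    (sz0 _ _ s0) (sz0 _ _ t0) eN lbH lbG rH' rG' allgood J J w y' x' 0 0 k1 k2.
  rewrite !szE epsE => col; apply: col => //.
  - by exists 0; split; [exact: reach0|rewrite !mulr0 addr0].
  - by rewrite mulr0 addr0.
  - by rewrite !add0r (addrC (sz N t)).
  - by rewrite add0r /sz -mulrDl (addrC t).
have Kpos k : 0 < 2 * A * 2 ^+ k by rewrite !mulr_gt0// exprn_gt0.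
pose Pk (k : nat) (C : R) := 0 <= C /\
    ((forall x y (T h : R), 0 <= T -> (kern g H T x y < h%:E)%E ->
      exists V, reach g x V y /\ 2 * A * 2 ^+ k * V <= h + C * T) /\
    (forall x y (T h : R), 0 <= T -> (kern g G T x y < h%:E)%E ->
      exists V, reach g x V y /\ 2 * A * 2 ^+ k * V <= h + C * T)).
have [Cf HCf] : {Cf : nat -> R & forall k, Pk k (Cf k)}.
  apply: (@choice nat R Pk) => k.
  have [C C0 [_ _ rH rG]] := kern_bounds tG tH (Kpos k).
  by exists C.
(* At stage [k] the slope is [2 * A * 2 ^+ k], and [Cf k] comes with it. The mesh of that stage is
   made small beforehand, so that [(Cf k + C1)] times the mesh is at most [A] and the next
   displacement at most [2^-1 ^+ k]. The second bound sends the meshes to 0. *)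
pose del k := Num.min (A / (Cf k + C1 + 1)) k.+1%:R^-1.
have Cf1 k : 0 < Cf k + C1 + 1 by have [c0 _] := HCf k; rewrite ltr_wpDl// addr_ge0.
have del0 k : 0 < del k by rewrite lt_min divr_gt0//= invr_gt0 ltr0n.
pose P k (p : nat * M) := ~ Good p.1 p.2 /\ sz p.1 (s + t) <= del k.
have [f Hf] : {f : nat * (nat * M) -> nat * M & forall kp, P kp.1 kp.2 ->
    P kp.1.+1 (f kp) /\ exists V, reach g kp.2.2 V (f kp).2 /\ V <= 2^-1 ^+ kp.1}.
  apply: (@choice _ _ (fun kp p' => P kp.1 kp.2 -> P kp.1.+1 p' /\
    exists V, reach g kp.2.2 V p'.2 /\ V <= 2^-1 ^+ kp.1)) => -[k p] /=.
  have [[bad szp]|nP] := pselect (P k p); last by exists p.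
  have [C0 [rH rG]] := HCf k.
  have [p' [bad' szp' [V [rV KV]]]] := refine p _ _ _ C0 (del0 k.+1) rH rG bad.
  exists p' => _; split => //; exists V; split => //.
  have h1' : (Cf k + C1) * sz p.1 (s + t) <= A.
    apply: (@le_trans _ _ ((Cf k + C1 + 1) * sz p.1 (s + t))).
      by rewrite ler_wpM2r ?szD// lerDl.
    rewrite -ler_pdivlMl// mulrC; apply: (le_trans szp); by rewrite ge_min lexx.
  have : 2 * A * 2 ^+ k * V <= 2 * A by apply: (le_trans KV); move: h1'; clear; lra.
  rewrite -mulrA -[leRHS]mulr1 ler_pM2l ?mulr_gt0// exprVn => h2'.
  by rewrite -[leRHS]mul1r ler_pdivlMr ?exprn_gt0// mulrC.
have [C0 [rH0 rG0]] := HCf 0%N.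
(* A first refinement brings the mesh below [del 0]; the sequence starts from the bad point that it
   yields. *)
have [p0 [badp0 szp0 _]] := refine (0%N, z) _ _ _ C0 (del0 0%N) rH0 rG0 bad0.
pose p := fix p k := match k with 0%N => p0 | k'.+1 => f (k', p k') end.
have Pp k : P k (p k).
  by elim: k => [|k IH]; [split|have [h _] := Hf (k, p k) IH; exact: h].
have [pl pcv] : exists pl : M, (fun k => (p k).2) @ \oo --> pl.
  apply: (reach_Cauchy rc) => k; have [_ [V [rV hV]]] := Hf (k, p k) (Pp k).
  by exists V.
(* The exchange works for all small times on a whole neighbourhood of the limit, with any loss; this
   contradicts the badness of late terms of the sequence. *)
have [U [tau [nU tau0 Hsw]]] := local_swap pl A tG tH PC.
have [N1 _ HN1] := pcv _ nU.
have t1 : 0 <= tau^-1 by rewrite invr_ge0 ltW.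
pose k := maxn N1 (Num.bound tau^-1).
have Uk : U (p k).2 by apply: HN1; rewrite /= leq_maxl.
have [badk szk] := Pp k.
have szt : sz (p k).1 (s + t) < tau.
  apply: (le_lt_trans szk); rewrite gt_min; apply/orP; right.
  rewrite -[tau]invrK ltf_pV2 ?posrE ?invr_gt0 ?ltr0n//.
  apply: (lt_le_trans (archi_boundP t1)); rewrite ler_nat; apply: leq_trans (leqnSn _).
  exact: leq_maxr.
have szDD : sz (p k).1 (s + t) = sz (p k).1 s + sz (p k).1 t by rewrite /sz mulrDl.
have sk := sz0 (p k).1 _ s0; have tk := sz0 (p k).1 _ t0.
apply: badk => y' x' k1 k2 kk1 kk2 kA.
have eN : 0 < e / (p k).1.+1%:R ^+ 2 by rewrite divr_gt0// exprn_gt0// ltr0n.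
apply: (Hsw _ y' x' _ _ k1 k2 Uk tk _ sk _ kk1 kk2 _ _ eN).
- by move: szt sk; rewrite szDD; clear; lra.
- by move: szt tk; rewrite szDD; clear; lra.
- apply: le_trans kA; rewrite -addrA lerDl; apply: addr_ge0; last exact: ltW.
  by rewrite mulr_ge0// addr_ge0// ltW.
Qed.

Lemma lax_le_kern H (t h : R) (u : M -> \bar R) z y : (kern g H t z y < h%:E)%E ->
  (lax_oleinik g H t u y <= u z + h%:E)%E.
Proof.
move=> /ereal_inf_lt[_ [c [ac c0 ct] <-] /ltW l].
apply: (@le_trans _ _ (u (c 0%R) + act H c 0 t)%E); last by rewrite c0; exact: leeD2l.
by apply: ereal_inf_lbound; exists c.
Qed.

(** The exchange of kernels is transferred to infima of [u] plus kernels, first for the [H]-curve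
    and then for the [G]-curve. The work is in the infinite values of [u] and of the action. *)
Lemma lax_swap_le G H : tonelli g G -> tonelli g H -> poisson_commute G H -> rcomplete g ->
  connected [set: M] -> forall (u : M -> \bar R) (s t : R), 0 < s -> 0 < t -> forall x,
  (lax_oleinik g H t (lax_oleinik g G s u) x <= lax_oleinik g G s (lax_oleinik g H t u) x)%E.
Proof.
move=> tG tH PC rc cM u s t s0 t0 x; set L := lax_oleinik g H t _ x.
have kfin (F : hamiltonian X) y z (T : R) : tonelli g F -> 0 < T -> exists h : R, (kern g F T y z < h%:E)%E.
  move=> tF T0; have := kern_fin tF cM y z T0; have [B _ HB] := lagrangian_lb tF.
  have := kern_lb g y z (ltW T0) HB.
  by case: (kern g F T y z) => [r| |] // _ _; exists (r + 1); rewrite lte_fin ltrDl.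
have sw z y (h1 h2 : R) : (kern g H t z y < h1%:E)%E -> (kern g G s y x < h2%:E)%E ->
    (L <= u z + (h1 + h2)%:E)%E.
  move=> k1 k2; apply/lee_addgt0Pr => e e0.
  have [z' [a [b [ka kb ab]]]] := kern_swap tG tH PC rc t0 s0 k1 k2 e0.
  apply: (le_trans (lax_le_kern _ kb)); apply: (@le_trans _ _ (u z + a%:E + b%:E)%E).
    by rewrite leeD2r//; exact: lax_le_kern.
  by rewrite -!addeA; apply: leeD2l; rewrite -!EFinD lee_fin ltW.
have actlb (F : hamiltonian X) c (T : R) : tonelli g F -> 0 < T -> act F c 0 T != -oo%E.
  move=> tF T0; have [B _ HB] := lagrangian_lb tF; have := act_lb c (ltW T0) HB.
  by case: (act F c 0 T).
have kact (F : hamiltonian X) c (T al e : R) : abs_cont_curve g 0 T c -> act F c 0 T = al%:E -> 0 < e ->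
    (kern g F T (c 0%R) (c T) < (al + e)%:E)%E.
  move=> ac E e0; apply: (@le_lt_trans _ _ (act F c 0 T)); last by rewrite E lte_fin ltrDl.
  by have := kern_le_act F ac; rewrite subr0.
have half y (h2 : R) : (kern g G s y x < h2%:E)%E -> (L <= lax_oleinik g H t u y + h2%:E)%E.
  move=> k2; rewrite -leeBlDr//; apply: le_ereal_inf_tmp => _ [c [ac cy] <-].
  rewrite leeBlDr// -/(act H c 0 t).
  case E : (act H c 0 t) (actlb H c t tH t0) => [al| |] // _.
    apply/lee_addgt0Pr => e e0; have k1 := kact H c t al e ac E e0; rewrite cy in k1.
    apply: (le_trans (sw _ _ _ _ k1 k2)); rewrite -!addeA; apply: leeD2l.
    by rewrite -!EFinD lee_fin; lra.
  (* The action is [+oo]. If [u (c 0)] is [-oo], the sum is [-oo] by convention, but a path of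
     finite action from the same point, which exists by connectedness, shows that [L] is [-oo] as
     well. Otherwise the upper bound is [+oo]. *)
  have [h1 k1] := kfin H (c 0%R) y t tH t0; have := sw _ _ _ _ k1 k2.
  by case: (u (c 0%R)) => [r| |] //; rewrite ?leey.
apply: le_ereal_inf_tmp => _ [c [ac cx] <-]; rewrite -/(act G c 0 s).
case E : (act G c 0 s) (actlb G c s tG s0) => [al| |] // _.
  apply/lee_addgt0Pr => e e0; have k2 := kact G c s al e ac E e0; rewrite cx in k2.
  by have := half _ _ k2; rewrite EFinD addeA.
have [h2 k2] := kfin G (c 0%R) x s tG s0; have := half _ _ k2.
by case: (lax_oleinik g H t u (c 0%R)) => [r| |] //; rewrite ?leey.
Qed.

Lemma poisson_commute_sym G H : poisson_commute G H -> poisson_commute H G.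
Proof.
move=> PC a aa z az xi eta h1 h2; have := PC a aa z az eta xi h2 h1.
by rewrite !OmegaE => h; rewrite -[LHS]opprK opprB h oppr0.
Qed.

End assembly.

Unset Implicit Arguments.

Theorem theorem0p1 (R : realType) (n : nat) (M : topologicalType)
    (X : C2manifold R n M) (g : riemannian X) (G H : hamiltonian X)
    (Mconn : connected [set: M]) (Mcomplete : rcomplete g)
    (tonG : tonelli g G) (tonH : tonelli g H) (comGH : poisson_commute G H)
    (u : M -> \bar R) (s t : R) (s0 : 0 < s) (t0 : 0 < t) :
  lax_oleinik g G s (lax_oleinik g H t u) = lax_oleinik g H t (lax_oleinik g G s u).
Proof.
apply/funext => x; apply/eqP; rewrite eq_le; apply/andP; split.
  exact: (lax_swap_le tonH tonG (poisson_commute_sym comGH) Mcomplete Mconn u t0 s0).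
exact: (lax_swap_le tonG tonH comGH Mcomplete Mconn u s0 t0).
Qed.
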